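(* Let $A\in\mathbb{Z}^{m\times m}$ be a positive definite symmetric matrix, $\alpha\in\mathbb{N}_0$, and $p$ the polynomial defined as $p(U)=\exp\bigl(-\operatorname{tr}\mathbf{\Delta}_A/8\pi\bigr)\bigl(P(U)\bigr)$ with $P\in\mathcal{P}^{m,n}_\alpha$. For $H,K\in\mathbb{R}^{m\times n}$ and $Z=X+iY\in\mathbb{H}_n$ let $$\vartheta_{H,K}(Z)=\det Y^{-\alpha/2}\sum_{U\in H+\mathbb{Z}^{m\times n}}p(UY^{1/2})\,\mathrm{e}\bigl(\operatorname{tr}(U^{T}AUZ)/2+\operatorname{tr}(K^{T}AU)\bigr).$$ Then $$\vartheta_{H,K}(-Z^{-1})=i^{-mn/2}\,\det A^{-n/2}\,\det Z^{m/2+\alpha}\,\mathrm{e}\bigl(\operatorname{tr}(H^{T}AK)\bigr)\sum_{J\in A^{-1}\mathbb{Z}^{m\times n}\bmod\mathbb{Z}^{m\times n}}\vartheta_{J+K,-H}(Z).$$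
   Context: $\mathrm{e}(z):=\exp(2\pi i z)$; $1/8\pi$ means $1/(8\pi)$. $\mathbb{H}_n=\{Z=X+iY: X,Y\in\mathbb{R}^{n\times n}\text{ symmetric},\ Y\text{ positive definite}\}$; $Y^{1/2}$ is the symmetric positive definite square root of $Y$. $\mathcal{P}^{m,n}_\alpha$ is the complex vector space of polynomials $P:\mathbb{C}^{m\times n}\to\mathbb{C}$ with $P(UN)=(\det N)^\alpha P(U)$ for all $N\in\mathbb{C}^{n\times n}$. The polynomial $p$ is taken as a function $p:\mathbb{R}^{m\times n}\to\mathbb{R}$. $\operatorname{tr}\mathbf{\Delta}_A=\sum_{\nu=1}^n\sum_{\mu,\rho=1}^m\frac{\partial}{\partial U_{\mu\nu}}(A^{-1})_{\mu\rho}\frac{\partial}{\partial U_{\rho\nu}}$, and $\exp(c\operatorname{tr}\mathbf{\Delta}_A)(P)=\sum_{k\ge0}\frac{c^k}{k!}(\operatorname{tr}\mathbf{\Delta}_A)^kP$ (a finite sum). Powers: $\det Z^{k}$ means $(\det Z)^k$ (likewise for $A$ and $Y$), and for $z\in\mathbb{C}$ and any non-integer exponent $k$, $z^k:=\exp(k\log z)$ with $\log z=\log|z|+i\arg(z)$, $-\pi<\arg(z)\le\pi$. The sum over $J$ runs over representatives of $A^{-1}\mathbb{Z}^{m\times n}$ modulo $\mathbb{Z}^{m\times n}$.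
   Formalization: The power det Z^{m/2+α} is taken as the product of the principal powers of the eigenvalues of Z (the holomorphic branch on H_n), not the principal power of the number det Z, for which the formula fails, e.g. at m=1, n=3, A=1, α=0, P=1, H=K=0, Z=i·1. *)

(* Defs.v *)
From HB Require Import structures.
From mathcomp Require Import all_boot all_order all_algebra complex.
From mathcomp Require Import all_classical all_reals all_analysis.
From mathcomp Require Import summability.
From mathcomp Require Import ring.
From mathcomp Require mpoly.
Import (canonicals, coercions) mpoly.
Import numFieldNormedType.Exports.
Import Order.TTheory GRing.Theory Num.Theory.

Set Implicit Arguments.
Unset Strict Implicit.
Unset Printing Implicit Defensive.

Local Open Scope classical_set_scope.
Local Open Scope ring_scope.
Local Open Scope complex_scope.

Section ComplexFunctions.
Variable R : realType.
Implicit Types z k : R[i].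

Definition cexp z : R[i] :=
  (expR (complex.Re z) * cos (complex.Im z))
    +i* (expR (complex.Re z) * sin (complex.Im z)).

Definition cmod z : R := Num.sqrt (complex.Re z ^+ 2 + complex.Im z ^+ 2).

(* The principal argument, in ]-pi, pi]. *)
Definition carg z : R :=
  let t := acos (complex.Re z / cmod z) in
  if 0 <= complex.Im z then t else - t.

Definition clog z : R[i] := ln (cmod z) +i* carg z.

Definition cpow z k : R[i] := cexp (k * clog z).

Definition e2pi z : R[i] := cexp (2 * (pi%:C) * 'i * z).

Lemma cexpD z k : cexp (z + k) = cexp z * cexp k.
Proof.
case: z k => [a b] [c d]; rewrite /cexp /= expRD cosD sinD.
by apply/eqP; rewrite eq_complex /=; apply/andP; split; apply/eqP; ring.
Qed.

Lemma cexpMn z j : cexp (z *+ j) = cexp z ^+ j.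
Proof.
elim: j => [|j IH]; last by rewrite mulrS exprS cexpD IH.
by rewrite mulr0n expr0 /cexp /= expR0 cos0 sin0 mulr1 mulr0.
Qed.

Lemma clogK z : z != 0 -> cexp (clog z) = z.
Proof.
move=> z0; have r0 : 0 < cmod z.
  rewrite sqrtr_gt0 lt_neqAle addr_ge0 ?sqr_ge0// andbT eq_sym.
  by rewrite paddr_eq0 ?sqr_ge0// !sqrf_eq0; move: z0; rewrite eq_complex.
have r2 : cmod z ^+ 2 = complex.Re z ^+ 2 + complex.Im z ^+ 2.
  by rewrite sqr_sqrtr// addr_ge0 ?sqr_ge0.
have ble : -1 <= complex.Re z / cmod z <= 1.
  rewrite -ler_norml normrM (gtr0_norm (x := (cmod z)^-1)) ?invr_gt0//.
  rewrite ler_pdivrMr// mul1r -sqrtr_sqr ler_wsqrtr// lerDl sqr_ge0 //.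
have bin : complex.Re z / cmod z \in `[(-1), 1]%R by rewrite in_itv.
have sinE : sin (acos (complex.Re z / cmod z)) = `|complex.Im z| / cmod z.
  rewrite sin_acos// expr_div_n r2.
  rewrite -{1}(@divff _ (cmod z ^+ 2)) ?expf_neq0 ?gt_eqF// {1}r2 -r2 -mulrBl.
  rewrite [X in (X - _)]r2 addrC addKr sqrtrM ?sqr_ge0// sqrtr_sqr.
  by rewrite -exprVn sqrtr_sqr (gtr0_norm (x := (cmod z)^-1))// invr_gt0.
have rK x : cmod z * (x / cmod z) = x by rewrite mulrC divfK// gt_eqF.
rewrite /clog /cexp /= lnK ?posrE// /carg; apply/eqP; rewrite eq_complex /=.
apply/andP; split; case: ifPn => I0.
- by rewrite acosK// rK.
- by rewrite cosN acosK// rK.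
- by rewrite sinE rK ger0_norm.
- by rewrite sinN sinE mulrN rK ltr0_norm ?opprK// ltNge.
Qed.

Lemma cpow_nat z j : z != 0 -> cpow z j%:R = z ^+ j.
Proof. by move=> z0; rewrite /cpow mulr_natl cexpMn clogK. Qed.

End ComplexFunctions.

Section Matrices.
Variable R : realType.

Definition toCmx p q (M : 'M[R]_(p, q)) : 'M[R[i]]_(p, q) :=
  map_mx (real_complex R) M.

Definition posdefmx p (M : 'M[R]_p) : Prop :=
  forall x : 'cV[R]_p, x != 0 -> 0 < (x^T *m M *m x) ord0 ord0.

Definition sqrtmx p (Y : 'M[R]_p) : 'M[R]_p :=
  xget 0 [set S | [/\ S^T = S, posdefmx S & S *m S = Y]].

Definition Immx p (Z : 'M[R[i]]_p) : 'M[R]_p := map_mx (@complex.Im R) Z.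

(* [Z^T = Z] says that the real and the imaginary part are both symmetric. *)
Definition siegel p : set 'M[R[i]]_p := [set Z | Z^T = Z /\ posdefmx (Immx Z)].

(* Listed with algebraic multiplicity. *)
Definition eigenvalues p (Z : 'M[R[i]]_p) : seq R[i] :=
  sval (closed_field_poly_normal (char_poly Z)).

(* The holomorphic branch of (det Z)^k on the Siegel upper half-space. The
   eigenvalues of such a Z lie in the upper half-plane, so their principal
   powers vary holomorphically; the branch is the one whose value at
   i * 1 is i^(p k). It is the ordinary power when k is a natural number
   ([det_cpow_nat]) and the principal power when p = 1 ([det_cpow_dim1]). For
   p >= 2 and non-integer k the principal power of the number det Z jumps
   where det Z crosses the negative real axis, and the theta transformation
   formula fails for it: at m = 1, A = 1, H = K = 0, P = 1, Z = i * 1, n = 3,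
   it would give theta = - theta with theta > 0. *)
Definition det_cpow p (Z : 'M[R[i]]_p) (k : R[i]) : R[i] :=
  \prod_(z <- eigenvalues Z) cpow z k.

Lemma prod_eigenvalues p (Z : 'M[R[i]]_p) :
  \prod_(z <- eigenvalues Z) z = \det Z.
Proof.
rewrite /eigenvalues; case: closed_field_poly_normal => s /= sE.
move: sE; rewrite (monicP (char_poly_monic Z)) scale1r => sE.
have szE : size s = p.
  by apply: succn_inj; rewrite -(size_char_poly Z) sE size_prod_XsubC.
have := char_poly_det Z; rewrite sE coef0_prod.
rewrite (eq_bigr (fun z => -1 * z)); last first.
  by move=> z _; rewrite coefB coefX coefC eqxx sub0r mulN1r.
rewrite big_split /= big_const_seq count_predT szE iter_mulr_1 => H.
by apply: (can_inj (signrMK p)).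
Qed.

Lemma det_cpow_nat p (Z : 'M[R[i]]_p) j :
  \det Z != 0 -> det_cpow Z j%:R = (\det Z) ^+ j.
Proof.
rewrite -prod_eigenvalues -prodrXl prodf_seq_neq0 => /allP nz.
by apply: eq_big_seq => z /nz /= z0; rewrite cpow_nat.
Qed.

Lemma det_cpow_dim1 (Z : 'M[R[i]]_1) k : det_cpow Z k = cpow (\det Z) k.
Proof.
rewrite -prod_eigenvalues /det_cpow.
have : size (eigenvalues Z) = 1.
  rewrite /eigenvalues; case: closed_field_poly_normal => s /= sE.
  apply: succn_inj; rewrite -(size_char_poly Z) sE.
  by rewrite (monicP (char_poly_monic Z)) scale1r size_prod_XsubC.
by case: (eigenvalues Z) => [|z [|]] // _; rewrite !big_seq1.
Qed.

End Matrices.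

Section Polynomials.
Variables (R : realType) (m n : nat).

(* The variable of index [mxvec_index mu nu] stands for the entry U_(mu, nu). *)
Notation mxpoly := (mpoly.mpoly (m * n) R[i]).

Definition mxeval (P : mxpoly) (U : 'M[R[i]]_(m, n)) : R[i] :=
  mpoly.meval (fun j => mxvec U ord0 j) P.

Definition det_homog (alpha : nat) : set mxpoly :=
  [set P | forall (U : 'M[R[i]]_(m, n)) (N : 'M[R[i]]_n),
    mxeval P (U *m N) = (\det N) ^+ alpha * mxeval P U].

Definition dvar (mu : 'I_m) (nu : 'I_n) (P : mxpoly) : mxpoly :=
  mpoly.mderiv (mxvec_index mu nu) P.

Definition tr_laplacian (A : 'M[int]_m) (P : mxpoly) : mxpoly :=
  \sum_(nu < n) \sum_(mu < m) \sum_(rho < m)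
    dvar mu nu ((invmx (map_mx intr A) mu rho : R[i]) *: dvar rho nu P).

(* Each application of the Laplacian lowers the degree by 2, so the terms of
   index [msize P] = deg P + 1 and beyond vanish. *)
Definition exp_tr_laplacian (c : R[i]) (A : 'M[int]_m) (P : mxpoly) : mxpoly :=
  \sum_(k < mpoly.msize P) (c ^+ k / (k`!)%:R) *: iter k (tr_laplacian A) P.

End Polynomials.

Section Theta.
Variables (R : realType) (m n : nat).

(* [sum] is the unconditional sum: the limit of the finite partial sums along
   the directed set of finite subsets of the index type. *)
Definition theta (A : 'M[int]_m) (alpha : nat) (p : mpoly.mpoly (m * n) R[i])
    (H K : 'M[R]_(m, n)) (Z : 'M[R[i]]_n) : R[i] :=
  let AR : 'M[R]_m := map_mx intr A in
  let Y := Immx Z in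
  ((\det Y) `^ (- (alpha%:R / 2)))%:C *
  sum (fun N : 'M[int]_(m, n) =>
    let U := H + map_mx intr N in
    mxeval p (toCmx (U *m sqrtmx Y)) *
    e2pi (\tr (toCmx (U^T *m AR *m U) *m Z) / 2
          + (\tr (K^T *m AR *m U))%:C) : (R[i])^o).

Definition integral_mx (V : 'M[R]_(m, n)) : Prop :=
  exists N : 'M[int]_(m, n), V = map_mx intr N.

Definition dual_mx (A : 'M[int]_m) (V : 'M[R]_(m, n)) : Prop :=
  exists N : 'M[int]_(m, n), V = invmx (map_mx intr A) *m map_mx intr N.

(* [s] lists, without repetition, one representative of each class of
   A^-1 Z^(m x n) modulo Z^(m x n). *)
Definition coset_reps (A : 'M[int]_m) (s : seq 'M[R]_(m, n)) : Prop :=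
  [/\ uniq s,
      {in s, forall J, dual_mx A J},
      {in s &, forall J J', integral_mx (J - J') -> J = J'}
    & forall V, dual_mx A V -> exists2 J, J \in s & integral_mx (V - J)].

End Theta.

(* Main.v *)
Require Import Defs.
From HB Require Import structures.
From mathcomp Require Import all_boot all_order all_algebra complex.
From mathcomp Require Import all_classical all_reals all_analysis.
From mathcomp Require Import summability finmap.
From mathcomp Require Import ring lra zify.
From mathcomp Require mpoly.
Import (canonicals, coercions) mpoly.
Import Order.TTheory GRing.Theory Num.Theory.
Import Normc.
Import numFieldNormedType.Exports.
Set Implicit Arguments.
Unset Strict Implicit.
Unset Printing Implicit Defensive.
Local Open Scope classical_set_scope.
Local Open Scope ring_scope.
Local Open Scope complex_scope.

(** By vectorisation the formula becomes a statement on Z^d, d = mn, with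
W = - A (x) Z^-1: the Jacobi identity on the Siegel space

  sum_N e(W[N]/2 + N.z) = kappa(W) sum_N e(- W^-1[N + z]/2),

completed by a polynomial factor.

In dimension one, let f(x) = exp(- pi rho^2 (x + z)^2) and q = 2p + 1. By
orthogonality of the q-th roots of unity, the Riemann sums of step 1/q of
f(x) e(- k x), |k| <= p, add up exactly to the sum of f over Z. After completing
the square, each is an explicit factor times a Riemann sum of a Gaussian, and
following a path of parameters in steps of 1/q shows that the latter depends on
its complex parameters only up to O(1/q), apart from the factor rho. Second
differences dominate the sums by O(1/k^2), so p may tend to infinity.

Dimension d follows by induction through Schur complements. As
kappa(W)^2 det W = i^d, continuity along a path from the purely imaginary
matrices identifies kappa(W) with the principal powers.

For the polynomial factor, insert e(N.k), shift k by t e_j and compare the terms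
of first order in t: multiplication by X_j on one side is X_j + 2 (tau grad)_j
on the other, tau = - W^-1/(4 pi i), which is the rule for the heat operator
exp(tau-Laplacian). As Im(- Z^-1)^-1 = Z Y^-1 Z - 2iZ, the heat operators compose
to the one of - A^-1 (x) (Z Y^-1 Z)/(8 pi), which the homogeneity of P turns into
(det Z)^alpha times the one of - A^-1 (x) Y^-1/(8 pi). *)

Local Notation Re := complex.Re.
Local Notation Im := complex.Im.

(** * Unconditional sums and the complex exponential *)

(** The Riemann sums stay comparable because a Gaussian moved along the path of its parameters
    changes by an exact derivative in x, up to second order in the step, and the sum of such a
    derivative over the grid telescopes. The step of the path equals the mesh, so q steps with an
    error O(1/q^2) each cost O(1/q) in total. The common limit of the sums, classically the Gaussian
    integral, is read off from the limiting identity itself at W = i and z = 0, where both sides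
    carry the same nonzero theta value.

    The obstacle on the side of determinants is that induction on d produces a product of roots over
    the pivots of symmetric elimination, whereas the formula to be proved speaks of the eigenvalues
    of Z. The two products have the same square, and only a connectedness argument decides the sign
    between them.

    In the identity with a polynomial, the shift h of the lattice may stay fixed, but the character
    k must remain free through the whole induction, since each new factor X_j comes from a variation
    of k. The constant 8 pi in the definition of p is the one for which the term of the composed
    heat operator that is linear in Z cancels. *)

Lemma eqC (R : realType) (z w : R[i]) : Re z = Re w -> Im z = Im w -> z = w.
Proof. by case: z w => ? ? [? ?] /= -> ->. Qed.

Lemma le_of_eq (R : realType) (x y : R) : x = y -> x <= y.
Proof. by move=> ->. Qed.

Lemma Immx_sym (R : realType) n (M : 'M[R[i]]_n) : M^T = M -> (Immx M)^T = Immx M.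
Proof. by move=> Ms; apply/matrixP => i j; rewrite !mxE -{1}Ms mxE. Qed.

Section Summation.
Variable R : realType.
Local Notation C := R[i].
Implicit Types T : choiceType.

(** For a nonnegative family this is summability. It passes through domination, products and
    injections without any mention of a limit. *)
Definition bsum T (g : T -> R) : Prop :=
  exists M, forall A : {fset T}, \sum_(i <- A) g i <= M.

(** The epsilon form of the limit along finite subsets, in which all estimates are made; [hasum_sum]
    translates it into [sum]. *)
Definition hasum T (f : T -> C) (s : C) : Prop :=
  forall e : R, 0 < e -> exists A : {fset T}, forall B : {fset T},
    (A `<=` B)%fset -> normc (\sum_(i <- B) f i - s) < e.

Lemma normc_ge0 (z : C) : 0 <= normc z.
Proof. by case: z => a b /=; exact: sqrtr_ge0. Qed.

Lemma normc_sum I (r : seq I) (P : pred I) (f : I -> C) :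
  normc (\sum_(i <- r | P i) f i) <= \sum_(i <- r | P i) normc (f i).
Proof.
elim/big_rec2: _ => [|i y x _ le_yx]; first by rewrite normc0.
by apply: le_trans (le_normcD _ _) _; rewrite lerD2l.
Qed.

Lemma normc_real (x : R) : normc x%:C = `|x|.
Proof. by rewrite /= expr0n addr0 sqrtr_sqr. Qed.

Lemma le_normc_sub (x y z : C) : normc (x - z) <= normc (x - y) + normc (y - z).
Proof. by apply: le_trans (le_normcD _ _); rewrite subrKA. Qed.

Lemma normc_subC (x y : C) : normc (x - y) = normc (y - x).
Proof. by rewrite -normcN opprB. Qed.

Lemma normc_leRI (z : C) : normc z <= `|Re z| + `|Im z|.
Proof.
rewrite {1}[z]complexE; apply: le_trans (le_normcD _ _) _.
rewrite normcM !normc_real lerD2l.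
by rewrite /= expr0n expr1n add0r sqrtr1 mul1r.
Qed.

Lemma normc_Re_le (z : C) : `|Re z| <= normc z.
Proof.
case: z => a b /=; rewrite -[ `|a| ]sqrtr_sqr ler_wsqrtr //.
by rewrite lerDl sqr_ge0.
Qed.

Lemma normc_Im_le (z : C) : `|Im z| <= normc z.
Proof.
case: z => a b /=; rewrite -[ `|b| ]sqrtr_sqr ler_wsqrtr //.
by rewrite lerDr sqr_ge0.
Qed.

Lemma bsum_le T (g h : T -> R) : (forall t, h t <= g t) -> bsum g -> bsum h.
Proof.
move=> hg [M HM]; exists M => A; apply: le_trans (HM A).
by apply: ler_sum => i _.
Qed.

Lemma bsumZ T (c : R) (g : T -> R) : 0 <= c -> bsum g -> bsum (fun t => c * g t).
Proof.
move=> c0 [M HM]; exists (c * M) => A; rewrite -mulr_sumr.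
exact: ler_wpM2l.
Qed.

Lemma bsumD T (g h : T -> R) : bsum g -> bsum h -> bsum (fun t => g t + h t).
Proof.
move=> [M HM] [N HN]; exists (M + N) => A; rewrite big_split /=.
exact: lerD.
Qed.

Lemma bsum_inj T T' (g : T -> R) (h : T' -> T) :
  injective h -> bsum g -> bsum (fun t => g (h t)).
Proof.
move=> hI [M HM]; exists M => A.
have := HM [fset h x | x in A]%fset.
by rewrite big_imfset //= => x y _ _; exact: hI.
Qed.

Lemma sum_sub_fset T (g : T -> R) (A B : {fset T}) :
  (forall t, 0 <= g t) -> (A `<=` B)%fset ->
  \sum_(i <- A) g i <= \sum_(i <- B) g i.
Proof.
move=> g0 AB; rewrite [leRHS](big_fsetID _ (mem A)) /=.
have -> : [fset x in B | x \in A]%fset = A.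
  apply/fsetP => x; rewrite !inE /=; case xA: (x \in A); rewrite ?andbF//.
  by rewrite (fsubsetP AB).
by rewrite lerDl sumr_ge0.
Qed.

Lemma big_fsetM T1 T2 (V : nmodType) (F : T1 * T2 -> V)
    (A : {fset T1}) (B : {fset T2}) :
  \sum_(p <- (A `*` B)%fset) F p = \sum_(x <- A) \sum_(y <- B) F (x, y).
Proof. by rewrite big_imfset2 //= => -[? ?] [? ?] _ _ /= [-> ->]. Qed.

Lemma bsum_prod T1 T2 (g : T1 -> R) (h : T2 -> R) :
  (forall t, 0 <= g t) -> (forall t, 0 <= h t) ->
  bsum g -> bsum h -> bsum (fun p : T1 * T2 => g p.1 * h p.2).
Proof.
move=> g0 h0 [M HM] [N HN]; exists (M * N) => A.
set A1 := [fset x.1 | x in A]%fset; set A2 := [fset x.2 | x in A]%fset.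
have sub : (A `<=` A1 `*` A2)%fset.
  apply/fsubsetP => -[x y] xyA; rewrite in_fsetM /=.
  by apply/andP; split; apply/imfsetP; exists (x, y).
apply: le_trans (sum_sub_fset _ sub) _ => [[x y]|]; first exact: mulr_ge0.
rewrite big_fsetM /=.
rewrite (eq_bigr (fun x => g x * \sum_(y <- A2) h y)); last first.
  by move=> x _; rewrite mulr_sumr.
rewrite -mulr_suml; apply: ler_pM => //; exact: sumr_ge0.
Qed.

Lemma bsum_tail T (g : T -> R) (e : R) : (forall t, 0 <= g t) ->
  bsum g -> 0 < e ->
  exists A : {fset T}, forall B : {fset T}, [disjoint A & B]%fset ->
    \sum_(i <- B) g i < e.
Proof.
move=> g0 [M HM] e0.
pose S := [set x : R | exists A : {fset T}, x = \sum_(i <- A) g i].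
have hS : has_sup S.
  split; first by exists (\sum_(i <- fset0) g i); exists fset0.
  by exists M => _ [A ->]; exact: HM.
have [x [A ->] xA] := sup_adherent e0 hS.
exists A => B dAB.
have : \sum_(i <- (A `|` B)%fset) g i <= sup S.
  by apply: sup_upper_bound => //; exists (A `|` B)%fset.
rewrite (big_fsetID _ (mem A)) /=.
have -> : [fset x in (A `|` B) | x \in A]%fset = A.
  by apply/fsetP => y; rewrite !inE /=; case: (y \in A); rewrite ?andbF.
have -> : [fset x in (A `|` B) | x \notin A]%fset = B.
  apply/fsetP => y; rewrite !inE /=; case yA: (y \in A); rewrite ?andbF ?andbT//.
  by move/fdisjointP : dAB => /(_ _ yA) /negbTE ->.
lra.
Qed.

Lemma hasum_real T (g : T -> R) : (forall t, 0 <= g t) -> bsum g ->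
  exists s : R, hasum (fun t => (g t)%:C) s%:C.
Proof.
move=> g0 [M HM].
pose S := [set x : R | exists A : {fset T}, x = \sum_(i <- A) g i].
have hS : has_sup S.
  split; first by exists (\sum_(i <- fset0) g i); exists fset0.
  by exists M => _ [A ->]; exact: HM.
exists (sup S) => e e0; have [x [A ->] xA] := sup_adherent e0 hS.
exists A => B AB; rewrite -rmorph_sum -rmorphB normc_real /=.
have h1 := sum_sub_fset g0 AB.
have h2 : \sum_(i <- B) g i <= sup S.
  by apply: sup_upper_bound => //; exists B.
by rewrite ler0_norm ?subr_le0//; lra.
Qed.

Lemma hasumD T (f g : T -> C) s t : hasum f s -> hasum g t ->
  hasum (fun x => f x + g x) (s + t).
Proof.
move=> fs gt e e0; have e20 : 0 < e / 2 by lra.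
have [A HA] := fs _ e20; have [B HB] := gt _ e20.
exists (A `|` B)%fset => D; rewrite fsubUset => /andP[AD BD].
rewrite big_split /= opprD addrACA; apply: le_lt_trans (le_normcD _ _) _.
have := HA _ AD; have := HB _ BD; lra.
Qed.

Lemma hasumZ T (c : C) (f : T -> C) s : hasum f s ->
  hasum (fun x => c * f x) (c * s).
Proof.
move=> fs e e0; have c0 := normc_ge0 c.
have d0 : 0 < e / (normc c + 1) by rewrite divr_gt0//; lra.
have [A HA] := fs _ d0; exists A => B /HA.
rewrite -mulr_sumr -mulrBr normcM ltr_pdivlMr; last lra.
apply: le_lt_trans; rewrite mulrC ler_wpM2l ?normc_ge0//; lra.
Qed.

Lemma eq_hasum T (f g : T -> C) s : f =1 g -> hasum f s -> hasum g s.
Proof. by move=> /funext ->. Qed.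

Lemma hasumB T (f g : T -> C) s t : hasum f s -> hasum g t ->
  hasum (fun x => f x - g x) (s - t).
Proof.
move=> fs /(hasumZ (-1)) gt; rewrite -mulN1r.
by apply: eq_hasum (hasumD fs gt) => x; rewrite mulN1r.
Qed.

(** A real family h with |h| <= |f| is the difference of the nonnegative families |f| + h and |f|,
    whose finite sums are bounded; this applies to the real and the imaginary part of f. *)
Lemma hasum_exists T (f : T -> C) : bsum (fun t => normc (f t)) ->
  exists s, hasum f s.
Proof.
move=> bf.
have bg (h : T -> R) : (forall t, `|h t| <= normc (f t)) ->
    exists s : R, hasum (fun t => (h t)%:C) s%:C.
  move=> hf.
  have [s1 H1] : exists s : R, hasum (fun t => (normc (f t) + h t)%:C) s%:C.
    apply: hasum_real => [t|]; first by have := hf t; rewrite ler_norml; lra.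
    apply: bsum_le (bsumZ _ bf) => [t|]; last exact: (ler0n _ 2).
    by have := hf t; rewrite ler_norml; lra.
  have [s2 H2] : exists s : R, hasum (fun t => (normc (f t))%:C) s%:C.
    by apply: hasum_real => // t; exact: normc_ge0.
  exists (s1 - s2); rewrite rmorphB.
  by apply: eq_hasum (hasumB H1 H2) => t; rewrite -rmorphB /= addrC addKr.
have [s1 H1] := bg (fun t => Re (f t)) (fun t => normc_Re_le _).
have [s2 H2] := bg (fun t => Im (f t)) (fun t => normc_Im_le _).
exists (s1%:C + 'i * s2%:C).
by apply: eq_hasum (hasumD H1 (hasumZ 'i H2)) => t; rewrite -complexE.
Qed.

Lemma hasum_unique T (f : T -> C) s t : hasum f s -> hasum f t -> s = t.
Proof.
move=> fs ft; apply/eqP; rewrite -subr_eq0; apply/eqP/eq0_normc/eqP.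
rewrite eq_le normc_ge0 andbT leNgt; apply/negP => n0.
have n20 : 0 < normc (s - t) / 2 by lra.
have [A HA] := fs _ n20; have [B HB] := ft _ n20.
have := HA _ (fsubsetUl A B); have := HB _ (fsubsetUr A B).
set x := (X in normc (X - _)).
have := le_normc_sub s x t; rewrite (normc_subC s x); lra.
Qed.

Lemma hasum_le T (f : T -> C) s (M : R) : hasum f s ->
  (forall A : {fset T}, \sum_(i <- A) normc (f i) <= M) -> normc s <= M.
Proof.
move=> fs HM; rewrite leNgt; apply/negP => Ms.
have d0 : 0 < normc s - M by lra.
have [A HA] := fs _ d0; have := HA _ (fsubset_refl A); rewrite normc_subC.
have := le_normcD (s - \sum_(i <- A) f i) (\sum_(i <- A) f i); rewrite subrK.
have := normc_sum A xpredT f; have := HM A; lra.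
Qed.

(** Reindexing along an injection i whose range Q contains the support of f, with j as its inverse
    on Q. Bijections, finite supports and sublattices are all instances. *)
Lemma hasum_supp T T' (f : T -> C) s (i : T' -> T) (j : T -> T')
    (Q : pred T) :
  cancel i j -> (forall t, Q t -> i (j t) = t) -> (forall t, Q (i t)) ->
  (forall t, ~~ Q t -> f t = 0) ->
  hasum (fun t => f (i t)) s -> hasum f s.
Proof.
move=> iK jK Qi f0 fs e e0; have [A HA] := fs _ e0.
exists [fset i x | x in A]%fset => B AB.
have := HA [fset j x | x in [fset x in B | Q x]]%fset; rewrite big_imfset /=; last first.
  by move=> x y; rewrite !inE /= => /andP[_ /jK jx] /andP[_ /jK jy] E; rewrite -jx E jy.
have -> : \sum_(x <- [fset x in B | Q x]%fset) f (i (j x)) = \sum_(x <- B) f x.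
  rewrite [RHS](big_fsetID _ Q) /= [X in _ = _ + X]big_seq [X in _ = _ + X]big1; last first.
    by move=> x; rewrite !inE /= => /andP[_ /f0].
  rewrite addr0 big_seq [RHS]big_seq; apply: eq_bigr => x.
  by rewrite !inE /= => /andP[_ /jK ->].
apply; apply/fsubsetP => x xA; apply/imfsetP; exists (i x) => //=.
rewrite !inE /= Qi andbT; apply: (fsubsetP AB).
by apply/imfsetP; exists x.
Qed.

Lemma hasum_bij T T' (f : T -> C) s (h : T' -> T) (h' : T -> T') :
  cancel h h' -> cancel h' h -> hasum f s -> hasum (fun t => f (h t)) s.
Proof.
move=> hK h'K fs; apply: (@hasum_supp _ _ _ s h' h xpredT) => //.
by apply: eq_hasum fs => t; rewrite h'K.
Qed.

Lemma hasum_fin (T : finType) (f : T -> C) : hasum f (\sum_t f t).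
Proof.
move=> e e0; exists [fset x in T]%fset => B /fsubsetP AB.
rewrite big_uniq ?fset_uniq//= (eq_bigl xpredT) ?subrr ?normc0// => x.
by apply: AB; rewrite !inE.
Qed.

(** The finite set B of rows is fixed first; the finite set E of columns is then enlarged until
    every row of B is within (e/2)/(|B|+1) of its sum. *)
Lemma hasum_fubini T1 T2 (f : T1 * T2 -> C) (g : T1 -> C) s :
  (forall x, hasum (fun y => f (x, y)) (g x)) -> hasum f s -> hasum g s.
Proof.
move=> fg fs e e0; have e20 : 0 < e / 2 by lra.
have [A HA] := fs _ e20.
set A1 := [fset x.1 | x in A]%fset; set A2 := [fset x.2 | x in A]%fset.
exists A1 => B A1B.
pose d := (e / 2) / (size B).+1%:R.
have d0 : 0 < d by rewrite divr_gt0// ltr0Sn.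
have /choice [D HD] x : exists D : {fset T2}, forall E : {fset T2},
    (D `<=` E)%fset -> normc (\sum_(y <- E) f (x, y) - g x) < d by exact: fg.
pose E := (A2 `|` \bigcup_(x <- B) D x)%fset.
have DE x : x \in B -> (D x `<=` E)%fset.
  move=> xB; apply: fsubset_trans (fsubsetUr _ _).
  exact: bigfcup_sup.
have AE : (A `<=` B `*` E)%fset.
  apply/fsubsetP => -[x y] xyA; rewrite in_fsetM /= inE; apply/andP; split.
    by apply: (fsubsetP A1B); apply/imfsetP; exists (x, y).
  by apply/orP; left; apply/imfsetP; exists (x, y).
have := HA _ AE; rewrite big_fsetM /=.
set S := \sum_(x <- B) _ => HS.
apply: le_lt_trans (le_normc_sub _ S _) _.
rewrite [e](splitr e); apply: ler_ltD => //.
rewrite /S -sumrB big_seq; apply: le_trans (normc_sum _ _ _) _.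
apply: (@le_trans _ _ (\sum_(i <- B) d)).
  rewrite [leRHS]big_seq; apply: ler_sum => x xB; rewrite normc_subC.
  by apply/ltW/HD/DE.
rewrite big_const_seq count_predT iter_addr_0 -[leLHS]mulr_natr /d (mulrAC (e / 2)).
rewrite ler_pdivrMr ?ltr0Sn// ler_wpM2l ?ler_nat//; lra.
Qed.

(** Dominated convergence to 0: outside a finite set A the dominating sum is small for all q at
    once, and on A finitely many terms tend to 0. *)
Lemma tannery T (f : nat -> T -> C) (g : T -> R) (s : nat -> C) :
  (forall t, 0 <= g t) -> bsum g -> (forall q t, normc (f q t) <= g t) ->
  (forall t (e : R), 0 < e -> exists Q, forall q, (Q <= q)%N -> normc (f q t) < e) ->
  (forall q, hasum (f q) (s q)) ->
  forall e : R, 0 < e -> exists Q, forall q, (Q <= q)%N -> normc (s q) < e.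
Proof.
move=> g0 bg fg f0 fs e e0.
have e30 : 0 < e / 3 by lra.
have [A HA] := bsum_tail g0 bg e30.
pose d := (e / 3) / (size A).+1%:R.
have d0 : 0 < d by rewrite divr_gt0// ltr0Sn.
have /choice [Q HQ] t : exists Q, forall q, (Q <= q)%N -> normc (f q t) < d.
  exact: f0.
exists (\max_(t <- A) Q t) => q Qq.
have [B HB] := fs q _ e30.
have := HB _ (fsubsetUr A B).
set S := \sum_(i <- _) _ => HS.
have SE : normc S <= e / 3 + e / 3; last first.
  have := le_normcD (S - s q) (- S); rewrite addrAC subrr add0r !normcN; lra.
apply: le_trans (normc_sum _ _ _) _.
rewrite (big_fsetID _ (mem A)) /=; apply: lerD.
  have -> : [fset x in (A `|` B) | x \in A]%fset = A.
    by apply/fsetP => y; rewrite !inE /=; case: (y \in A); rewrite ?andbF.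
  apply: (@le_trans _ _ (\sum_(i <- A) d)).
    rewrite big_seq [leRHS]big_seq; apply: ler_sum => x xA.
    apply/ltW/HQ; apply: leq_trans Qq.
    by rewrite (big_rem x) //= leq_maxl.
  rewrite big_const_seq count_predT iter_addr_0 -[leLHS]mulr_natr /d (mulrAC (e / 3)).
  rewrite ler_pdivrMr ?ltr0Sn// ler_wpM2l ?ler_nat//; lra.
apply: le_trans (ltW (HA [fset x in (A `|` B) | x \notin A]%fset _)).
  exact: ler_sum.
by apply/fdisjointP => x xA; rewrite !inE /= xA andbF.
Qed.

Lemma hasum_sum T (f : T -> C) s : hasum f s ->
  sum (f : T -> (R[i])^o) = s.
Proof.
move=> fs; have FF := @totally_filter T.
rewrite /sum; apply: cvg_lim => //.
apply/cvgrPdist_lt => /= e e0; rewrite /totally /=.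
(* The norm of R[i] takes values in R[i], so the given epsilon is a complex number; its positivity
   forces the imaginary part to vanish. *)
have [er ei] : 0 < Re e /\ e = (Re e)%:C.
  by move: e0; case: e => a b; rewrite ltcE /= => /andP[/eqP ->].
have [A HA] := fs _ er; exists A => // B /= AB.
have := HA _ AB; rewrite big_seq_fsetE /= -/(partial_sum _ _) => H.
by rewrite ei distrC normc_def ltcR /=; move: H; case: (_ - _).
Qed.

End Summation.

(** * Elementary bounds for the sine, the cosine and the complex exponential *)

Section ComplexExponential.
Variable R : realType.
Local Notation C := R[i].

Lemma normc_cexp (z : C) : normc (cexp z) = expR (Re z).
Proof.
rewrite /cexp /= !exprMn -mulrDr cos2Dsin2 mulr1 sqrtr_sqr.
by rewrite ger0_norm ?expR_ge0.
Qed.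

Lemma cexp0 : cexp 0 = 1 :> C.
Proof. by rewrite /cexp /= expR0 cos0 sin0 mulr1 mulr0. Qed.

Lemma cexp_neq0 (z : C) : cexp z != 0.
Proof.
apply/eqP => /(congr1 (@normc R)); rewrite normc_cexp normc0.
by apply/eqP; rewrite gt_eqF ?expR_gt0.
Qed.

Lemma cexpN (z : C) : cexp (- z) = (cexp z)^-1.
Proof.
by apply: (mulfI (cexp_neq0 z)); rewrite -cexpD subrr cexp0 divff ?cexp_neq0.
Qed.

Lemma cexpB (z w : C) : cexp (z - w) = cexp z / cexp w.
Proof. by rewrite cexpD cexpN. Qed.

Lemma cexp_real (x : R) : cexp x%:C = (expR x)%:C.
Proof. by rewrite /cexp /= cos0 sin0 mulr1 mulr0. Qed.

Lemma normc_sin_le (x : R) : `|sin x| <= `|x|.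
Proof.
wlog x0 : x / 0 <= x => [H|].
  have [/H//|/ltW x0] := leP 0 x.
  by rewrite -[x]opprK sinN !(normrN (- x)) normrN H ?oppr_ge0.
have [|c _] := @MVT_segment R sin cos 0 x x0.
  by apply: continuous_subspaceT => y; exact: continuous_sin.
rewrite sin0 !subr0 => ->; rewrite normrM ler_piMl ?normr_ge0//.
exact: cos_max.
Qed.

Lemma one_sub_cos (x : R) : 1 - cos x = 2 * sin (x / 2) ^+ 2.
Proof.
have {1}-> : x = (x / 2) *+ 2 by rewrite -mulr_natr divfK ?pnatr_eq0.
by rewrite cos_mulr2n cos2sin2 mulr2n; ring.
Qed.

Lemma one_sub_cos_le (x : R) : 1 - cos x <= x ^+ 2 / 2.
Proof.
rewrite one_sub_cos; have := normc_sin_le (x / 2).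
rewrite -ler_sqr ?nnegrE ?normr_ge0// !real_normK ?num_real//; lra.
Qed.

Lemma one_sub_cos_ge0 (x : R) : 0 <= 1 - cos x.
Proof. by rewrite subr_ge0; have := cos_max x; rewrite ler_norml => /andP[]. Qed.

Lemma one_sub_cos_le1 (x : R) : 1 - cos x <= `|x|.
Proof.
have [x2|x2] := leP `|x| 2.
  apply: le_trans (one_sub_cos_le x) _.
  rewrite -real_normK ?num_real// expr2 -mulrA ler_piMr ?normr_ge0//.
  by rewrite ler_pdivrMr// mul1r.
by have := cos_max x; rewrite ler_norml; lra.
Qed.

Lemma sin_sub_le (x : R) : `|sin x - x| <= x ^+ 2.
Proof.
wlog x0 : x / 0 <= x => [H|].
  have [/H//|/ltW x0] := leP 0 x.
  by rewrite -[x]opprK sinN -opprD normrN [leRHS]sqrrN H ?oppr_ge0.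
have [|c] := @MVT_segment R sin cos 0 x x0.
  by apply: continuous_subspaceT => y; exact: continuous_sin.
rewrite in_itv /= => /andP[c0 cx]; rewrite sin0 !subr0 => ->.
rewrite -{2}[x]mul1r -mulrBl normrM expr2 (ger0_norm x0) ler_wpM2r//.
rewrite distrC ger0_norm ?one_sub_cos_ge0//.
by apply: le_trans (one_sub_cos_le1 c) _; rewrite ger0_norm.
Qed.

(** With sin(u/2) = (u/2) cos c for some c <= u/2, sin u = u cos c cos(u/2) >= u cos(u/2)^2 = u (1 +
    cos u)/2, and cos u >= 0. *)
Lemma sin_ge_half (u : R) : 0 <= u <= pi / 2 -> u / 2 <= sin u.
Proof.
move=> /andP[u0 u1]; have hu0 : 0 <= u / 2 by lra.
have [|c] := @MVT_segment R sin cos 0 (u / 2) hu0.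
  by apply: continuous_subspaceT => y; exact: continuous_sin.
rewrite in_itv /= => /andP[c0 cx]; rewrite sin0 !subr0 => sE.
have pi0 := pi_gt0 R.
have cosle : cos (u / 2) <= cos c.
  have [->|cu] := eqVneq c (u / 2) => //.
  rewrite ltW// ltr_cos ?in_itv/=; first by rewrite lt_neqAle cu.
  - by apply/andP; split; lra.
  - by apply/andP; split; lra.
have cu0 : 0 <= cos u by apply: cos_ge0_pihalf; apply/andP; split; lra.
have ch0 : 0 <= cos (u / 2) by apply: cos_ge0_pihalf; apply/andP; split; lra.
have uE : u = (u / 2) *+ 2 by rewrite -mulr_natr divfK ?pnatr_eq0.
have cE : cos u = 2 * cos (u / 2) ^+ 2 - 1 by rewrite {1}uE cos_mulr2n mulr_natl.
have -> : sin u = 2 * (sin (u / 2) * cos (u / 2)).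
  by rewrite {1}uE mulr2n sinD; ring.
rewrite sE.
have : cos (u / 2) ^+ 2 <= cos c * cos (u / 2) by rewrite expr2 ler_wpM2r.
nra.
Qed.

Lemma cos_lower (u : R) : `|u| <= pi -> u ^+ 2 / 8 <= 1 - cos u.
Proof.
move=> upi; rewrite one_sub_cos.
have : `|u| / 2 / 2 <= sin (`|u| / 2).
  by apply: sin_ge_half; have := normr_ge0 u; lra.
have -> : sin (u / 2) ^+ 2 = sin (`|u| / 2) ^+ 2.
  have [u0|u0] := leP 0 u; first by rewrite ger0_norm.
  by rewrite ltr0_norm// mulNr sinN sqrrN.
have -> : u ^+ 2 = `|u| ^+ 2 by rewrite real_normK ?num_real.
have := normr_ge0 u; nra.
Qed.

Lemma expR_sub1_le (x : R) : 0 <= expR x - 1 - x <= x ^+ 2 * (1 + expR x).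
Proof.
have e1 := expR_ge1Dx x; have e2 := expR_ge1Dx (- x).
have e0 := expR_gt0 x.
have e3 : expR x * expR (- x) = 1 by rewrite expRN divff ?gt_eqF.
have e4 : expR x - 1 <= x * expR x.
  suff : expR x * (1 - x) <= 1 by lra.
  by rewrite -[leRHS]e3 ler_pM2l.
apply/andP; split; first lra.
apply: (@le_trans _ _ (x * (expR x - 1))); first lra.
have x2 : 0 <= x ^+ 2 := sqr_ge0 x.
have [x0|x0] := leP 0 x.
  apply: (@le_trans _ _ (x * (x * expR x))); first by rewrite ler_wpM2l.
  by rewrite mulrA -expr2 ler_wpM2l//; lra.
apply: (@le_trans _ _ (x * x)); first by rewrite ler_nM2l//; lra.
by rewrite -expr2 ler_peMr//; lra.
Qed.

Definition exp_rest (z : C) : C := cexp z - 1 - z.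

(** The factor 1 + exp(Re z) has the shape that suits a product F * [exp_rest] E: the bound becomes
    |F| + |F exp E|, that is, the Gaussian before and after the perturbation. *)
Lemma exp_rest_le (z : C) :
  normc (exp_rest z) <= 5 * normc z ^+ 2 * (1 + expR (Re z)).
Proof.
have hx := normc_Re_le z; have hy := normc_Im_le z.
case: z hx hy => x y hx hy; rewrite /exp_rest.
set n := normc (x +i* y) in hx hy *.
have {hx}hx : `|x| <= n := hx. have {hy}hy : `|y| <= n := hy.
pose u : C := cos y +i* sin y.
(* With u = exp(iy), the remainder splits into a second order part in x, one in y, and a mixed
   product of two first order parts. *)
have -> : cexp (x +i* y) - 1 - (x +i* y) =
    (expR x - 1 - x)%:C * u + ((cos y - 1) +i* (sin y - y))
     + x%:C * ((cos y - 1) +i* sin y).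
  by apply: eqC => /=; ring.
have n0 := normc_ge0 (x +i* y); rewrite -/n in n0.
have := expR_sub1_le x => /andP[r0 r1].
have nu : normc u = 1 by rewrite /u /= cos2Dsin2 sqrtr1.
have x2 : x ^+ 2 <= n ^+ 2 by rewrite -(real_normK (num_real x)) lerXn2r ?nnegrE.
have y2 : y ^+ 2 <= n ^+ 2 by rewrite -(real_normK (num_real y)) lerXn2r ?nnegrE.
have A1 : normc ((expR x - 1 - x)%:C * u) <= n ^+ 2 * (1 + expR x).
  rewrite normcM nu mulr1 normc_real ger0_norm//; apply: le_trans r1 _.
  by rewrite ler_wpM2r// addr_ge0// expR_ge0.
have A2 : normc ((cos y - 1) +i* (sin y - y)) <= 2 * n ^+ 2.
  apply: le_trans (normc_leRI _) _ => /=.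
  rewrite distrC ger0_norm ?one_sub_cos_ge0//.
  have := one_sub_cos_le y; have := sin_sub_le y; have := sqr_ge0 y; lra.
have A3 : normc (x%:C * ((cos y - 1) +i* sin y)) <= 2 * n ^+ 2.
  rewrite normcM normc_real (_ : 2 * n ^+ 2 = n * (2 * n)); last by ring.
  apply: ler_pM => //; first exact: normc_ge0.
  apply: le_trans (normc_leRI _) _ => /=.
  rewrite distrC ger0_norm ?one_sub_cos_ge0//.
  have := one_sub_cos_le1 y; have := normc_sin_le y; lra.
apply: le_trans (le_normcD _ _) _.
have := le_normcD ((expR x - 1 - x)%:C * u) ((cos y - 1) +i* (sin y - y)).
have := mulr_ge0 (sqr_ge0 n) (ltW (expR_gt0 x)); rewrite -/n; lra.
Qed.

End ComplexExponential.

(** * Sums as total functions, and uniform bounds for sums over the integers *)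

Section TotalSum.
Variable R : realType.
Local Notation C := R[i].

(** The value carries information only for a summable family, hence the hypotheses [bsum] in the
    lemmas that compute with it. *)
Definition tsum (T : choiceType) (f : T -> C) : C := sum (f : T -> (R[i])^o).

Lemma hasumE (T : choiceType) (f : T -> C) s : hasum f s -> tsum f = s.
Proof. exact: hasum_sum. Qed.

Lemma tsumP (T : choiceType) (f : T -> C) :
  bsum (fun t => normc (f t)) -> hasum f (tsum f).
Proof. by move=> /hasum_exists [s fs]; rewrite (hasumE fs). Qed.

Lemma sum_sub_seq (T : eqType) (g : T -> R) (s t : seq T) :
  (forall x, 0 <= g x) -> uniq s -> {subset s <= t} ->
  \sum_(i <- s) g i <= \sum_(i <- t) g i.
Proof.
move=> g0; elim: s t => [|x s IH] t /=; first by rewrite big_nil sumr_ge0.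
move=> /andP[xs us] st; have xt : x \in t by apply: st; rewrite mem_head.
rewrite big_cons (perm_big _ (perm_to_rem xt)) /= big_cons lerD2l.
apply: IH => // y ys; apply: rem_mem; last by apply: st; rewrite inE ys orbT.
by apply: contraNneq xs => <-.
Qed.

(** At most two integers share an absolute value, so a finite set of integers is covered by two
    copies of an initial segment of the naturals. *)
Lemma sum_absz_le (g : nat -> R) (M : R) (A : {fset int}) :
  (forall k, 0 <= g k) -> (forall N, \sum_(k < N) g k <= M) ->
  \sum_(n <- A) g `|n|%N <= M + M.
Proof.
move=> g0 gM; pose N := (\max_(n <- A) `|n|)%N.+1.
have AN n : n \in A -> (`|n| < N)%N.
  by move=> nA; rewrite /N ltnS (big_rem n) //= leq_maxl.
pose t := [seq Posz k | k <- iota 0 N] ++ [seq - Posz k | k <- iota 0 N].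
apply: (@le_trans _ _ (\sum_(n <- t) g `|n|%N)).
  apply: sum_sub_seq => // n nA; rewrite mem_cat; apply/orP.
  have := AN n nA; case: n {nA} => k kN; [left | right]; apply/mapP.
    by exists k => //; rewrite mem_iota.
  by exists k.+1 => //; rewrite mem_iota.
have sE : \sum_(j <- iota 0 N) g j = \sum_(k < N) g k.
  by rewrite -(big_mkord xpredT g) /index_iota subn0.
rewrite big_cat !big_map /=.
rewrite (eq_bigr g) // [X in _ + X](eq_bigr g) ?sE ?lerD// => k _.
by rewrite abszN.
Qed.

(** From exp(-h)(1 + h) <= 1 follows 1 - exp(-h) >= h/(1 + h) >= h/2. *)
Lemma geometric_sum_le (h : R) (N : nat) : 0 < h <= 1 ->
  \sum_(k < N) h * expR (- (k%:R * h)) <= 2.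
Proof.
move=> /andP[h0 h1]; pose r := expR (- h).
have r0 : 0 < r := expR_gt0 _.
have rh : r * (1 + h) <= 1.
  have : r * expR h = 1 by rewrite /r expRN mulVf ?gt_eqF ?expR_gt0.
  by move=> e; rewrite -[leRHS]e ler_pM2l// expR_ge1Dx.
have hr : h <= 2 * (1 - r) by nra.
rewrite -mulr_sumr.
have -> : \sum_(k < N) expR (- (k%:R * h)) = \sum_(k < N) r ^+ k.
  by apply: eq_bigr => k _; rewrite -mulrN expRM_natl.
have H : (1 - r) * \sum_(k < N) r ^+ k <= 1.
  have := subrX1 r N; have := exprn_ge0 N (ltW r0); lra.
have : 0 <= \sum_(k < N) r ^+ k by apply: sumr_ge0 => k _; rewrite exprn_ge0 ?ltW.
nra.
Qed.

(** The bound is uniform in the mesh h; it dominates every Riemann sum of a Gaussian, whatever the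
    step. *)
Lemma riemann_sum_le (h : R) (A : {fset int}) : 0 < h <= 1 ->
  \sum_(n <- A) h * expR (- `|n%:~R * h|) <= 4.
Proof.
move=> h01; have h0 : 0 < h by case/andP: h01.
have -> : 4 = 2 + 2 :> R by lra.
rewrite (eq_bigr (fun n : int => h * expR (- (`|n|%N%:R * h)))); last first.
  by move=> n _; rewrite normrM (gtr0_norm h0) -intr_norm -abszE.
apply: (sum_absz_le (g := fun k : nat => h * expR (- (k%:R * h)))).
  by move=> k; rewrite mulr_ge0 ?expR_ge0 ?ltW.
by move=> N; exact: geometric_sum_le.
Qed.

(** Telescoping: 1/(x + 1)^2 <= 1/x - 1/(x + 1). *)
Lemma inv_sqr_sum_le (N : nat) : \sum_(k < N) (1 + k%:R) ^- 2 <= 2 :> R.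
Proof.
have H : \sum_(k < N) (1 + k%:R) ^- 2 <= 2 - (if N is 0%N then 0 else N%:R^-1) :> R.
  elim: N => [|N IH]; first by rewrite big_ord0; lra.
  rewrite big_ord_recr /=; case: N IH => [|N] IH.
    rewrite big_ord0 addr0 expr1n !invr1; lra.
  apply: le_trans (lerD IH (lexx _)) _ => /=.
  set x : R := N.+1%:R; have x0 : 0 < x by rewrite ltr0Sn.
  have -> : N.+2%:R = x + 1 :> R by rewrite -natr1.
  have x1 : 0 < (x + 1)^-1 by rewrite invr_gt0; lra.
  have E : x^-1 - (x + 1)^-1 = x^-1 * (x + 1)^-1.
    by field; apply/andP; split; apply/eqP; lra.
  have : (x + 1) ^- 2 <= x^-1 * (x + 1)^-1.
    rewrite expr2 invfM ler_pM2r// lef_pV2 ?posrE//; lra.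
  rewrite (addrC 1 x); move: E; set a := x^-1; set b := (x + 1)^-1.
  set c := (x + 1) ^- 2; set d := a * b => E; lra.
by apply: le_trans H _; case: N => [|N]; rewrite ?subr0// gerBl invr_ge0.
Qed.

End TotalSum.

(** * Riemann sums of Gaussians *)

Section Order.
Variables (R : realType) (P : Type) (D : P -> Prop) (h X : P -> R).
Local Notation C := R[i].
Hypothesis h01 : forall p, D p -> 0 <= h p <= 1.
Hypothesis X1 : forall p, D p -> 1 <= X p.

(* Errors are measured by a power of the step [h] and by a Gaussian weight [G],
   up to powers of [X], which the weight absorbs in the end. *)
Definition ord (G : P -> R) (j : nat) (f : P -> C) : Prop :=
  exists M k, 0 <= M /\ forall p, D p -> normc (f p) <= M * h p ^+ j * X p ^+ k * G p.

Lemma eq_ord G j f g : (forall p, D p -> f p = g p) -> ord G j f -> ord G j g.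
Proof. by move=> fg [M [k [M0 H]]]; exists M, k; split=> // p Dp; rewrite -fg ?H. Qed.

Lemma ord_le G i j f : (forall p, D p -> 0 <= G p) -> (i <= j)%N ->
  ord G j f -> ord G i f.
Proof.
move=> G0 ij [M [k [M0 H]]]; exists M, k; split => // p Dp.
apply: le_trans (H p Dp) _; have /andP[h0 h1] := h01 Dp; have x1 := X1 Dp.
rewrite ler_wpM2r ?G0// ler_wpM2r ?exprn_ge0//; first lra.
by rewrite ler_wpM2l// ler_wiXn2l.
Qed.

Lemma ordD G j f g : (forall p, D p -> 0 <= G p) ->
  ord G j f -> ord G j g -> ord G j (fun p => f p + g p).
Proof.
move=> G0 [M [k [M0 H]]] [N [l [N0 I]]]; exists (M + N), (k + l)%N.
split; first exact: addr_ge0.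
move=> p Dp; apply: le_trans (le_normcD _ _) _.
have /andP[h0 h1] := h01 Dp; have x1 := X1 Dp.
rewrite !mulrDl; apply: lerD.
  apply: le_trans (H p Dp) _; rewrite ler_wpM2r ?G0//.
  by rewrite ler_wpM2l ?mulr_ge0 ?exprn_ge0// ler_weXn2l// leq_addr.
apply: le_trans (I p Dp) _; rewrite ler_wpM2r ?G0//.
by rewrite ler_wpM2l ?mulr_ge0 ?exprn_ge0// ler_weXn2l// leq_addl.
Qed.

Lemma ordM G i j f g : ord (fun=> 1) i f -> ord G j g ->
  ord G (i + j) (fun p => f p * g p).
Proof.
move=> [M [k [M0 H]]] [N [l [N0 I]]]; exists (M * N), (k + l)%N.
split; first exact: mulr_ge0.
move=> p Dp; rewrite normcM.
apply: le_trans (ler_pM (normc_ge0 _) (normc_ge0 _) (H p Dp) (I p Dp)) _.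
by rewrite !exprD mulr1; apply: le_of_eq; ring.
Qed.

Lemma ordN G j f : ord G j f -> ord G j (fun p => - f p).
Proof.
by move=> [M [k [M0 H]]]; exists M, k; split=> // p Dp; rewrite normcN H.
Qed.

Lemma ordB G j f g : (forall p, D p -> 0 <= G p) ->
  ord G j f -> ord G j g -> ord G j (fun p => f p - g p).
Proof. by move=> G0 Hf Hg; apply: ordD => //; exact: ordN. Qed.

Lemma ord_cst c : ord (fun=> 1) 0 (fun=> c).
Proof.
exists (normc c), 0%N; split; first exact: normc_ge0.
by move=> p _; rewrite !mulr1.
Qed.

Lemma ord_h : ord (fun=> 1) 1 (fun p => (h p)%:C).
Proof.
exists 1, 0%N; split=> // p Dp; have /andP[h0 _] := h01 Dp.
by rewrite normc_real ger0_norm// mul1r !mulr1.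
Qed.

Lemma ord_bound (M : R) f : 0 <= M ->
  (forall p, D p -> normc (f p) <= M) -> ord (fun=> 1) 0 f.
Proof.
move=> M0 H; exists M, 0%N; split => // p Dp; rewrite !mulr1; exact: H.
Qed.

(* A small factor [exp_rest] of an exponent is only controlled together with
   the size of [F] before and after the multiplication by [cexp E]. *)
Lemma ord_rest G j F E : (forall p, D p -> 0 <= G p) ->
  ord (fun=> 1) j E -> ord G 0 F -> ord G 0 (fun p => F p * cexp (E p)) ->
  ord G (j + j) (fun p => F p * exp_rest (E p)).
Proof.
move=> G0 [M [k [M0 H]]] [N [l [N0 I]]] [N' [l' [N'0 I']]].
exists (5 * M ^+ 2 * (N + N')), (k + k + (l + l'))%N; split.
  by rewrite !mulr_ge0 ?exprn_ge0// ?addr_ge0.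
move=> p Dp; rewrite normcM.
have /andP[h0 h1] := h01 Dp; have x1 := X1 Dp.
have x0 : 0 <= X p by lra.
apply: le_trans (ler_wpM2l (normc_ge0 _) (exp_rest_le _)) _.
have -> : normc (F p) * (5 * normc (E p) ^+ 2 * (1 + expR (Re (E p))))
  = (5 * normc (E p) ^+ 2) * (normc (F p) + normc (F p * cexp (E p))).
  by rewrite normcM normc_cexp; ring.
have HE : normc (E p) ^+ 2 <= M ^+ 2 * h p ^+ (j + j) * X p ^+ (k + k).
  have := H p Dp; rewrite mulr1 => H'.
  apply: le_trans (_ : _ <= (M * h p ^+ j * X p ^+ k) ^+ 2) _.
    by rewrite lerXn2r ?nnegrE ?normc_ge0// !mulr_ge0 ?exprn_ge0.
  by rewrite !exprD; apply: le_of_eq; ring.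
have HF : normc (F p) + normc (F p * cexp (E p)) <= (N + N') * X p ^+ (l + l') * G p.
  rewrite !mulrDl; apply: lerD.
    apply: le_trans (I p Dp) _; rewrite ler_wpM2r ?G0// expr0 mulr1.
    by rewrite ler_wpM2l// ler_weXn2l// leq_addr.
  apply: le_trans (I' p Dp) _; rewrite ler_wpM2r ?G0// expr0 mulr1.
  by rewrite ler_wpM2l// ler_weXn2l// leq_addl.
apply: le_trans (ler_pM _ _ (ler_wpM2l _ HE) HF) _.
- by rewrite mulr_ge0 ?exprn_ge0 ?normc_ge0.
- by rewrite addr_ge0 ?normc_ge0.
- by [].
by rewrite (exprD _ (k + k)); apply: le_of_eq; ring.
Qed.
End Order.

(** * Size of complex Gaussians *)

Section Gauss.
Variable R : realType.
Local Notation C := R[i].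

Definition gau (rho w : C) (x : R) : C := cexp (- pi%:C * (rho * x%:C + w) ^+ 2).

Lemma normc_gau_le (c B : R) (rho w : C) (x : R) :
  0 <= B -> c <= Re (rho ^+ 2) -> normc rho <= B -> normc w <= B ->
  normc (gau rho w x) <=
    expR (pi * B ^+ 2) * expR (2 * pi * B ^+ 2 * `|x|) * expR (- (pi * c * x ^+ 2)).
Proof.
move=> B0 cr rB wB; rewrite /gau normc_cexp -!expRD ler_expR.
have -> : - pi%:C * (rho * x%:C + w) ^+ 2 =
    (- pi * x ^+ 2)%:C * rho ^+ 2 + (- pi * 2 * x)%:C * (rho * w) + (- pi)%:C * w ^+ 2.
  by ring.
have ReD (z1 z2 : C) : Re (z1 + z2) = Re z1 + Re z2.
  by case: z1 z2 => ? ? [? ?].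
have ReZ (k : R) (z : C) : Re (k%:C * z) = k * Re z.
  by case: z => ? ? /=; rewrite mul0r subr0.
rewrite !ReD !ReZ.
have p0 := pi_gt0 R.
have h1 : `|Re (rho * w)| <= B ^+ 2.
  apply: le_trans (normc_Re_le _) _; rewrite normcM expr2.
  by apply: ler_pM => //; exact: normc_ge0.
have h2 : `|Re (w ^+ 2)| <= B ^+ 2.
  apply: le_trans (normc_Re_le _) _; rewrite !expr2 normcM.
  by apply: ler_pM => //; exact: normc_ge0.
have h3 : - pi * x ^+ 2 * Re (rho ^+ 2) <= - (pi * c * x ^+ 2).
  have := ler_wpM2l (mulr_ge0 (ltW p0) (sqr_ge0 x)) cr; lra.
have h4 : - pi * Re (w ^+ 2) <= pi * B ^+ 2.
  rewrite mulNr -mulrN ler_pM2l//; move: h2; rewrite ler_norml; lra.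
have h5 : - pi * 2 * x * Re (rho * w) <= 2 * pi * B ^+ 2 * `|x|.
  apply: le_trans (ler_norm _) _; rewrite !normrM normrN (gtr0_norm p0).
  have := ler_wpM2l (mulr_ge0 (ltW p0) (normr_ge0 x)) h1.
  rewrite (gtr0_norm (ltr0Sn _ 1)); lra.
lra.
Qed.

(** Completing the square gives (k + 1)|x| - c x^2 <= (k + 1)^2/(4c). The powers of the weight
    exp|x| collected in the error calculus are paid for here. *)
Lemma gauss_absorb (c : R) (k : nat) : 0 < c ->
  exists2 M, 0 <= M & forall x : R,
    expR `|x| ^+ k * expR (- (c * x ^+ 2)) <= M * expR (- `|x|).
Proof.
move=> c0; exists (expR ((k.+1)%:R ^+ 2 / (4 * c))); first exact: expR_ge0.
move=> x; rewrite -expRM_natl -!expRD ler_expR.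
have -> : x ^+ 2 = `|x| ^+ 2 by rewrite real_normK ?num_real.
set y := `|x|; rewrite -natr1; set m : R := k%:R.
suff : 0 <= (c * y - (m + 1) / 2) ^+ 2 / c.
  have -> : (c * y - (m + 1) / 2) ^+ 2 / c = c * y ^+ 2 - (m + 1) * y + (m + 1) ^+ 2 / (4 * c).
    by field; rewrite gt_eqF.
  lra.
by rewrite divr_ge0 ?sqr_ge0 ?ltW.
Qed.

End Gauss.

Section GaussOrder.
Variables (R : realType) (P : Type) (D : P -> Prop) (h x : P -> R) (c : R).
Local Notation C := R[i].
Hypothesis h01 : forall p, D p -> 0 <= h p <= 1.
Local Notation X := (fun p => expR `|x p|).
Local Notation G := (fun p => expR (- (pi * c * x p ^+ 2))).

Lemma expR_abs_ge1 p : 1 <= X p.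
Proof. by rewrite -[leLHS]expR0 ler_expR. Qed.

Lemma ord_gau (B : R) (rho w : P -> C) : 0 <= B ->
  (forall p, D p -> [/\ c <= Re (rho p ^+ 2), normc (rho p) <= B & normc (w p) <= B]) ->
  ord D h X G 0 (fun p => gau (rho p) (w p) (x p)).
Proof.
move=> B0 H; pose k := (Num.truncn (2 * pi * B ^+ 2)).+1.
exists (expR (pi * B ^+ 2)), k; split=> [|p Dp]; first exact: expR_ge0.
have [cr rB wB] := H p Dp.
apply: le_trans (normc_gau_le (x p) B0 cr rB wB) _.
rewrite expr0 mulr1 ler_wpM2r ?expR_ge0// ler_wpM2l ?expR_ge0//.
rewrite -expRM_natl ler_expR ler_wpM2r ?normr_ge0//.
by rewrite ltW// truncnS_gt.
Qed.

Lemma ord_x : ord D h X (fun=> 1) 0 (fun p => (x p)%:C).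
Proof.
exists 1, 1%N; split=> // p Dp; rewrite normc_real expr0 expr1 !mulr1 mul1r.
by have := expR_ge1Dx `|x p|; lra.
Qed.

Lemma ord_absorb j f : 0 < c -> ord D h X G j f -> exists M, 0 <= M /\
  forall p, D p -> normc (f p) <= M * h p ^+ j * expR (- `|x p|).
Proof.
move=> c0 [N [k [N0 H]]]; have [M M0 HM] := gauss_absorb k (mulr_gt0 (pi_gt0 R) c0).
exists (N * M); split=> [|p Dp]; first exact: mulr_ge0.
apply: le_trans (H p Dp) _; rewrite -mulrA.
have -> : N * M * h p ^+ j * expR (- `|x p|) = N * h p ^+ j * (M * expR (- `|x p|)) by ring.
by rewrite ler_wpM2l// mulr_ge0// exprn_ge0//; case/andP: (h01 Dp).
Qed.
End GaussOrder.

Lemma bsum_riemann (R : realType) (f : R -> R[i]) (M k : R) : 0 < k <= 1 ->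
  0 <= M -> (forall x, normc (f x) <= M * expR (- `|x|)) ->
  bsum (fun n : int => normc (k%:C * f (n%:~R * k))).
Proof.
move=> k01 M0 H; exists (M * 4) => A; have k0 : 0 < k by case/andP: k01.
apply: (@le_trans _ _ (\sum_(n <- A) M * (k * expR (- `|n%:~R * k|)))).
  by apply: ler_sum => n _; rewrite normcM normc_real (gtr0_norm k0) mulrCA ler_pM2l.
by rewrite -mulr_sumr ler_wpM2l// riemann_sum_le.
Qed.

(** * Comparison of Riemann sums along a path of Gaussians *)

Section Path.
Variables (R : realType) (l w0 : R[i]).
Local Notation C := R[i].
Hypothesis l_small : `|Im l| < pi / 4.

(** A lower bound for Re(rho(s)^2) valid on the whole path 0 <= s <= 1, hence a common Gaussian
    rate; it is positive because |2 Im l| < pi/2. *)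
Let c : R := expR (- (2 * `|Re l|)) * cos (2 * Im l).
Let rho (s : R) : C := cexp (s%:C * l).

Lemma path_c_gt0 : 0 < c.
Proof.
rewrite mulr_gt0 ?expR_gt0// cos_gt0_pihalf//.
by move: l_small; rewrite ltr_norml => /andP[]; lra.
Qed.

Lemma path_rho_sqr s : 0 <= s <= 1 -> c <= Re (rho s ^+ 2).
Proof.
move=> /andP[s0 s1]; rewrite /rho -cexpMn /c.
have -> : s%:C * l *+ 2 = (2 * s * Re l) +i* (2 * s * Im l).
  by case: l => a b; apply: eqC => /=; ring.
rewrite /=; apply: ler_pM; rewrite ?expR_ge0//.
- apply/ltW/cos_gt0_pihalf; by move: l_small; rewrite ltr_norml => /andP[]; lra.
- rewrite ler_expR; have : - `|Re l| <= Re l.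
    by rewrite lerNl -normrN ler_norm.
  move=> lo; have := ler_wpM2l s0 lo.
  have : s * `|Re l| <= `|Re l| by rewrite ler_piMl.
  lra.
rewrite -(cos_norm (2 * Im l)) -(cos_norm (2 * s * _)).
have pi0 := pi_gt0 R.
have E : `|2 * s * Im l| = s * `|2 * Im l|.
  by rewrite !normrM (ger0_norm s0); ring.
have n0 := normr_ge0 (2 * Im l).
have n1 : `|2 * Im l| <= pi / 2.
  by rewrite normrM gtr0_norm//; move: l_small; lra.
have : `|2 * s * Im l| <= `|2 * Im l|.
  by rewrite E ler_piMl.
rewrite le_eqVlt => /orP[/eqP -> //|lt]; rewrite ltW// ltr_cos ?in_itv//=.
- by apply/andP; split; [exact: normr_ge0 | lra].
- by apply/andP; split; lra.
Qed.

Lemma path_rho_le s : 0 <= s <= 1 -> normc (rho s) <= expR `|Re l|.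
Proof.
move=> /andP[s0 s1]; rewrite /rho normc_cexp ler_expR.
have -> : Re (s%:C * l) = s * Re l.
  by case: l => a b /=; rewrite mul0r subr0.
apply: le_trans (ler_norm _) _; rewrite normrM (ger0_norm s0).
by rewrite ler_piMl.
Qed.

Lemma path_rhoV_le s : 0 <= s <= 1 -> normc (rho s)^-1 <= expR `|Re l|.
Proof.
move=> /andP[s0 s1]; rewrite /rho -cexpN normc_cexp ler_expR.
have -> : Re (- (s%:C * l)) = - (s * Re l).
  by case: l => a b /=; rewrite mul0r subr0.
apply: le_trans (ler_norm _) _; rewrite normrN normrM (ger0_norm s0).
by rewrite ler_piMl.
Qed.

(** V is the flux of F: differentiation gives dF/ds = dV/dx, so the sum of F over a fine grid does
    not change to first order in s. *)
Let F (s x : R) : C := rho s * gau (rho s) (s%:C * w0) x.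
Let V (s x : R) : C := (l * x%:C + w0 / rho s) * F s x.

(** A point ((s, h), x) consists of the time s on the path, the step h and the argument x of the
    Gaussian. *)
Let P : Type := (R * R * R)%type.
Let D (p : P) : Prop := [/\ 0 <= p.1.1, 0 <= p.1.2 & p.1.1 + p.1.2 <= 1].
Let h (p : P) : R := p.1.2.
Let x (p : P) : R := p.2.
Let X (p : P) := expR `|x p|.
Let G (p : P) := expR (- (pi * c * x p ^+ 2)).
Let r (p : P) : C := rho p.1.1.
Let w (p : P) : C := p.1.1%:C * w0.
Let y p : C := r p * (x p)%:C + w p.
Let v p : C := l * (x p)%:C + w0 / r p.
Let phi p : C := exp_rest ((h p)%:C * l).
(** The increment of y as s becomes s + h. Accordingly E1 and E2 are the logarithms of F(s + h,
    x)/F(s, x) and of F(s, x + h)/F(s, x). *)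
Let delta p : C := r p * (x p)%:C * ((h p)%:C * l + phi p) + (h p)%:C * w0.
Let E1 p : C := (h p)%:C * l - pi%:C * (2 * y p * delta p + delta p ^+ 2).
Let E2 p : C := - pi%:C * (2 * y p * ((h p)%:C * r p) + ((h p)%:C * r p) ^+ 2).

Let h01 p : D p -> 0 <= h p <= 1.
Proof. by case: p => [[s k] z] [/= s0 k0 sk]; rewrite /h /=; apply/andP; split; lra. Qed.
Let X1 p : D p -> 1 <= X p. Proof. by move=> _; exact: expR_abs_ge1. Qed.
Let G0 p : D p -> 0 <= G p. Proof. by move=> _; exact: expR_ge0. Qed.
Let G10 (p : P) : D p -> 0 <= 1 :> R. Proof. by []. Qed.
Let O := ord D h X (fun=> 1).
Let OG := ord D h X G.

Let Oh : O 1 (fun p => (h p)%:C). Proof. exact: ord_h. Qed.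
Let Ox : O 0 (fun p => (x p)%:C). Proof. exact: ord_x. Qed.
Let Oc (z : C) : O 0 (fun=> z). Proof. exact: ord_cst. Qed.
Let Or : O 0 r.
Proof.
apply: (@ord_bound _ _ _ _ _ (expR `|Re l|)); first exact: expR_ge0.
move=> [[s k] z] [/= s0 k0 sk]; apply: path_rho_le; apply/andP; split; lra.
Qed.
Let OrV : O 0 (fun p => (r p)^-1).
Proof.
apply: (@ord_bound _ _ _ _ _ (expR `|Re l|)); first exact: expR_ge0.
move=> [[s k] z] [/= s0 k0 sk]; apply: path_rhoV_le; apply/andP; split; lra.
Qed.
Let Ow : O 0 w.
Proof.
apply: (@ord_bound _ _ _ _ _ (normc w0)); first exact: normc_ge0.
move=> [[s k] z] [/= s0 k0 sk]; rewrite /w /= normcM normc_real ger0_norm//.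
by rewrite ler_piMl ?normc_ge0//; lra.
Qed.
Let OM i j f g : O i f -> O j g -> O (i + j) (fun p => f p * g p).
Proof. exact: ordM. Qed.
Let OD i f g : O i f -> O i g -> O i (fun p => f p + g p).
Proof. exact: ordD. Qed.
Let Ole i j f : (i <= j)%N -> O j f -> O i f.
Proof. exact: ord_le. Qed.

Let Oy : O 0 y.
Proof. by apply: OD; last exact: Ow; exact: (OM Or Ox). Qed.
Let Ov : O 0 v.
Proof. by apply: OD; [exact: (OM (Oc l) Ox) | exact: (OM (Oc w0) OrV)]. Qed.
Let Ophi : O 2 phi.
Proof.
have Ohl : O 1 (fun p => (h p)%:C * l) by exact: (OM Oh (Oc l)).
apply: (@eq_ord _ _ _ _ _ _ _ (fun p => 1 * phi p)); first by move=> p _; rewrite mul1r.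
apply: (@ord_rest _ _ _ _ _ h01 X1 _ 1) => //; first exact: Oc.
apply: (@ord_bound _ _ _ _ _ (expR `|Re l|)); first exact: expR_ge0.
by move=> p Dp; rewrite mul1r; exact: (path_rho_le (h01 Dp)).
Qed.
Let Odelta : O 1 delta.
Proof.
apply: OD; last exact: (OM Oh (Oc w0)).
apply: (OM (i := 0)); first exact: (OM Or Ox).
by apply: OD; [exact: (OM Oh (Oc l)) | exact: Ole Ophi].
Qed.
Let OE1 : O 1 E1.
Proof.
apply: OD; first exact: (OM Oh (Oc l)).
apply: ordN; apply: (OM (Oc _)); apply: OD.
  by apply: (OM (i := 0)) => //; exact: (OM (Oc _) Oy).
apply: (@Ole 1 2) => //; exact: (OM Odelta Odelta).
Qed.
Let OE2 : O 1 E2.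
Proof.
have Ohr : O 1 (fun p => (h p)%:C * r p) by exact: (OM Oh Or).
apply: (OM (Oc _)); apply: OD.
  by apply: (OM (i := 0)) => //; exact: (OM (Oc _) Oy).
apply: (@Ole 1 2) => //; exact: (OM Ohr Ohr).
Qed.

Let F_ p := F p.1.1 (x p).
Let rE p : rho (p.1.1 + h p) = r p * cexp ((h p)%:C * l).
Proof. by rewrite /r /rho -cexpD; congr cexp; ring. Qed.
Let FE1 p : F_ p * cexp (E1 p) = F (p.1.1 + h p) (x p).
Proof.
rewrite /F_ /F rE -!mulrA; congr (_ * _).
rewrite /gau -[LHS]cexpD -[RHS]cexpD; congr cexp.
have -> : cexp ((h p)%:C * l) = 1 + ((h p)%:C * l + phi p) by rewrite /phi /exp_rest; ring.
rewrite /E1 -/(r p) /y /delta /w; ring.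
Qed.
Let FE2 p : F_ p * cexp (E2 p) = F p.1.1 (x p + h p).
Proof.
rewrite /F_ /F -!mulrA; congr (_ * _); rewrite /gau -[LHS]cexpD; congr cexp.
rewrite /E2 -/(r p) /y /w; ring.
Qed.

Let B : R := expR `|Re l| + normc w0.
Let OF : OG 0 F_.
Proof.
apply: (ordM Or); apply: (@ord_gau _ _ _ _ _ _ B).
  by rewrite addr_ge0 ?expR_ge0 ?normc_ge0.
move=> [[s k] z] [/= s0 k0 sk]; split.
- by apply: path_rho_sqr; apply/andP; split; lra.
- apply: le_trans (path_rho_le _) _; first by apply/andP; split; lra.
  by rewrite lerDl normc_ge0.
- rewrite normcM normc_real ger0_norm//.
  apply: (@le_trans _ _ (normc w0)); last by rewrite lerDr expR_ge0.
  by rewrite ler_piMl ?normc_ge0//; lra.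
Qed.
Let OF1 : OG 0 (fun p => F_ p * cexp (E1 p)).
Proof.
apply: (@eq_ord _ _ _ _ _ _ _ (fun p => F (p.1.1 + h p) (x p))); first by move=> p _; rewrite FE1.
have [N [j [N0 H]]] := OF; exists N, j; split=> // -[[s k] z] [/= s0 k0 sk].
by apply: (H (s + k, 0, z)); split=> //=; lra.
Qed.
Let OF2 : OG 0 (fun p => F_ p * cexp (E2 p)).
Proof.
(* The shift by h is moved from x into the constant term, w + rho h, so that the bound is in the
   Gaussian weight at x itself. *)
apply: (@eq_ord _ _ _ _ _ _ _ (fun p => r p * gau (r p) (w p + r p * (h p)%:C) (x p))).
  move=> p _; rewrite FE2 /F; congr (_ * _); rewrite /gau; congr cexp.
  by rewrite /r /w; ring.
apply: (ordM Or); apply: (@ord_gau _ _ _ _ _ _ (B + expR `|Re l|)).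
  by rewrite !addr_ge0 ?expR_ge0 ?normc_ge0.
move=> [[s k] z] [/= s0 k0 sk]; rewrite /h /r /w /=.
have rB : normc (rho s) <= expR `|Re l|.
  by apply: path_rho_le; apply/andP; split; lra.
have wB : normc (s%:C * w0) <= normc w0.
  rewrite normcM normc_real ger0_norm//.
  by rewrite ler_piMl ?normc_ge0//; lra.
have e0 := expR_ge0 `|Re l|; have n0 := normc_ge0 w0.
split.
- by apply: path_rho_sqr; apply/andP; split; lra.
- by apply: le_trans rB _; rewrite /B; lra.
- apply: le_trans (le_normcD _ _) _.
  rewrite [normc (rho s * _)]normcM (normc_real k) (ger0_norm k0).
  have rk : normc (rho s) * k <= expR `|Re l|.
    by apply: le_trans rB; rewrite ler_piMr ?normc_ge0//; lra.
  by apply: le_trans (lerD wB rk) _; rewrite /B; lra.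
Qed.

(** The discrete form of dF/ds = dV/dx. The first order parts cancel in E1 - v E2 - h l, which is
    the quantity [br] of order 2; the remainders [exp_rest] are of order 2 as well. *)
Lemma path_step_ord :
  OG 2 (fun p => F (p.1.1 + h p) (x p) - F p.1.1 (x p)
                 - (V p.1.1 (x p + h p) - V p.1.1 (x p))).
Proof.
pose br p : C := - pi%:C * (2 * y p * (r p * (x p)%:C * phi p) + delta p * delta p)
            + pi%:C * (v p * (((h p)%:C * r p) * ((h p)%:C * r p))).
have Obr : O 2 br.
  have Ohr : O 1 (fun p => (h p)%:C * r p) by exact: (OM Oh Or).
  apply: OD.
    apply: (OM (Oc _)); apply: OD; last exact: (OM Odelta Odelta).
    apply: (@OM 0 2); first exact: (OM (Oc _) Oy).
    by apply: (@OM 0 2) => //; exact: (OM Or Ox).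
  by apply: (OM (Oc _)); apply: (OM Ov); exact: (OM Ohr Ohr).
have OR1 : OG 2 (fun p => F_ p * exp_rest (E1 p)) by apply: (@ord_rest _ _ _ _ _ h01 X1 _ 1).
have OR2 : OG 2 (fun p => F_ p * exp_rest (E2 p)) by apply: (@ord_rest _ _ _ _ _ h01 X1 _ 1).
apply: (@eq_ord _ _ _ _ _ _ _ (fun p =>
   F_ p * exp_rest (E1 p) - v p * (F_ p * exp_rest (E2 p))
   - (h p)%:C * (l * (F_ p * exp_rest (E2 p) + E2 p * F_ p)) + br p * F_ p)).
  move=> p _.
  have -> : V p.1.1 (x p + h p) = (v p + l * (h p)%:C) * (F_ p * cexp (E2 p)).
    by rewrite FE2 /V; congr (_ * _); rewrite /v /r; ring.
  rewrite -FE1 -[V p.1.1 (x p)]/(v p * F_ p) -/(F_ p).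
  have brE : br p = E1 p - v p * E2 p - (h p)%:C * l.
    have dE : delta p = r p * (x p)%:C * phi p + (h p)%:C * (r p * v p).
      have -> : r p * v p = l * r p * (x p)%:C + w0.
        by rewrite /v mulrDr [r p * (w0 / _)]mulrCA divff ?cexp_neq0//; ring.
      by rewrite /delta; ring.
    by rewrite /br /E1 /E2 dE; ring.
  by rewrite brE /exp_rest; ring.
apply: ordD => //; last exact: (ordM Obr OF).
apply: ordB => //.
  by apply: ordB => //; exact: (ordM Ov OR2).
apply: (ordM Oh); apply: (@ordM _ _ _ _ _ _ 0 1); first exact: Oc.
apply: ordD => //; first by apply: ord_le OR2.
exact: (ordM OE2 OF).
Qed.

Let absorb j f (H : OG j f) := ord_absorb h01 path_c_gt0 H.

Let F_le : exists M, 0 <= M /\ forall s x, 0 <= s <= 1 ->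
  normc (F s x) <= M * expR (- `|x|).
Proof.
have [M [M0 H]] := absorb OF; exists M; split=> // s z /andP[s0 s1].
have := H (s, 0, z); rewrite expr0 mulr1; apply.
by split; rewrite ?addr0.
Qed.

Let V_le : exists M, 0 <= M /\ forall s x, 0 <= s <= 1 ->
  normc (V s x) <= M * expR (- `|x|).
Proof.
have [M [M0 H]] := absorb (ordM Ov OF); exists M; split=> // s z /andP[s0 s1].
have := H (s, 0, z); rewrite expr0 mulr1; apply.
by split; rewrite ?addr0.
Qed.

Let step_le : exists M, 0 <= M /\ forall s k x, 0 <= s -> 0 <= k -> s + k <= 1 ->
  normc (F (s + k) x - F s x - (V s (x + k) - V s x)) <= M * k ^+ 2 * expR (- `|x|).
Proof.
have [M [M0 H]] := absorb path_step_ord; exists M; split=> // s k z s0 k0 sk.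
exact: (H (s, k, z)).
Qed.

Let S (q : nat) (s : R) : C :=
  tsum (fun n : int => (q%:R^-1)%:C * F s (n%:~R / q%:R)).

(** The path advances by the mesh k = 1/q, so V(x + k) and V(x) have the same sum over the grid and
    only the second order error survives: q steps, each costing O(k^2). *)
Lemma path_riemann : exists M, 0 <= M /\ forall q, (0 < q)%N ->
  normc (S q 1 - S q 0) <= M / q%:R.
Proof.
have [MF [MF0 HF]] := F_le; have [MV [MV0 HV]] := V_le.
have [M [M0 HM]] := step_le.
exists (M * 4); split=> [|q q0]; first exact: mulr_ge0.
set k : R := q%:R^-1; have q0' : 0 < q%:R :> R by rewrite ltr0n.
have k01 : 0 < k <= 1 by rewrite invr_gt0 q0' invf_le1// ler1n.
have k0 : 0 < k by case/andP: k01.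
have qk : q%:R * k = 1 by rewrite divff ?gt_eqF.
have js (j : nat) : (j <= q)%N -> 0 <= j%:R * k <= 1.
  move=> jq; apply/andP; split.
    by apply: mulr_ge0 => //; exact: ltW.
  by rewrite -[X in _ <= X]qk ler_pM2r// ler_nat.
have one_step (j : nat) : (j < q)%N ->
    normc (S q (j.+1%:R * k) - S q (j%:R * k)) <= M * 4 * k ^+ 2.
  move=> jq; set s := j%:R * k.
  have s01 : 0 <= s <= 1 by apply: js; exact: ltnW.
  have -> : j.+1%:R * k = s + k by rewrite -natr1 mulrDl mul1r.
  have sk01 : 0 <= s + k <= 1.
    by have := js j.+1 jq; rewrite -natr1 mulrDl mul1r.
  have HS t : 0 <= t <= 1 ->
      hasum (fun n : int => k%:C * F t (n%:~R * k)) (S q t).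
    move=> t01; apply: tsumP; apply: bsum_riemann k01 MF0 _ => z; exact: HF.
  have [t Hv] : exists t, hasum (fun n : int => k%:C * V s (n%:~R * k)) t.
    apply: hasum_exists; apply: bsum_riemann k01 MV0 _ => z; exact: HV.
  have Hv' : hasum (fun n : int => k%:C * V s (n%:~R * k + k)) t.
    apply: eq_hasum (hasum_bij (addrK 1) (subrK (1 : int)) Hv) => n.
    by rewrite intrD mulrDl mul1r.
  have HT := hasumB (hasumB (HS _ sk01) (HS _ s01)) (hasumB Hv' Hv).
  rewrite subrr subr0 in HT; apply: (hasum_le HT) => A.
  apply: (@le_trans _ _ (\sum_(n <- A) M * k ^+ 2 * (k * expR (- `|n%:~R * k|)))).
    apply: ler_sum => n _; rewrite -!mulrBr.
    rewrite normcM normc_real (gtr0_norm k0) mulrCA ler_pM2l//.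
    by apply: HM; case/andP: s01 sk01 => ? ? /andP[? ?] //; exact: ltW.
  rewrite -mulr_sumr [M * 4 * _]mulrAC; apply: ler_wpM2l.
    by rewrite mulr_ge0 ?sqr_ge0.
  exact: riemann_sum_le.
have H j : (j <= q)%N -> normc (S q (j%:R * k) - S q 0) <= j%:R * (M * 4 * k ^+ 2).
  elim: j => [|j IH] jq; first by rewrite !mul0r subrr normc0.
  apply: le_trans (le_normc_sub _ (S q (j%:R * k)) _) _.
  rewrite -[in leRHS]natr1 mulrDl mul1r addrC.
  by apply: lerD; [exact: IH (ltnW jq) | exact: one_step].
have := H q (leqnn q); rewrite qk => /le_trans; apply.
by rewrite mulrCA expr2 (mulrA q%:R) qk mul1r.
Qed.

End Path.

(** * The Jacobi identity in dimension one *)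

Section E2pi.
Variable R : realType.
Local Notation C := R[i].

Lemma e2piE (z : C) : e2pi z = cexp (2 * pi%:C * 'i * z).
Proof. by []. Qed.

Lemma e2piD (z w : C) : e2pi (z + w) = e2pi z * e2pi w.
Proof. by rewrite /e2pi mulrDr cexpD. Qed.

Lemma e2pi0 : e2pi 0 = 1 :> C.
Proof. by rewrite /e2pi mulr0 cexp0. Qed.

Lemma e2piN (z : C) : e2pi (- z) = (e2pi z)^-1.
Proof. by rewrite /e2pi mulrN cexpN. Qed.

Lemma e2pi_neq0 (z : C) : e2pi z != 0.
Proof. exact: cexp_neq0. Qed.

Lemma e2piMn (z : C) n : e2pi (z *+ n) = e2pi z ^+ n.
Proof. by rewrite /e2pi mulrnAr cexpMn. Qed.

Lemma e2pi_real (x : R) : e2pi x%:C = cos (2 * pi * x) +i* sin (2 * pi * x).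
Proof.
rewrite /e2pi (_ : _ * x%:C = 0 +i* (2 * pi * x)).
  by rewrite /cexp /= expR0 !mul1r.
by apply: eqC => /=; ring.
Qed.

Lemma normc_e2pi_real (x : R) : normc (e2pi x%:C) = 1.
Proof. by rewrite e2pi_real /= cos2Dsin2 sqrtr1. Qed.

Lemma e2pi1 : e2pi 1 = 1 :> C.
Proof.
rewrite (_ : 1 = 1%:C) // e2pi_real mulr1 mulr_natl cos2pi.
by rewrite mulr2n sinD sinpi !mul0r !mulr0 addr0.
Qed.

Lemma e2pi_int (n : int) : e2pi n%:~R = 1 :> C.
Proof.
case: n => n; first by rewrite -pmulrn e2piMn e2pi1 expr1n.
by rewrite NegzE mulrNz e2piN -pmulrn e2piMn e2pi1 expr1n invr1.
Qed.

Lemma e2pi_intM (n : int) (z : C) : e2pi (n%:~R + z) = e2pi z.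
Proof. by rewrite e2piD e2pi_int mul1r. Qed.

(** A geometric sum. The odd modulus q = 2p + 1 makes the frequencies j - p symmetric, running
    through all integers from -p to p. *)
Lemma sum_e2pi (p : nat) (n : int) : let q := (2 * p).+1 in
  \sum_(j < q) e2pi (- ((Posz j - Posz p) * n)%:~R / q%:R) =
    if (q %| `|n|)%N then q%:R else 0 :> C.
Proof.
move=> q; have q0 : (q%:R : C) != 0 by rewrite pnatr_eq0.
have [m [r [nE rq]]] : exists m, exists r : nat, n = m * q%:Z + Posz r /\ (r < q)%N.
  exists (n %/ q)%Z, `|(n %% q)%Z|%N; split.
    by rewrite gez0_abs ?modz_ge0// -divz_eq.
  by rewrite -ltz_nat gez0_abs ?modz_ge0// ltz_pmod.
have dvE : (q %| `|n|)%N = (r == 0)%N.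
  rewrite -[(q %| _)%N]/(q %| n)%Z nE rpredDl ?dvdz_mull// dvdzE /=.
  by case: r rq {nE} => [|r] rq; [rewrite dvdn0 | rewrite gtnNdvd].
pose zeta : C := e2pi (- n%:~R / q%:R).
have zE : zeta = e2pi (- r%:R / q%:R).
  rewrite /zeta (_ : - n%:~R / q%:R = (- m)%:~R + - r%:R / q%:R) ?e2pi_intM//.
  by rewrite nE rmorphD rmorphM mulrNz /= -!pmulrn; field.
have tE (j : 'I_q) : e2pi (- ((Posz j - Posz p) * n)%:~R / q%:R)
    = e2pi ((Posz p * n)%:~R / q%:R) * zeta ^+ j.
  rewrite /zeta -e2piMn -e2piD; congr e2pi.
  by rewrite -mulr_natr !rmorphM rmorphB /= -!pmulrn; field.
rewrite (eq_bigr _ (fun j _ => tE j)) -mulr_sumr dvE.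
have zq : zeta ^+ q = 1.
  rewrite /zeta -e2piMn (_ : - n%:~R / q%:R *+ q = (- n)%:~R) ?e2pi_int//.
  by rewrite -mulr_natr divfK// mulrNz.
case: eqP => [r0|/eqP r0].
  have z1 : zeta = 1 by rewrite zE r0 oppr0 mul0r e2pi0.
  rewrite (eq_bigr (fun=> 1)) => [|j _]; last by rewrite z1 expr1n.
  rewrite sumr_const card_ord nE r0 addr0.
  rewrite (_ : _ / _ = (Posz p * m)%:~R) ?e2pi_int ?mul1r//.
  by rewrite !rmorphM /= -!pmulrn; field.
have z1 : zeta != 1.
  pose x : R := - (r%:R / q%:R).
  have xE : - r%:R / q%:R = x%:C :> C.
    by rewrite /x rmorphN rmorphM fmorphV !rmorph_nat; field; exact: q0.
  rewrite zE xE e2pi_real eq_complex /=; apply/negP => /andP[/eqP c1 _].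
  (* If zeta were 1, then sin(pi r/q) would vanish, although 0 < r < q. *)
  have := one_sub_cos (2 * pi * x); rewrite c1 subrr.
  rewrite (_ : 2 * pi * x / 2 = - (pi * (r%:R / q%:R))); last first.
    by rewrite /x; field; rewrite pnatr_eq0.
  rewrite sinN sqrrN => /eqP; rewrite eq_sym mulf_eq0 pnatr_eq0 /= sqrf_eq0.
  rewrite gt_eqF// sin_gt0_pi// mulr_gt0 ?pi_gt0 ?divr_gt0 ?ltr0n ?lt0n//=.
  by rewrite gtr_pMr ?pi_gt0// ltr_pdivrMr ?ltr0n// mul1r ltr_nat.
have /eqP := subrX1 zeta q; rewrite zq subrr eq_sym mulf_eq0 subr_eq0 (negbTE z1) /=.
by move=> /eqP ->; rewrite mulr0.
Qed.

End E2pi.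

Section Jacobi.
Variable R : realType.
Local Notation C := R[i].

Lemma Re_cexp_sqr_gt0 (l : C) : `|Im l| < pi / 4 ->
  0 < Re (cexp l ^+ 2).
Proof.
move=> ll; have := @path_rho_sqr R l ll 1; rewrite rmorph1 mul1r.
by move=> H; apply: lt_le_trans (path_c_gt0 ll) (H _); rewrite ler01 lexx.
Qed.

Lemma gau_decay (l w : C) : `|Im l| < pi / 4 ->
  exists M, 0 <= M /\ forall x, normc (gau (cexp l) w x) <= M * expR (- `|x|).
Proof.
move=> ll; pose c := Re (cexp l ^+ 2); have c0 : 0 < c by exact: Re_cexp_sqr_gt0.
have OG : ord (fun=> True) (fun=> 1) (fun x => expR `|x|)
    (fun x => expR (- (pi * c * x ^+ 2))) 0 (gau (cexp l) w).
  apply: (@ord_gau _ _ _ _ id _ (normc (cexp l) + normc w)).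
    by rewrite addr_ge0 ?normc_ge0.
  by move=> p _; split=> //; rewrite ?lerDl ?lerDr ?normc_ge0.
have [|M [M0 H]] := ord_absorb (x := id) _ c0 OG; first by rewrite ler01 lexx.
by exists M; split=> // x; have := H x I; rewrite expr0 mulr1.
Qed.

(** The ratios gau(x + k)/gau(x) and gau(x - k)/gau(x) are exp(E 1) and exp(E (-1)). Their linear
    parts in k are opposite, so E 1 + E (-1) is already of order k^2. *)
Lemma gau_second_difference (l w : C) : `|Im l| < pi / 4 ->
  exists M, 0 <= M /\ forall k x, 0 <= k <= 1 ->
    normc (gau (cexp l) w (x + k) - 2 * gau (cexp l) w x + gau (cexp l) w (x - k))
      <= M * k ^+ 2 * expR (- `|x|).
Proof.
move=> ll; pose c := Re (cexp l ^+ 2); have c0 : 0 < c by exact: Re_cexp_sqr_gt0.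
set rho := cexp l.
pose P := (R * R)%type; pose D (p : P) := 0 <= p.1 <= 1.
pose h (p : P) := p.1; pose x (p : P) := p.2.
pose X (p : P) := expR `|x p|; pose G (p : P) := expR (- (pi * c * x p ^+ 2)).
have h01 p : D p -> 0 <= h p <= 1 by [].
have X1 p : D p -> 1 <= X p by move=> _; exact: expR_abs_ge1.
have G0 p : D p -> 0 <= G p by move=> _; exact: expR_ge0.
pose O := ord D h X (fun=> 1).
have OD i f g : O i f -> O i g ->
    O i (fun p => f p + g p) by exact: ordD.
pose u (p : P) : C := 2 * (rho * (x p)%:C + w) * ((h p)%:C * rho).
pose s (p : P) : C := ((h p)%:C * rho) * ((h p)%:C * rho).
pose E (a : C) (p : P) : C := - pi%:C * (a * u p + s p).
pose F (p : P) : C := gau rho w (x p).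
have Ohr : O 1 (fun p => (h p)%:C * rho).
  by apply: (@ordM _ _ _ _ _ _ 1 0); [exact: ord_h | exact: ord_cst].
have Os : O 2 s by exact: (ordM Ohr Ohr).
have Ou : O 1 u.
  apply: (@ordM _ _ _ _ _ _ 0 1) => //; apply: (@ordM _ _ _ _ _ _ 0 0); first exact: ord_cst.
  apply: OD; last exact: ord_cst.
  by apply: (@ordM _ _ _ _ _ _ 0 0); [exact: ord_cst | exact: ord_x].
have OE a : O 1 (E a).
  apply: (@ordM _ _ _ _ _ _ 0 1); first exact: ord_cst.
  apply: OD; last by apply: ord_le Os.
  by apply: (@ordM _ _ _ _ _ _ 0 1); first exact: ord_cst.
have OF : ord D h X G 0 F.
  apply: (@ord_gau _ _ _ _ _ _ (normc rho + normc w)).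
    by rewrite addr_ge0 ?normc_ge0.
  by move=> p _; split=> //; rewrite ?lerDl ?lerDr ?normc_ge0.
have FE a p : F p * cexp (E a%:C p) = cexp (- pi%:C * (1 - a ^+ 2)%:C * s p) * gau rho w (x p + a * h p).
  by rewrite /F /gau -cexpD -[RHS]cexpD; congr cexp; rewrite /E /u /s; ring.
have OFE a : a ^+ 2 = 1 -> ord D h X G 0 (fun p => F p * cexp (E a%:C p)).
  move=> a2; apply: (@eq_ord _ _ _ _ _ _ _ (fun p => gau rho (w + rho * (a * h p)%:C) (x p))).
    move=> p _; rewrite FE a2 subrr mulr0 mul0r cexp0 mul1r /gau; congr cexp; ring.
  apply: (@ord_gau _ _ _ _ _ _ (normc rho + normc w + normc rho * `|a|)).
    by rewrite !addr_ge0 ?normc_ge0// mulr_ge0 ?normc_ge0.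
  move=> p /andP[p0 p1]; have n0 := normc_ge0 rho; have nw := normc_ge0 w.
  have na : 0 <= normc rho * `|a| by rewrite mulr_ge0.
  split=> //; first by lra.
  apply: le_trans (le_normcD _ _) _; rewrite normcM normc_real normrM (ger0_norm p0).
  have : normc rho * (`|a| * p.1) <= normc rho * `|a|.
    by rewrite ler_wpM2l// ler_piMr.
  by rewrite /h; lra.
have a1 : 1 ^+ 2 = 1 :> R by rewrite expr1n.
have a2 : (-1) ^+ 2 = 1 :> R by rewrite sqrrN expr1n.
have O1 := @ord_rest _ _ _ _ _ h01 X1 _ 1 _ _ G0 (OE _) OF (OFE _ a1).
have O2 := @ord_rest _ _ _ _ _ h01 X1 _ 1 _ _ G0 (OE _) OF (OFE _ a2).
have O3 : ord D h X G 2 (fun p => (- (2 * pi%:C) * s p) * F p).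
  apply: (@ordM _ _ _ _ _ _ 2 0) => //.
  by apply: (@ordM _ _ _ _ _ _ 0 2) => //; exact: ord_cst.
have [M [M0 H]] := ord_absorb h01 c0 (ordD h01 X1 G0 (ordD h01 X1 G0 O1 O2) O3).
exists M; split=> // t y t01; have := H (t, y) t01.
rewrite /F /=; set lhs := (X in normc X <= _ -> _).
suff -> : lhs = gau rho w (y + t) - 2 * gau rho w y + gau rho w (y - t) by [].
have := FE 1 (t, y); have := FE (-1) (t, y).
rewrite a1 a2 !subrr !mulr0 !mul0r !cexp0 !mul1r mulN1r /F /x /h /= => <- <-.
by rewrite /lhs /exp_rest /E rmorphN rmorph1; ring.
Qed.

(** The left factor is -2(1 - cos u) with u = 2 pi x, and |x| <= 1/2 is the range |u| <= pi in which
    1 - cos u >= u^2/8. *)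
Lemma e2pi_second_difference (x : R) : `|x| <= 1 / 2 ->
  x ^+ 2 <= normc (e2pi x%:C - 2 + e2pi (- x)%:C).
Proof.
move=> xh; rewrite !e2pi_real mulrN cosN sinN.
set th := 2 * pi * x.
have -> : (cos th +i* sin th) - 2 + (cos th +i* (- sin th)) = (- (2 * (1 - cos th)))%:C.
  by apply: eqC => /=; ring.
have pi0 := pi_gt0 R.
rewrite normc_real normrN normrM (gtr0_norm (ltr0Sn _ 1)) ger0_norm ?one_sub_cos_ge0//.
have := @cos_lower R th; rewrite /th => H.
have {}H := H _; apply: le_trans (_ : _ <= 2 * ((2 * pi * x) ^+ 2 / 8)) _; last first.
  rewrite ler_pM2l// H// !normrM (gtr0_norm pi0) (gtr0_norm (ltr0Sn _ 1)).
  by nra.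
have p1 : 1 <= pi :> R by have := pi_ge2 R; lra.
have -> : 2 * ((2 * pi * x) ^+ 2 / 8) = pi ^+ 2 * x ^+ 2 by field.
by rewrite ler_peMl ?sqr_ge0// expr_ge1// ltW.
Qed.

End Jacobi.

(** * Poisson summation for a Gaussian by roots of unity *)

Section Jacobi1.
Variable R : realType.
Local Notation C := R[i].
Implicit Types l z w : C.

Lemma tsumZ (T : choiceType) (c : C) (f : T -> C) :
  bsum (fun t => normc (f t)) -> tsum (fun t => c * f t) = c * tsum f.
Proof. by move=> /tsumP /(hasumZ c) /hasumE. Qed.

Lemma bsum_expR : bsum (fun n : int => expR (- `|n%:~R|) : R).
Proof.
exists 4 => A; have := @riemann_sum_le R 1 A; rewrite ltr01 lexx => /(_ isT).
by under eq_bigr do rewrite mul1r mulr1.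
Qed.

Lemma bsum_inv_sqr : bsum (fun k : int => (1 + `|k|%:R) ^- 2 : R).
Proof.
exists (2 + 2) => A; apply: (@sum_absz_le R (fun k => (1 + k%:R) ^- 2)).
  by move=> k; rewrite invr_ge0 exprn_ge0// addr_ge0.
exact: inv_sqr_sum_le.
Qed.

Lemma hasum_bigsum (T : choiceType) (J : finType) (f : J -> T -> C) (s : J -> C) :
  (forall j, hasum (f j) (s j)) -> hasum (fun t => \sum_j f j t) (\sum_j s j).
Proof.
move=> H; suff : forall r, hasum (fun t => \sum_(j <- r) f j t) (\sum_(j <- r) s j).
  by move/(_ (index_enum J)).
elim=> [|j r IH].
  rewrite big_nil => e e0; exists fset0 => B _.
  by rewrite big1 ?subrr ?normc0// => t _; rewrite big_nil.
rewrite big_cons; apply: eq_hasum (hasumD (H j) IH) => t.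
by rewrite big_cons.
Qed.

Lemma inv_nat01 (q : nat) : (0 < q)%N -> 0 < (q%:R^-1 : R) <= 1.
Proof. by move=> q0; rewrite invr_gt0 ltr0n q0 invf_le1 ?ltr0n// ler1n. Qed.

Definition riem (f : R -> C) (q : nat) : C :=
  tsum (fun n : int => (q%:R^-1)%:C * f (n%:~R / q%:R)).

Lemma hasum_riem (f : R -> C) (M : R) q : (0 < q)%N -> 0 <= M ->
  (forall x, normc (f x) <= M * expR (- `|x|)) ->
  hasum (fun n : int => (q%:R^-1)%:C * f (n%:~R / q%:R)) (riem f q).
Proof.
by move=> q0 M0 fM; apply: tsumP; apply: bsum_riemann (inv_nat01 q0) M0 fM.
Qed.

Lemma riem_le (f : R -> C) (M : R) q : (0 < q)%N -> 0 <= M ->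
  (forall x, normc (f x) <= M * expR (- `|x|)) -> normc (riem f q) <= M * 4.
Proof.
move=> q0 M0 fM; apply: (hasum_le (hasum_riem q0 M0 fM)) => A.
have k01 := inv_nat01 q0; have k0 : 0 < (q%:R^-1 : R) by case/andP: k01.
apply: (@le_trans _ _ (\sum_(n <- A) M * (q%:R^-1 * expR (- `|n%:~R / q%:R|)))).
  by apply: ler_sum => n _; rewrite normcM normc_real (gtr0_norm k0) mulrCA ler_pM2l.
by rewrite -mulr_sumr ler_wpM2l// riemann_sum_le.
Qed.

Lemma riem_gau l w : `|Im l| < pi / 4 ->
  exists M, 0 <= M /\ forall q, (0 < q)%N ->
    normc (cexp l * riem (gau (cexp l) w) q - riem (gau 1 0) q) <= M / q%:R.
Proof.
move=> ll; have [M [M0 H]] := path_riemann w ll; exists M; split=> // q q0.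
apply: le_trans (H q q0); apply: le_of_eq.
congr (normc (_ - _)).
  have [N [N0 HN]] := gau_decay w ll.
  rewrite -[LHS](hasumE (hasumZ _ (hasum_riem q0 N0 HN))); congr tsum.
  by apply/funext => n; rewrite mulrCA rmorph1 !mul1r.
by congr tsum; apply/funext => n; rewrite rmorph0 !mul0r cexp0 mul1r.
Qed.

Variables (l z : C).
Hypothesis l_small : `|Im l| < pi / 4.
Let rho := cexp l.
(** The point of the upper half-plane of which rho is the root (i/tau)^(1/2). *)
Let tau := 'i / rho ^+ 2.
Let t (k : int) : C := e2pi (tau * k%:~R ^+ 2 / 2 + k%:~R * z).
Let f (x : R) : C := gau rho (rho * z) x.
Let fk (k : int) (x : R) : C := f x * e2pi (- k%:~R * x%:C).
Let rt : rho ^+ 2 * tau = 'i%R.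
Proof. by rewrite /tau mulrC divfK// expf_neq0// cexp_neq0. Qed.

Let complete_square k x :
  fk k x = t k * gau rho (rho * (z + k%:~R * tau)) x.
Proof.
rewrite /fk /f /t /gau !e2piE -[LHS]cexpD -[RHS]cexpD; congr cexp.
by rewrite -rt; move: tau => s; field.
Qed.

(** The dual term t k is itself a constant times a Gaussian, with parameter exp(-l) in place of
    exp(l); the condition on Im l is symmetric. *)
Let t_decay : exists M, 0 <= M /\ forall k : int, normc (t k) <= M * expR (- `|k%:~R|).
Proof.
have lN : `|Im (- l)| < pi / 4.
  by case: l l_small => a b /=; rewrite normrN.
pose u : C := - 'i * rho * z.
have [M [M0 H]] := gau_decay u lN.
exists (normc (cexp (pi%:C * u ^+ 2)) * M); split=> [|k].
  by rewrite mulr_ge0 ?normc_ge0.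
have -> : t k = cexp (pi%:C * u ^+ 2) * gau (cexp (- l)) u k%:~R.
  rewrite /t e2piE /gau -cexpD; congr cexp.
  have i2 : 'i * 'i = -1 :> C by rewrite -expr2 sqr_i.
  have r0 : rho != 0 by exact: cexp_neq0.
  have kE : (k%:~R : R)%:C = k%:~R :> C by rewrite rmorph_int.
  have tE : tau = 'i * (rho^-1) ^+ 2 by rewrite /tau exprVn.
  rewrite cexpN -/rho kE /u tE; set s := rho^-1.
  have rs : rho * s = 1 by rewrite divff.
  transitivity (pi%:C * ('i * 'i) * s ^+ 2 * k%:~R ^+ 2 + 2 * pi%:C * 'i * k%:~R * z).
    by field.
  rewrite i2; transitivity (- pi%:C * s ^+ 2 * k%:~R ^+ 2 + 2 * pi%:C * 'i * k%:~R * z * (rho * s)).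
    by rewrite rs; ring.
  by ring.
rewrite normcM -mulrA ler_wpM2l ?normc_ge0//; exact: H.
Qed.

Let fk_le : exists M, 0 <= M /\ forall k x, normc (fk k x) <= M * expR (- `|x|).
Proof.
have [M [M0 H]] := gau_decay (rho * z) l_small; exists M; split=> // k x.
rewrite /fk normcM (_ : - k%:~R * x%:C = (- k%:~R * x)%:C).
  by rewrite normc_e2pi_real mulr1.
by rewrite rmorphM rmorphN rmorph_int.
Qed.

Let q (p : nat) : nat := (2 * p).+1.

(** Summation by parts twice: shifting the grid by one point multiplies the character by e(k/q) or
    e(-k/q), so (e(k/q) - 2 + e(-k/q)) S is a sum of second differences of f, of size O(1/q^2). The
    factor is at least (k/q)^2 in modulus, and the powers of q cancel. *)
Let riem_fk_le : exists M, 0 <= M /\ forall p (k : int), (`|k| <= p)%N ->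
  normc (riem (fk k) (q p)) <= M * (1 + `|k|%:R) ^- 2.
Proof.
have [M [M0 HM]] := fk_le; have [N [N0 HN]] := gau_second_difference (rho * z) l_small.
exists (M * 4 + N * 16); split=> [|p k kp]; first by rewrite addr_ge0 ?mulr_ge0.
have q0 : (0 < q p)%N by [].
have k01 := inv_nat01 q0; set h : R := (q p)%:R^-1 in k01.
have h0 : 0 < h by case/andP: k01.
have hq : (q p)%:R * h = 1 by rewrite divff// gt_eqF// ltr0n.
have [->|kn0] := eqVneq k 0.
  rewrite absz0 addr0 expr1n invr1 mulr1.
  have := riem_le q0 M0 (HM 0); have : 0 <= N * 16 by rewrite mulr_ge0.
  lra.
set S := riem _ _; pose kh : R := k%:~R * h.
have HS : hasum (fun n : int => h%:C * fk k (n%:~R * h)) S := hasum_riem q0 M0 (HM k).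
have Hp := hasumZ (e2pi kh%:C) (hasum_bij (addrK 1) (subrK (1 : int)) HS).
have Hm := hasumZ (e2pi (- kh)%:C) (hasum_bij (subrK 1) (addrK (1 : int)) HS).
have := hasumD (hasumB Hp (hasumZ 2 HS)) Hm.
rewrite -!mulrBl -mulrDl => Hd.
have e (x : R) : - k%:~R * x%:C = (- (k%:~R * x))%:C :> C.
  by rewrite rmorphN rmorphM rmorph_int mulNr.
have ee (x y : R) : e2pi (k%:~R * y)%:C * e2pi (- k%:~R * (x + y)%:C) = e2pi (- k%:~R * x%:C).
  by rewrite -e2piD !e -[RHS]/(e2pi (_%:C)); congr e2pi; ring.
have sh (x y : R) : e2pi (k%:~R * y)%:C * fk k (x + y) = f (x + y) * e2pi (- k%:~R * x%:C).
  by rewrite /fk -(ee x y) mulrCA.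
have dE (n : int) : normc (e2pi kh%:C * (h%:C * fk k ((n + 1)%:~R * h)) -
      2 * (h%:C * fk k (n%:~R * h)) + e2pi (- kh)%:C * (h%:C * fk k ((n - 1)%:~R * h)))
    = h * normc (f (n%:~R * h + h) - 2 * f (n%:~R * h) + f (n%:~R * h - h)).
  rewrite !(mulrCA _ h%:C) -mulrBr -mulrDr normcM normc_real (gtr0_norm h0); congr (_ * _).
  have -> : (n + 1)%:~R * h = n%:~R * h + h by rewrite intrD mulrDl mul1r.
  have -> : (n - 1)%:~R * h = n%:~R * h - h by rewrite intrD mulrNz mulrBl mul1r.
  have -> : - kh = k%:~R * - h by rewrite mulrN.
  rewrite (sh _ h) (sh _ (- h)) /fk (mulrA 2) -mulrBl -mulrDl normcM e.
  by rewrite normc_e2pi_real mulr1.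
have bnd : normc ((e2pi kh%:C - 2 + e2pi (- kh)%:C) * S) <= N * h ^+ 2 * 4.
  apply: (hasum_le Hd) => A.
  apply: (@le_trans _ _ (\sum_(n <- A) N * h ^+ 2 * (h * expR (- `|n%:~R * h|)))).
    apply: ler_sum => n _; rewrite dE mulrCA ler_pM2l//.
    by apply: HN; case/andP: k01 => ? ?; rewrite ltW.
  rewrite -mulr_sumr; apply: ler_wpM2l; first by rewrite mulr_ge0 ?sqr_ge0.
  exact: riemann_sum_le.
(* The frequencies satisfy |k| <= p < q/2; this is what keeps the factor away from its other
   zeros. *)
have khh : `|kh| <= 1 / 2.
  rewrite /kh normrM (gtr0_norm h0) -intr_norm -abszE.
  have : `|k|%:R * h <= p%:R * h by rewrite ler_pM2r// ler_nat.
  have : (2 * p%:R + 1) * h = 1 by rewrite -[RHS]hq; congr (_ * _); rewrite /q -[RHS]natr1 natrM.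
  rewrite -pmulrn; lra.
have := e2pi_second_difference khh.
have S0 := normc_ge0 S.
move=> /(ler_wpM2r S0); rewrite -normcM => /le_trans /(_ bnd).
rewrite /kh exprMn => H.
have h2 : 0 < h ^+ 2 by rewrite exprn_gt0.
have k1 : 1 <= (`|k|%:R : R) by rewrite ler1n lt0n absz_eq0.
have kE : (k%:~R : R) ^+ 2 = `|k|%:R ^+ 2.
  by rewrite -[LHS]real_normK ?num_real// -intr_norm -abszE -pmulrn.
have {}H : `|k|%:R ^+ 2 * normc S <= N * 4.
  by rewrite -(ler_pM2r h2); move: H; rewrite kE; lra.
rewrite ler_pdivlMr; last by rewrite exprn_gt0//; lra.
have : (1 + `|k|%:R) ^+ 2 <= 4 * `|k|%:R ^+ 2 :> R by nra.
move=> /(ler_wpM2r S0); have : 0 <= M * 4 by rewrite mulr_ge0.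
lra.
Qed.

Let F : C := tsum (fun n : int => f n%:~R).
Let G : C := tsum t.
Let I (p : nat) : C := riem (gau 1 0) (q p).

Let HF : hasum (fun n : int => f n%:~R) F.
Proof.
have [M [M0 H]] := gau_decay (rho * z) l_small.
by apply: tsumP; apply: (bsum_le _ (bsumZ M0 bsum_expR)) => n; exact: H.
Qed.

Let HG : hasum t G.
Proof.
have [M [M0 H]] := t_decay.
by apply: tsumP; apply: (bsum_le _ (bsumZ M0 bsum_expR)) => n; exact: H.
Qed.

(** Orthogonality keeps the grid points n/q with q dividing n, and the q frequencies cancel the
    weight 1/q. *)
Let sum_riem_fk p : \sum_(j < q p) riem (fk (Posz j - Posz p)) (q p) = F.
Proof.
have [M [M0 HM]] := fk_le; have q0 : (0 < q p)%N by [].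
have qn0 : (q p)%:R != 0 :> C by rewrite pnatr_eq0.
have H := hasum_bigsum (fun j : 'I_(q p) => hasum_riem q0 M0 (HM (Posz j - Posz p))).
apply: (hasum_unique H) => {H}.
have sE (n : int) : \sum_(j < q p) ((q p)%:R^-1)%:C * fk (Posz j - Posz p) (n%:~R / (q p)%:R)
    = if (q p %| `|n|)%N then f (n%:~R / (q p)%:R) else 0.
  under eq_bigr => j _.
    rewrite /fk mulrCA mulrA.
    rewrite (_ : - _ * _ = - ((Posz j - Posz p) * n)%:~R / (q p)%:R); last first.
      rewrite rmorphM fmorphV rmorph_nat rmorph_int [in RHS]intrM.
      by rewrite mulrA mulNr.
    over.
  rewrite -mulr_sumr (sum_e2pi R p n) fmorphV rmorph_nat.
  by case: ifP => _; rewrite ?mulr0// mulfVK.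
apply: (@hasum_supp _ _ _ _ _ (fun m : int => m * (q p)%:Z) (fun n => (n %/ (q p)%:Z)%Z)
   (fun n => (q p)%:Z %| n)%Z).
- by move=> m; rewrite mulzK.
- by move=> n /divzK.
- by move=> m; rewrite dvdz_mull.
- by move=> n; rewrite sE dvdzE => /negbTE ->.
apply: eq_hasum HF => m; rewrite sE abszM dvdn_mull//.
by congr f; rewrite intrM -pmulrn mulfK// pnatr_eq0.
Qed.

(** Extension by 0 beyond |k| <= p turns the finite sums into families over the fixed index set Z,
    as dominated convergence requires. *)
Let g p (k : int) : C := if (`|k| <= p)%N then riem (fk k) (q p) else 0.

Let Hg p : hasum (g p) F.
Proof.
pose i (j : 'I_(q p)) := Posz j - Posz p.
pose i' (k : int) : 'I_(q p) := inord (absz (k + Posz p)).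
apply: (@hasum_supp R int 'I_(q p) (g p) F i i' (fun k => `|k| <= p)%N); rewrite /i /i'.
- by move=> j; rewrite subrK /= inord_val.
- move=> k kp; rewrite inordK; last by rewrite /q; lia.
  by rewrite gez0_abs ?addrK//; lia.
- by move=> j; have := ltn_ord j; rewrite /q; lia.
- by move=> k; rewrite /g => /negbTE ->.
rewrite -(sum_riem_fk p).
rewrite (eq_bigr (fun j : 'I_(q p) => g p (Posz j - Posz p))); first exact: hasum_fin.
move=> j _; rewrite /g ifT//; by have := ltn_ord j; rewrite /q; lia.
Qed.

(** For fixed k, completing the square and the comparison of Riemann sums make rho * [g p k] close
    to [I p * t k]; the bounds O(1/k^2) and O(exp(-|k|)) dominate. The factor [I p] stays
    unevaluated at this stage. *)
Lemma jacobi_lim (e : R) : 0 < e -> exists Q, forall p, (Q <= p)%N ->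
  normc (rho * F - I p * G) < e.
Proof.
have [M [M0 HM]] := riem_fk_le; have [N [N0 HN]] := t_decay.
have z_small : `|Im (0 : C)| < pi / 4 by rewrite normr0 divr_gt0 ?pi_gt0.
have [L [L0 HL]] : exists L, 0 <= L /\ forall p, normc (I p) <= L.
  have [L [L0 HL]] := gau_decay 0 z_small; exists (L * 4); split; first exact: mulr_ge0.
  by move=> p; apply: riem_le => // x; rewrite -cexp0; exact: HL.
pose B (k : int) := normc rho * M * (1 + `|k|%:R) ^- 2 + L * N * expR (- `|k%:~R|).
apply: (@tannery R int (fun p k => rho * g p k - I p * t k) B).
- by move=> k; apply: addr_ge0; rewrite ?mulr_ge0 ?normc_ge0 ?expR_ge0.
- apply: bsumD; apply: bsumZ; rewrite ?mulr_ge0 ?normc_ge0//.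
    exact: bsum_inv_sqr.
  exact: bsum_expR.
- move=> p k; apply: le_trans (le_normcD _ _) _; rewrite normcN !normcM.
  apply: lerD.
    rewrite -mulrA ler_wpM2l ?normc_ge0// /g; case: ifP => [|_]; first exact: HM.
    by rewrite normc0 mulr_ge0// invr_ge0 exprn_ge0// addr_ge0.
  rewrite -[leRHS]mulrA; apply: ler_pM; rewrite ?normc_ge0//; exact: HL.
- move=> k d d0; pose w := rho * (z + k%:~R * tau).
  have [K [K0 HK]] := riem_gau w l_small.
  exists (maxn `|k| (Num.truncn (normc (t k) * K / d)).+1) => p.
  rewrite geq_max => /andP[kp Kp].
  have [D [D0 HD]] := gau_decay w l_small.
  have -> : g p k = t k * riem (gau rho w) (q p).
    rewrite /g kp /riem -(hasumE (hasumZ (t k) (hasum_riem (ltn0Sn _) D0 HD))).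
    by congr tsum; apply/funext => n; rewrite complete_square mulrCA.
  rewrite mulrCA [I p * _]mulrC -mulrBr normcM.
  apply: le_lt_trans (ler_wpM2l (normc_ge0 _) (HK (q p) _)) _ => //.
  rewrite mulrA ltr_pdivrMr ?ltr0n// [d * _]mulrC -ltr_pdivrMr//.
  apply: lt_le_trans (truncnS_gt _) _; rewrite ler_nat (leq_trans Kp)//.
  by rewrite /q; lia.
by move=> p; apply: hasumB; apply: hasumZ.
Qed.

End Jacobi1.

Section JacobiIdentity.
Variable R : realType.
Local Notation C := R[i].

(** At l = z = 0 both series of [jacobi_lim] are the same number th, so (1 - I p) th tends to 0. All
    terms of th are positive and the one at 0 is 1, hence th does not vanish. *)
Lemma riem_gau1_lim (e : R) : 0 < e -> exists Q, forall p, (Q <= p)%N ->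
  normc (riem (gau 1 0) (2 * p).+1 - 1 : C) < e.
Proof.
move=> e0.
have z_small : `|Im (0 : C)| < pi / 4 by rewrite normr0 divr_gt0 ?pi_gt0.
pose th : C := tsum (fun n : int => gau 1 0 n%:~R).
have Hth : hasum (fun n : int => gau 1 0 n%:~R) th.
  have [M [M0 H]] := gau_decay 0 z_small; rewrite cexp0 in H.
  by apply: tsumP; apply: (bsum_le _ (bsumZ M0 (bsum_expR R))) => n; exact: H.
have gr (n : int) : gau 1 0 n%:~R = (expR (- (pi * n%:~R ^+ 2)))%:C :> C.
  by rewrite -cexp_real /gau; congr cexp; ring.
have thn : 1 / 2 <= normc th.
  have h2 : 0 < (1 / 2 : R) by lra.
  have [A HA] := Hth _ h2; have := HA _ (fsubsetUr [fset 0%Z]%fset A).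
  rewrite (eq_bigr _ (fun n _ => gr n)) -rmorph_sum /=.
  set B := (_ `|` _)%fset; set s := \sum_(n <- _) _ => Hs.
  have s1 : 1 <= s.
    have : \sum_(n <- [fset 0%Z]%fset) expR (- (pi * n%:~R ^+ 2)) <= s.
      by apply: sum_sub_fset (fsubsetUl _ _) => n; exact: expR_ge0.
    by rewrite big_seq_fset1 expr0n mulr0 oppr0 expR0.
  have := le_normcD (s%:C - th) th; rewrite subrK normc_real ger0_norm; lra.
have d0 : 0 < e / 2 by lra.
have [Q HQ] := @jacobi_lim R 0 0 z_small _ d0; exists Q => p /HQ.
rewrite cexp0 !mul1r.
have -> : tsum (fun k : int => e2pi ('i / 1 ^+ 2 * k%:~R ^+ 2 / 2 + k%:~R * 0)) = th.
  congr tsum; apply/funext => k; rewrite e2piE /gau; congr cexp.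
  have i2 : 'i%R * 'i%R = -1 :> C by rewrite -expr2 sqrCi.
  rewrite rmorph_int expr1n divr1 mulr0 !addr0 mul1r.
  transitivity (pi%:C * ('i * 'i) * k%:~R ^+ 2 : C); first by field.
  by rewrite i2; ring.
rewrite -[X in X - _]mul1r -mulrBl normcM normc_subC.
have := normc_ge0 (riem (gau 1 0) (2 * p).+1 - 1 : C); nra.
Qed.

Lemma jacobi1 (l z : C) : `|Im l| < pi / 4 ->
  tsum (fun k : int => e2pi ('i / cexp l ^+ 2 * k%:~R ^+ 2 / 2 + k%:~R * z)) =
  cexp l * tsum (fun n : int => gau (cexp l) (cexp l * z) n%:~R).
Proof.
move=> l_small; set G := LHS; set F := RHS.
apply/eqP; rewrite -subr_eq0; apply/eqP/eq0_normc/eqP.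
rewrite eq_le normc_ge0 andbT; apply/ler_addgt0Pr => e e0; rewrite add0r.
have G1 : 0 < normc G + 1 by have := normc_ge0 G; lra.
have d0 : 0 < e / 2 by lra.
have d1 : 0 < e / 2 / (normc G + 1) by rewrite divr_gt0.
have [Q HQ] := @jacobi_lim R l z l_small _ d0.
have [Q' HQ'] := riem_gau1_lim d1.
pose p := maxn Q Q'.
have := HQ p (leq_maxl _ _); have := HQ' p (leq_maxr _ _).
rewrite -/F -/G; set I := riem _ _ => H1 H2.
have -> : G - F = - (F - I * G + (I - 1) * G) by ring.
rewrite normcN; apply: le_trans (le_normcD _ _) _; rewrite normcM.
move: H1; rewrite ltr_pdivlMr// => H1.
have := normc_ge0 (I - 1); have := normc_ge0 G; nra.
Qed.

End JacobiIdentity.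

(** * The Jacobi identity on the Siegel space *)

Section Schur.
Variable F : fieldType.

Definition dot d (u v : 'rV[F]_d) : F := (u *m v^T) 0 0.
Definition quad d (W : 'M[F]_d) (v : 'rV[F]_d) : F := (v *m W *m v^T) 0 0.

Lemma dotC d (u v : 'rV[F]_d) : dot u v = dot v u.
Proof. by rewrite /dot -[u *m v^T]trmxK trmx_mul trmxK mxE. Qed.

Lemma dotDl d (u v w : 'rV[F]_d) : dot (u + v) w = dot u w + dot v w.
Proof. by rewrite /dot mulmxDl mxE. Qed.

Lemma dotDr d (u v w : 'rV[F]_d) : dot w (u + v) = dot w u + dot w v.
Proof. by rewrite !(dotC w) dotDl. Qed.

Lemma dotZl d (c : F) (u v : 'rV[F]_d) : dot (c *: u) v = c * dot u v.
Proof. by rewrite /dot -scalemxAl mxE. Qed.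

Lemma dotZr d (c : F) (u v : 'rV[F]_d) : dot u (c *: v) = c * dot u v.
Proof. by rewrite !(dotC u) dotZl. Qed.

Lemma dotNl d (u v : 'rV[F]_d) : dot (- u) v = - dot u v.
Proof. by rewrite -scaleN1r dotZl mulN1r. Qed.

Lemma dotNr d (u v : 'rV[F]_d) : dot u (- v) = - dot u v.
Proof. by rewrite !(dotC u) dotNl. Qed.

Lemma dot0l d (v : 'rV[F]_d) : dot 0 v = 0.
Proof. by rewrite /dot mul0mx mxE. Qed.

Lemma dotE d (u v : 'rV[F]_d) : dot u v = \sum_j u 0 j * v 0 j.
Proof. by rewrite /dot mxE; apply: eq_bigr => j _; rewrite mxE. Qed.

Lemma dot_mulmx d (u v : 'rV[F]_d) (W : 'M[F]_d) : W^T = W ->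
  dot (u *m W) v = dot u (v *m W).
Proof. by move=> Ws; rewrite /dot trmx_mul Ws mulmxA. Qed.

Lemma quadE d (W : 'M[F]_d) v : quad W v = dot (v *m W) v.
Proof. by []. Qed.

Lemma quad0 d (W : 'M[F]_d) : quad W 0 = 0.
Proof. by rewrite quadE mul0mx dot0l. Qed.

Lemma quad_sum d (W : 'M[F]_d) v : quad W v = \sum_i \sum_j v 0 i * W i j * v 0 j.
Proof.
rewrite quadE dotE exchange_big; apply: eq_bigr => j _ /=.
by rewrite mxE mulr_suml.
Qed.

Lemma quadN d (W : 'M[F]_d) v : quad (- W) v = - quad W v.
Proof. by rewrite /quad mulmxN mulNmx mxE. Qed.

Lemma quadD d (W : 'M[F]_d) u v : W^T = W ->
  quad W (u + v) = quad W u + 2 * dot u (v *m W) + quad W v.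
Proof.
move=> Ws; rewrite !quadE mulmxDl !dotDl !dotDr.
by rewrite [dot (u *m W) v]dot_mulmx// [dot (v *m W) u]dotC; ring.
Qed.

Lemma quadZ d (W : 'M[F]_d) c v : quad W (c *: v) = c ^+ 2 * quad W v.
Proof. by rewrite !quadE -scalemxAl dotZl dotZr mulrA. Qed.

Definition schur d (W : 'M[F]_(1 + d)) : 'M[F]_d :=
  drsubmx W - (W 0 0)^-1 *: ((ursubmx W)^T *m ursubmx W).

Variables (d : nat) (W : 'M[F]_(1 + d)).
Hypothesis W_sym : W^T = W.
Let a := W 0 0.
Let b : 'rV[F]_d := ursubmx W.
Let D : 'M[F]_d := drsubmx W.

Lemma sym_block : W = block_mx a%:M b b^T D.
Proof.
rewrite -[LHS]submxK; congr (block_mx _ _ _ _).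
  rewrite [LHS]mx11_scalar; congr (_%:M).
  by rewrite !mxE /a; congr (W _ _); apply: val_inj.
by rewrite /b trmx_ursub W_sym.
Qed.

Lemma D_sym : D^T = D.
Proof. by rewrite /D trmx_drsub W_sym. Qed.

Lemma schur_sym : (schur W)^T = schur W.
Proof. by rewrite /schur linearB linearZ /= trmx_mul trmxK -/D D_sym. Qed.

Lemma dot_row (u w : F) (v y : 'rV[F]_d) :
  dot (row_mx u%:M v) (row_mx w%:M y) = u * w + dot v y.
Proof.
by rewrite /dot tr_row_mx mul_row_col mxE tr_scalar_mx mul_scalar_mx !mxE eqxx.
Qed.

Lemma mul_row_sym (u : F) (v : 'rV[F]_d) :
  row_mx u%:M v *m W = row_mx (a * u + dot v b)%:M (u *: b + v *m D).
Proof.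
rewrite [in LHS]sym_block mul_row_block; congr row_mx; last by rewrite mul_scalar_mx.
by rewrite -scalar_mxM mulrC [v *m _]mx11_scalar -raddfD.
Qed.

Lemma quad_block (u : F) (v : 'rV[F]_d) :
  quad W (row_mx u%:M v) = a * u ^+ 2 + 2 * u * dot v b + quad D v.
Proof.
by rewrite quadE mul_row_sym dot_row dotDl dotZl (dotC b) -quadE; ring.
Qed.

Lemma mul_schur (v : 'rV[F]_d) : v *m schur W = v *m D - (a^-1 * dot v b) *: b.
Proof.
rewrite /schur mulmxBr -scalemxAr mulmxA; congr (_ - _).
by rewrite [v *m _^T]mx11_scalar mul_scalar_mx scalerA.
Qed.

Lemma quad_schur (v : 'rV[F]_d) :
  quad (schur W) v = quad D v - a^-1 * dot v b ^+ 2.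
Proof.
by rewrite quadE mul_schur dotDl dotNl dotZl (dotC b) -quadE; ring.
Qed.

Hypothesis a0 : a != 0.

Lemma det_schur : \det W = a * \det (schur W).
Proof.
have WE : W = block_mx 1%:M 0 (a^-1 *: b^T) 1%:M *m block_mx a%:M b 0 (schur W).
  rewrite mulmx_block {1}sym_block; congr (block_mx _ _ _ _).
  - by rewrite mul1mx mul0mx addr0.
  - by rewrite mul1mx mul0mx addr0.
  - by rewrite mulmx0 addr0 mul_mx_scalar scalerA divff// scale1r.
  - by rewrite mul1mx -scalemxAl /schur -/a -/b -/D addrC subrK.
by rewrite [in LHS]WE det_mulmx det_lblock det_ublock !det1 !mul1r det_scalar1.
Qed.

(** Elimination solves (y0, y) W = (u, v): y is v - (u/a) b times the inverse of the Schur
    complement, and y0 follows from the first coordinate. *)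
Lemma quad_invmx (u : F) (v : 'rV[F]_d) : W \in unitmx ->
  quad (invmx W) (row_mx u%:M v) =
    u ^+ 2 / a + quad (invmx (schur W)) (v - (u / a) *: b).
Proof.
move=> Wu; have Su : schur W \in unitmx.
  by move: Wu; rewrite !unitmxE det_schur !unitfE mulf_eq0 negb_or => /andP[].
set v1 := v - _; pose y := v1 *m invmx (schur W).
pose y0 := (u - dot y b) / a.
have yW : row_mx y0%:M y *m W = row_mx u%:M v.
  rewrite mul_row_sym; congr row_mx.
    by congr (_%:M); rewrite /y0 mulrC divfK// subrK.
  have -> : y *m D = v1 + (a^-1 * dot y b) *: b.
    have <- : y *m schur W = v1 by rewrite /y mulmxKV.
    by rewrite mul_schur subrK.
  rewrite addrC -addrA -scalerDl /v1 -addrA -scaleNr -scalerDl.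
  by rewrite (_ : - (u / a) + (a^-1 * dot y b + y0) = 0) ?scale0r ?addr0// /y0; field.
rewrite -{1}yW quadE mulmxK// yW dot_row quadE -/y /v1 dotDr dotNr dotZr /y0.
by field.
Qed.

End Schur.

(** * Positivity on the Siegel space *)

Section Siegel.
Variable R : realType.
Local Notation C := R[i].

Definition l1 d (v : 'rV[R]_d) : R := \sum_j `|v 0 j|.

Lemma posdef_quad d (Y : 'M[R]_d) :
  posdefmx Y <-> forall v : 'rV[R]_d, v != 0 -> 0 < quad Y v.
Proof.
split=> H v v0.
  by have := H v^T; rewrite trmx_eq0 trmxK; apply.
by have := H v^T; rewrite trmx_eq0 /quad trmxK; apply.
Qed.

Lemma row_mx_surj (F : nzRingType) d (v : 'rV[F]_(1 + d)) :
  v = row_mx (v 0 0)%:M (rsubmx v).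
Proof.
rewrite -[LHS]hsubmxK; congr row_mx; rewrite [LHS]mx11_scalar; congr (_%:M).
by rewrite mxE; congr (v _ _); apply: val_inj.
Qed.

Lemma row_mx_entry0 (F : nzRingType) d (u : F) (v : 'rV[F]_d) :
  (row_mx u%:M v : 'rV_(1 + d)) 0 0 = u.
Proof.
have -> : (0 : 'I_(1 + d)) = lshift d 0 by exact: val_inj.
by rewrite row_mxEl mxE eqxx mulr1n.
Qed.

Lemma row_mx_neq0 (F : nzRingType) d (u : F) (v : 'rV[F]_d) :
  v != 0 -> (row_mx u%:M v : 'rV_(1 + d)) != 0.
Proof.
apply: contraNneq => /(congr1 rsubmx); rewrite row_mxKr => ->.
by apply/eqP/rowP => j; rewrite !mxE.
Qed.

Lemma l1_row d (u : R) (v : 'rV[R]_d) : l1 (row_mx u%:M v) = `|u| + l1 v.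
Proof.
rewrite /l1 (big_split_ord) /= big_ord1 row_mxEl mxE eqxx mulr1n; congr (_ + _).
by apply: eq_bigr => j _; rewrite row_mxEr.
Qed.

Lemma l1_ge0 d (v : 'rV[R]_d) : 0 <= l1 v.
Proof. exact: sumr_ge0. Qed.

Lemma dot_gt0 d (v : 'rV[R]_d) : v != 0 -> 0 < dot v v.
Proof.
move=> v0; rewrite dotE; have nn j : true -> 0 <= v 0 j * v 0 j by rewrite -expr2 sqr_ge0.
rewrite lt_neqAle sumr_ge0// andbT eq_sym psumr_eq0//.
apply: contraNN v0 => /allP H; apply/eqP/rowP => j.
by have := H j (mem_index_enum j); rewrite mulf_eq0 orbb => /eqP ->; rewrite mxE.
Qed.

Lemma posdef_diag0 d (Y : 'M[R]_(1 + d)) : Y^T = Y -> posdefmx Y -> 0 < Y 0 0.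
Proof.
move=> Ys /posdef_quad /(_ (row_mx 1%:M 0)); rewrite quad_block//.
rewrite dot0l quad0 expr1n !mulr1 mulr0 !addr0; apply.
apply/eqP => /(congr1 (fun v : 'rV_(1 + d) => v 0 0)).
by rewrite row_mx_entry0 mxE; apply/eqP; exact: oner_neq0.
Qed.

(** The first coordinate chosen is the critical point of the form in that variable, that is, where
    the completed square vanishes. *)
Lemma schur_complete (F : fieldType) d (W : 'M[F]_(1 + d)) (v : 'rV[F]_d) :
  W^T = W -> W 0 0 != 0 ->
  quad W (row_mx (- ((W 0 0)^-1 * dot v (ursubmx W)))%:M v) = quad (schur W) v.
Proof. by move=> Ws a0; rewrite quad_block// quad_schur//; field. Qed.

Lemma posdef_schur d (Y : 'M[R]_(1 + d)) :
  Y^T = Y -> posdefmx Y -> posdefmx (schur Y).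
Proof.
move=> Ys Yp; have a0 := posdef_diag0 Ys Yp.
apply/posdef_quad => v v0; rewrite -schur_complete ?gt_eqF//.
by move/posdef_quad : Yp; apply; exact: row_mx_neq0.
Qed.

Lemma dot_le_l1 d (b : 'rV[R]_d) : exists2 B, 0 <= B &
  forall v, `|dot v b| <= B * l1 v.
Proof.
exists (l1 b); first exact: l1_ge0.
move=> v; rewrite dotE mulr_sumr; apply: le_trans (ler_norm_sum _ _ _) _.
apply: ler_sum => j _; rewrite normrM mulrC ler_wpM2r//.
by rewrite /l1 (bigD1 j)//= lerDl sumr_ge0.
Qed.

(** Linear growth with an arbitrary slope K is the form of positivity that yields summability, and
    it is inherited from the Schur complement: the completed square a x^2 absorbs K|x| at the cost
    K^2/(4a). *)
Lemma posdef_growth d (Y : 'M[R]_d) (K : R) : Y^T = Y -> posdefmx Y -> 0 <= K ->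
  exists M, 0 <= M /\ forall v : 'rV[R]_d, K * l1 v <= quad Y v + M.
Proof.
elim: d => [|d IH] in Y K * => Ys Yp K0.
  exists 0; split=> // v; rewrite /l1 big_ord0 mulr0 addr0 quad_sum.
  by rewrite big_ord0.
have a0 := posdef_diag0 (d := d) Ys Yp; have Sp := posdef_schur (d := d) Ys Yp.
have Ss := schur_sym (d := d) Ys.
set a := Y 0 0 in a0; set S := schur _ in Sp Ss.
pose b : 'rV_d := ursubmx (Y : 'M[R]_(1 + d)).
have [B B0 HB] := dot_le_l1 (a^-1 *: b).
(* The slope K + K B pays both for w and for the difference B l1(w) between |u| and |x|. *)
have [|M [M0 HM]] := IH S (K + K * B) Ss Sp; first by rewrite addr_ge0 ?mulr_ge0.
exists (M + K ^+ 2 / (4 * a)); split=> [|v].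
  by rewrite addr_ge0// divr_ge0 ?sqr_ge0// mulr_ge0// ltW.
have [u [w ->]] : exists u w, v = row_mx u%:M w :> 'rV_(1 + d).
  by eexists; eexists; exact: (@row_mx_surj _ d v).
rewrite (@l1_row d) (@quad_block _ d)// -/a -/b.
have := HM w; rewrite quad_schur// -/a -/b.
set D := quad (drsubmx _) w => {}HM.
have := HB w; rewrite dotZr => {}HB.
pose x := u + a^-1 * dot w b.
have ux : `|u| <= `|x| + B * l1 w.
  rewrite (_ : u = x - a^-1 * dot w b); last by rewrite /x addrK.
  by apply: le_trans (ler_normB _ _) _; rewrite lerD2l.
have E : a * u ^+ 2 + 2 * u * dot w b = a * x ^+ 2 - a^-1 * dot w b ^+ 2.
  by rewrite /x; field; rewrite gt_eqF.
have sq : 0 <= a * ( `|x| - K / (2 * a)) ^+ 2 by rewrite mulr_ge0 ?sqr_ge0// ltW.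
have E2 : a * ( `|x| - K / (2 * a)) ^+ 2 = a * x ^+ 2 - K * `|x| + K ^+ 2 / (4 * a).
  rewrite -[x ^+ 2]real_normK ?num_real//; field; rewrite gt_eqF//.
have := ler_wpM2l K0 ux; move: sq; rewrite E2 E; lra.
Qed.

(** The Hermitian form of W. For symmetric W the terms with Re W cancel in its imaginary part, which
    becomes the real form of Im W at Re v plus the same form at Im v; this carries positivity to
    complex vectors. *)
Definition hq d (W : 'M[C]_d) (v : 'rV[C]_d) : C :=
  dot (map_mx conjc v *m W) v.

Lemma Im_sum I (r : seq I) (P : pred I) (f : I -> C) :
  Im (\sum_(i <- r | P i) f i) = \sum_(i <- r | P i) Im (f i).
Proof. by elim/big_rec2: _ => //= i y [a b] _ <-; case: (f i). Qed.

Lemma Im_hq d (W : 'M[C]_d) v : W^T = W ->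
  Im (hq W v) = quad (Immx W) (map_mx (@Re R) v)
                      + quad (Immx W) (map_mx (@Im R) v).
Proof.
move=> Ws.
have -> : hq W v = \sum_i \sum_j conjc (v 0 i) * W i j * v 0 j.
  rewrite /hq dotE exchange_big; apply: eq_bigr => j _ /=.
  by rewrite mxE mulr_suml; apply: eq_bigr => i _; rewrite !mxE.
rewrite !quad_sum Im_sum -big_split /=.
pose p i := Re (v 0 i); pose q i := Im (v 0 i).
pose X i j := Re (W i j).
have asym : \sum_i \sum_j p i * X i j * q j = \sum_i \sum_j q i * X i j * p j.
  rewrite exchange_big; apply: eq_bigr => i _; apply: eq_bigr => j _ /=.
  by rewrite /X -{1}Ws mxE; ring.
apply/eqP; rewrite -subr_eq0 -sumrB.
rewrite (eq_bigr (fun i => \sum_j p i * X i j * q j - \sum_j q i * X i j * p j)).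
  by rewrite sumrB asym subrr.
move=> i _; rewrite Im_sum -big_split -!sumrB; apply: eq_bigr => j _ /=.
rewrite /p /q /X !mxE; case: (v 0 i) (W i j) (v 0 j) => [a1 a2] [b1 b2] [c1 c2] /=.
by ring.
Qed.

Lemma siegel_hq d (W : 'M[C]_d) v : siegel W -> v != 0 -> 0 < Im (hq W v).
Proof.
move=> [Ws Wp] v0; rewrite Im_hq//.
have nn x : 0 <= quad (Immx W) x.
  have [->|/(posdef_quad _).1 H] := eqVneq x 0; last by exact/ltW/H.
  by rewrite quad0.
have [re0|re0] := eqVneq (map_mx (@Re R) v) 0; last first.
  by rewrite ltr_wpDr//; move/posdef_quad : Wp; apply.
rewrite ltr_wpDl//; move/posdef_quad : Wp; apply.
apply: contraNneq v0 => im0; apply/eqP/rowP => j; rewrite mxE.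
move/rowP/(_ j) : re0; move/rowP/(_ j) : im0; rewrite !mxE.
by case: (v 0 j) => x y /= -> ->.
Qed.

Lemma map_conj_toC d (v : 'rV[R]_d) : map_mx conjc (toCmx v) = toCmx v.
Proof. by apply/rowP => j; rewrite !mxE conjc_real. Qed.

Lemma Im_quad d (W : 'M[C]_d) (v : 'rV[R]_d) : W^T = W ->
  Im (quad W (toCmx v)) = quad (Immx W) v.
Proof.
move=> Ws; rewrite quadE -{1}map_conj_toC -/(hq W _) Im_hq//.
have -> : map_mx (@Re R) (toCmx v) = v by apply/rowP => j; rewrite !mxE.
have -> : map_mx (@Im R) (toCmx v) = 0 by apply/rowP => j; rewrite !mxE.
by rewrite quad0 addr0.
Qed.

Lemma toCmx_eq0 d (v : 'rV[R]_d) : (toCmx v == 0) = (v == 0).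
Proof.
apply/eqP/eqP => [/rowP H|->]; last by apply/rowP => j; rewrite !mxE.
by apply/rowP => j; have := H j; rewrite !mxE => -[].
Qed.

Lemma siegelP d (W : 'M[C]_d) : W^T = W ->
  (forall v : 'rV[R]_d, v != 0 -> 0 < Im (quad W (toCmx v))) -> siegel W.
Proof.
by move=> Ws H; split=> //; apply/posdef_quad => v /H; rewrite Im_quad.
Qed.

Lemma siegel_diag0 d (W : 'M[C]_(1 + d)) : siegel W -> 0 < Im (W 0 0).
Proof.
move=> [Ws Wp]; have Ys := Immx_sym Ws.
by have := posdef_diag0 Ys Wp; rewrite mxE.
Qed.

Lemma Im_gt0_neq0 (z : C) : 0 < Im z -> z != 0.
Proof. by apply: contraTneq => ->; rewrite ltxx. Qed.

(** The vector w = (-c/a, v) has w W = (0, v S), where S is the Schur complement, so the Hermitian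
    form of W at w is the form of S at the real vector v. *)
Lemma siegel_schur d (W : 'M[C]_(1 + d)) : siegel W -> siegel (schur W).
Proof.
move=> WS; have [Ws _] := WS; have a0 := Im_gt0_neq0 (siegel_diag0 WS).
apply: siegelP; first exact: schur_sym.
move=> v v0; set c := dot (toCmx v) (ursubmx W).
pose w : 'rV_(1 + d) := row_mx (- ((W 0 0)^-1 * c))%:M (toCmx v).
have := @siegel_hq _ W w WS; rewrite row_mx_neq0 ?toCmx_eq0// => /(_ isT).
rewrite /hq dot_mulmx// mul_row_sym// -/c.
rewrite (_ : W 0 0 * _ + c = 0); last by field.
rewrite /w map_row_mx map_conj_toC map_scalar_mx dot_row mulr0 add0r.
by rewrite quad_schur// dotDr dotZr -dot_mulmx ?D_sym// -quadE -/c => /lt_le_trans; apply; apply: le_of_eq; congr Im; ring.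
Qed.

Lemma siegel_unit d (W : 'M[C]_d) : siegel W -> W \in unitmx.
Proof.
elim: d W => [|d IH] W WS; first by rewrite unitmxE det_mx00 unitr1.
have a0 := Im_gt0_neq0 (siegel_diag0 (d := d) WS); have [Ws _] := WS.
rewrite unitmxE (@det_schur _ d)// unitrM unitfE a0 -unitmxE.
exact/IH/(@siegel_schur d).
Qed.

(** With w = v W^-1 the Hermitian form of W at w is conj(w).v, and its imaginary part is -Im(w.v)
    because v is real. *)
Lemma siegel_Ninv d (W : 'M[C]_d) : siegel W -> siegel (- invmx W).
Proof.
move=> WS; have Wu := siegel_unit WS; have [Ws _] := WS.
have Vs : (invmx W)^T = invmx W by rewrite trmx_inv Ws.
apply: siegelP; first by rewrite linearN /= Vs.
move=> v v0; pose w := toCmx v *m invmx W.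
have wW : w *m W = toCmx v by rewrite mulmxKV.
have : w != 0 by apply: contraNneq v0 => w0; rewrite -toCmx_eq0 -wW w0 mul0mx.
move/(siegel_hq WS); rewrite /hq dot_mulmx// wW quadN quadE -/w; clearbody w.
rewrite !dotE !Im_sum; rewrite [Im (- _)](_ : _ = - Im (\sum_j w 0 j * toCmx v 0 j)); last by case: (\sum_j _).
rewrite Im_sum -sumrN => H; apply: lt_le_trans H _; apply: le_of_eq.
apply: eq_bigr => j _; rewrite !mxE; case: (w 0 j) => x y /=; ring.
Qed.

(* The matrix of the exponent left by Poisson summation in the first variable
   alone. *)
Definition pinv d (W : 'M[C]_(1 + d)) : 'M[C]_(1 + d) :=
  block_mx (- (W 0 0)^-1)%:M (- (W 0 0)^-1 *: ursubmx W)
           (- (W 0 0)^-1 *: (ursubmx W)^T) (schur W).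

Lemma pinv_sym d (W : 'M[C]_(1 + d)) : siegel W -> (pinv W)^T = pinv W.
Proof.
move=> [Ws _]; rewrite /pinv tr_block_mx tr_scalar_mx !linearZ /= trmxK.
by rewrite schur_sym.
Qed.

Lemma quad_pinv d (W : 'M[C]_(1 + d)) (u : C) (v : 'rV[C]_d) : siegel W ->
  quad (pinv W) (row_mx u%:M v) =
    quad (drsubmx W) v - (u + dot v (ursubmx W)) ^+ 2 / W 0 0.
Proof.
move=> WS; have [Ws _] := WS; have a0 := Im_gt0_neq0 (siegel_diag0 WS).
rewrite quad_block ?pinv_sym// /pinv block_mxKur block_mxKdr quad_schur//.
have -> : (0 : 'I_(1 + d)) = lshift d 0 by exact: val_inj.
rewrite block_mxEul mxE eqxx mulr1n dotZr.
have -> : lshift d (0 : 'I_1) = (0 : 'I_(1 + d)) by exact: val_inj.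
by field.
Qed.

(** The Hermitian form of W at w = (-(u + c)/a, x), whose image under W has first coordinate -u, has
    the same imaginary part as the form of [pinv] at (u, x). *)
Lemma siegel_pinv d (W : 'M[C]_(1 + d)) : siegel W -> siegel (pinv W).
Proof.
move=> WS; have [Ws _] := WS; have a0 := Im_gt0_neq0 (siegel_diag0 WS).
apply: siegelP; first exact: pinv_sym.
move=> v; rewrite [v]row_mx_surj; set u := v 0 0; set x := rsubmx v => v0.
have -> : toCmx (row_mx u%:M x) = row_mx u%:C%:M (toCmx x).
  by rewrite /toCmx map_row_mx map_scalar_mx.
rewrite quad_pinv//; set c := dot _ _.
pose w0 : C := - (u%:C + c) / W 0 0.
pose w : 'rV_(1 + d) := row_mx w0%:M (toCmx x).
have w_neq0 : w != 0.
  apply: contraNneq v0 => w00.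
  have x0 : x = 0 by apply/eqP; rewrite -toCmx_eq0; move/(congr1 rsubmx) : w00; rewrite row_mxKr => ->; apply/eqP/rowP => j; rewrite !mxE.
  have : w0 = 0.
    by rewrite -(@row_mx_entry0 _ d w0 (toCmx x)) -/w w00 mxE.
  rewrite /w0 /c x0 dotE big1 => [|j _]; last by rewrite !mxE mul0r.
  move=> /eqP; rewrite addr0 mulf_eq0 invr_eq0 (negbTE a0) orbF oppr_eq0.
  rewrite eq_complex /= eqxx andbT => /eqP u0.
  by apply/eqP/rowP => j; rewrite u0 !mxE; case: splitP => k _; rewrite !mxE ?mul0rn// ord1.
have := siegel_hq WS w_neq0; rewrite /hq dot_mulmx// mul_row_sym// -/c.
rewrite (_ : W 0 0 * w0 + c = - u%:C); last by rewrite /w0; field.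
rewrite /w map_row_mx map_conj_toC map_scalar_mx dot_row.
rewrite dotDr dotZr -dot_mulmx ?D_sym// -quadE -/c.
move=> /lt_le_trans; apply; apply: le_of_eq.
have -> : quad (drsubmx W) (toCmx x) - (u%:C + c) ^+ 2 / W 0 0 =
   quad (drsubmx W) (toCmx x) + u%:C * w0 + w0 * c by rewrite /w0; field.
move: {w w_neq0} (quad _ _) => k; clearbody w0; move: w0 => w0.
clearbody c; case: w0 k c => [w1 w2] [k1 k2] [c1 c2] /=; ring.
Qed.

End Siegel.

(** * Absolute convergence of theta series *)

Section Lattice.
Variable R : realType.
Local Notation C := R[i].

Lemma bsum_l1 d : bsum (fun N : 'rV[int]_d => expR (- l1 (map_mx intr N : 'rV[R]_d))).
Proof.
elim: d => [|d IH].
  exists 1 => A; have sub : (A `<=` [fset 0])%fset.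
    by apply/fsubsetP => N _; rewrite inE; apply/eqP/rowP => -[].
  apply: le_trans (sum_sub_fset _ sub) _ => [N|]; first exact: expR_ge0.
  by rewrite big_seq_fset1 /l1 big_ord0 oppr0 expR0.
pose h (N : 'rV[int]_(1 + d)) : int * 'rV[int]_d := (N 0 0, rsubmx N).
have hI : injective h.
  by move=> N N' []; rewrite [N]row_mx_surj [N']row_mx_surj !row_mx_entry0 !row_mxKr => -> ->.
have := bsum_inj hI (bsum_prod (fun n => expR_ge0 _) (fun N => expR_ge0 _) (bsum_expR R) IH).
apply: bsum_le => N; rewrite -expRD ler_expR -opprD lerN2.
have -> : map_mx intr N = row_mx ((N 0 0)%:~R%:M) (map_mx intr (rsubmx N)) :> 'rV[R]_(1 + d).
  by rewrite {1}[N]row_mx_surj map_row_mx map_scalar_mx.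
by rewrite l1_row.
Qed.

Definition zC d (N : 'rV[int]_d) : 'rV[C]_d := map_mx intr N.

Lemma zCE d (N : 'rV[int]_d) : zC N = toCmx (map_mx intr N).
Proof. by apply/rowP => j; rewrite !mxE rmorph_int. Qed.

Lemma zC_row d (n : int) (N : 'rV[int]_d) :
  zC (row_mx n%:M N : 'rV[int]_(1 + d)) = row_mx n%:~R%:M (zC N).
Proof. by rewrite /zC map_row_mx map_scalar_mx. Qed.

Definition thterm d (W : 'M[C]_d) (z : 'rV[C]_d) (x : 'rV[C]_d) : C :=
  e2pi (quad W x / 2 + dot x z).

Lemma normc_e2pi (z : C) : normc (e2pi z) = expR (- (2 * pi * Im z)).
Proof.
rewrite e2piE normc_cexp; congr expR.
have -> : 2 * pi%:C * 'i%R * z = (2 * pi)%:C * ('i%C * z).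
  rewrite [RHS]mulrA; congr (_ * _ * _). ring.
by case: z => a b /=; ring.
Qed.

(** The linear term in z costs at most exp(2 pi B l1(x)), which the slope (K + 2 pi B)/pi of the
    quadratic form absorbs. The rate K is left free so that polynomial factors can be absorbed
    later. *)
Lemma thterm_decay d (W : 'M[C]_d) z (K : R) : siegel W -> 0 <= K ->
  exists M, 0 <= M /\ forall x : 'rV[R]_d,
    normc (thterm W z (toCmx x)) <= M * expR (- (K * l1 x)).
Proof.
move=> WS K0; have [Ws Yp] := WS.
have Ys := Immx_sym Ws.
have pi0 := pi_gt0 R.
have [B B0 HB] := dot_le_l1 (map_mx (@Im R) z).
have [|M [M0 HM]] := posdef_growth (K := (K + 2 * pi * B) / pi) Ys Yp.
  by apply: divr_ge0; rewrite ?(ltW pi0)// addr_ge0// mulr_ge0// mulr_ge0// ltW.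
exists (expR (pi * M)); split=> [|x]; first exact: expR_ge0.
rewrite /thterm normc_e2pi -expRD ler_expR.
have -> : Im (quad W (toCmx x) / 2 + dot (toCmx x) z) =
    quad (Immx W) x / 2 + dot x (map_mx (@Im R) z).
  rewrite -Im_quad//.
  have -> : dot x (map_mx (@Im R) z) = Im (dot (toCmx x) z).
    rewrite !dotE Im_sum; apply: eq_bigr => j _; rewrite !mxE.
    by case: (z 0 j) => u v /=; rewrite mul0r addr0.
  have I2 (y : C) : Im (y / 2) = Im y / 2.
    have -> : y / 2 = (2^-1)%:C * y by rewrite mulrC fmorphV rmorph_nat.
    by case: y => u v /=; rewrite mul0r addr0 mulrC.
  by rewrite -I2; case: (_ / 2) (dot _ _) => ? ? [? ?].
have := HB x; have := HM x.
have -> : (K + 2 * pi * B) / pi * l1 x = (K * l1 x + 2 * pi * (B * l1 x)) / pi.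
  by rewrite mulrAC mulrDl -[2 * pi * B * _]mulrA.
rewrite ler_pdivrMr//; have := normr_ge0 (dot x (map_mx (@Im R) z)).
set D := dot _ _; set Q := quad _ _; set L := K * _; set BL := B * _.
move=> _ H1 H2; have : - D <= BL by apply: le_trans H2; rewrite -normrN ler_norm.
by move/(ler_wpM2l (ltW pi0)); move: H1; lra.
Qed.

Lemma bsum_thterm d (W : 'M[C]_d) z : siegel W ->
  bsum (fun N : 'rV[int]_d => normc (thterm W z (zC N))).
Proof.
move=> WS; have [M [M0 H]] := thterm_decay z WS ler01.
apply: (bsum_le _ (bsumZ M0 (bsum_l1 d))) => N.
by rewrite zCE -[l1 _]mul1r; exact: H.
Qed.

Lemma bsum_slice_l (T1 T2 : choiceType) (f : T1 * T2 -> C) x :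
  bsum (fun p => normc (f p)) -> bsum (fun y => normc (f (x, y))).
Proof. by apply: (bsum_inj (h := fun y : T2 => (x, y))) => y y' []. Qed.

Lemma bsum_slice_r (T1 T2 : choiceType) (f : T1 * T2 -> C) y :
  bsum (fun p => normc (f p)) -> bsum (fun x => normc (f (x, y))).
Proof. by apply: (bsum_inj (h := fun x : T1 => (x, y))) => x x' []. Qed.

Lemma hasum_fubini_l (T1 T2 : choiceType) (f : T1 * T2 -> C) :
  bsum (fun p => normc (f p)) ->
  hasum (fun x => tsum (fun y => f (x, y))) (tsum f).
Proof.
move=> bf; apply: hasum_fubini (tsumP bf) => x.
exact/tsumP/bsum_slice_l.
Qed.

Lemma hasum_fubini_r (T1 T2 : choiceType) (f : T1 * T2 -> C) :
  bsum (fun p => normc (f p)) ->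
  hasum (fun y => tsum (fun x => f (x, y))) (tsum f).
Proof.
move=> bf; apply: (@hasum_fubini _ _ _ (fun p => f (p.2, p.1))) => [y|].
  exact/tsumP/bsum_slice_r.
pose sw S1 S2 (p : S1 * S2) := (p.2, p.1).
by apply: (@hasum_bij _ _ _ f _ (sw T2 T1) (sw T1 T2) _ _ (tsumP bf)) => -[].
Qed.

Lemma tsumZ_neq0 (T : choiceType) (c : C) (f : T -> C) : c != 0 ->
  bsum (fun t => normc (c * f t)) -> tsum (fun t => c * f t) = c * tsum f.
Proof.
move=> c0 bf; rewrite tsumZ//.
apply: (bsum_le _ (bsumZ (normc_ge0 c^-1) bf)) => t.
by rewrite -normcM mulKf.
Qed.

Lemma tsum_bij (T T' : choiceType) (f : T -> C) (h : T' -> T) (h' : T -> T') :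
  cancel h h' -> cancel h' h -> bsum (fun t => normc (f t)) ->
  tsum f = tsum (fun t => f (h t)).
Proof. by move=> hK h'K /tsumP H; rewrite (hasumE (hasum_bij hK h'K H)). Qed.

Lemma eq_tsum (T : choiceType) (f g : T -> C) : f =1 g -> tsum f = tsum g.
Proof. by move=> /funext ->. Qed.

(** Expanding the square gives a constant times the theta series of -W^-1, which lies in the Siegel
    space. *)
Lemma bsum_dual d (W : 'M[C]_d) z : siegel W ->
  bsum (fun N : 'rV[int]_d => normc (e2pi (- quad (invmx W) (zC N + z) / 2))).
Proof.
move=> WS; have [Ws _] := WS; set V := invmx W.
have Vs : V^T = V by rewrite trmx_inv Ws.
have H := bsumZ (normc_ge0 (e2pi (- quad V z / 2))) (bsum_thterm (- (z *m V)) (siegel_Ninv WS)).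
apply: bsum_le H => N; rewrite -normcM /thterm -e2piD quadN quadD// dotNr -/V.
by apply: le_of_eq; congr (normc (e2pi _)); field.
Qed.

Lemma tsum_row d (f : 'rV[int]_(1 + d) -> C) : bsum (fun N => normc (f N)) ->
  tsum f = tsum (fun p : int * 'rV[int]_d => f (row_mx p.1%:M p.2)).
Proof.
apply: (tsum_bij (h' := fun N : 'rV[int]_(1 + d) => (N 0 0, rsubmx N))) => [[n N]|N] /=.
  by rewrite row_mx_entry0 row_mxKr.
by rewrite -row_mx_surj.
Qed.

Lemma bsum_row d (f : 'rV[int]_(1 + d) -> R) : bsum f ->
  bsum (fun p : int * 'rV[int]_d => f (row_mx p.1%:M p.2)).
Proof.
apply: (bsum_inj (h := fun p : int * 'rV[int]_d => row_mx p.1%:M p.2 : 'rV_(1 + d))).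
move=> [n N] [n' N'] /= H; congr (_, _).
  by have := congr1 (fun v : 'rV_(1 + d) => v 0 0) H; rewrite !row_mx_entry0.
by have := congr1 rsubmx H; rewrite !row_mxKr.
Qed.

End Lattice.

(** * From one variable to d variables *)

Section UpperHalf.
Variable R : realType.
Local Notation C := R[i].

(* Half of the logarithm of i / a; the square root of i / a with positive real
   part is [cexp (hlog a)]. *)
Definition hlog (a : C) : C := ('i%C * (pi / 2)%:C - clog a) / 2.

Lemma cmod_gt0 (z : C) : z != 0 -> 0 < cmod z.
Proof.
move=> z0; rewrite lt_neqAle eq_sym sqrtr_ge0 andbT; apply: contraNneq z0.
by move=> H; apply/eqP/eq0_normc; case: z H.
Qed.

Lemma Re_cmod_lt (z : C) : 0 < Im z -> -1 < Re z / cmod z < 1.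
Proof.
move=> I0; have c0 := cmod_gt0 (Im_gt0_neq0 I0).
rewrite -ltr_norml normrM (gtr0_norm (x := (cmod z)^-1)) ?invr_gt0//.
rewrite ltr_pdivrMr// mul1r -sqrtr_sqr ltr_sqrt.
  by rewrite ltrDl exprn_gt0.
by rewrite ltr_wpDl ?sqr_ge0 ?exprn_gt0.
Qed.

Lemma carg_upper (z : C) : 0 < Im z -> carg z = acos (Re z / cmod z).
Proof. by move=> /ltW I0; rewrite /carg I0. Qed.

(** Im(hlog a) = (pi/2 - arg a)/2 with 0 < arg a < pi, which is exactly the range allowed in
    dimension one. *)
Lemma hlog_small (a : C) : 0 < Im a -> `|Im (hlog a)| < pi / 4.
Proof.
move=> a0; have /andP[l u] := Re_cmod_lt a0.
have g0 : 0 < acos (Re a / cmod a) by apply: acos_gt0; rewrite (ltW l) u.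
have gp : acos (Re a / cmod a) < pi by apply: acos_ltpi; rewrite l (ltW u).
have -> : Im (hlog a) = (pi / 2 - acos (Re a / cmod a)) / 2.
  rewrite /hlog -carg_upper//.
  have -> : (2^-1 : C) = (2^-1)%:C by rewrite fmorphV rmorph_nat.
  by rewrite /clog /=; ring.
by rewrite ltr_norml; apply/andP; split; lra.
Qed.

Lemma cexp_hlog_sqr (a : C) : a != 0 -> cexp (hlog a) ^+ 2 = 'i%R / a.
Proof.
move=> a0; rewrite -cexpMn /hlog mulr2n -splitr cexpB clogK//.
congr (_ / _); rewrite /cexp /= !mul0r !mul1r subr0 expR0 add0r.
by rewrite !mul1r cos_pihalf sin_pihalf.
Qed.

(** A branch of det(W/i)^(-1/2): the product of the roots of i/a with positive real part over the
    pivots a of symmetric elimination. *)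
Fixpoint kappa d : 'M[C]_d -> C :=
  match d with
  | 0 => fun=> 1
  | d.+1 => fun W => cexp (hlog ((W : 'M[C]_(1 + d)) 0 0)) * kappa (schur (W : 'M[C]_(1 + d)))
  end.

Lemma jacobi_upper (a s : C) : 0 < Im a ->
  tsum (fun k : int => e2pi (a * k%:~R ^+ 2 / 2 + k%:~R * s)) =
  cexp (hlog a) * tsum (fun n : int => e2pi (- ((n%:~R + s) ^+ 2 / (2 * a)))).
Proof.
move=> Ia; have a0 := Im_gt0_neq0 Ia.
have := jacobi1 s (hlog_small Ia); rewrite cexp_hlog_sqr//.
have -> : 'i%R / ('i%R / a) = a.
  by rewrite invf_div mulrC divfK// neq0Ci.
move=> ->; congr (_ * _); apply: eq_tsum => n; rewrite /gau e2piE; congr cexp.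
rewrite -mulrDr exprMn cexp_hlog_sqr//.
have -> : (n%:~R : R)%:C = n%:~R :> C by rewrite rmorph_int.
by field.
Qed.

Lemma jacobi d (W : 'M[C]_d) (z : 'rV[C]_d) : siegel W ->
  tsum (fun N : 'rV[int]_d => thterm W z (zC R N)) =
  kappa W * tsum (fun N : 'rV[int]_d => e2pi (- quad (invmx W) (zC R N + z) / 2)).
Proof.
elim: d => [|d IH] in W z *.
  move=> _; rewrite mul1r; apply: eq_tsum => N; congr e2pi.
  by rewrite !quad_sum !big_ord0 dotE big_ord0 oppr0 !mul0r addr0.
move=> WS; have [Ws _] := WS.
have Ia := @siegel_diag0 _ d W WS; have SS := @siegel_schur _ d W WS.
have Wu := siegel_unit WS.
set a := (W : 'M[C]_(1 + d)) 0 0 in Ia *; have a0 := Im_gt0_neq0 Ia.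
pose b : 'rV[C]_d := ursubmx (W : 'M[C]_(1 + d)).
pose D : 'M[C]_d := drsubmx (W : 'M[C]_(1 + d)).
set S := schur (W : 'M[C]_(1 + d)) in SS.
have [z1 [z' ->]] : exists z1 z', z = row_mx z1%:M z' :> 'rV_(1 + d).
  by eexists; eexists; exact: (@row_mx_surj _ d z).
pose zt : 'rV[C]_(1 + d) := row_mx (- (z1 / a))%:M (z' - (z1 / a) *: b).
pose cst : C := e2pi (- (z1 ^+ 2 / (2 * a))).
(* The double series after Poisson summation in the first variable alone. As a theta series of
   [pinv] W it converges absolutely, which permits the exchange of the two summations. *)
pose g (p : int * 'rV[int]_d) : C :=
  cst * thterm (pinv (W : 'M[C]_(1 + d))) zt (zC R (row_mx p.1%:M p.2 : 'rV_(1 + d))).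
have gE m N : g (m, N) = e2pi (quad D (zC R N) / 2 + dot (zC R N) z') *
    e2pi (- ((m%:~R + (dot (zC R N) b + z1)) ^+ 2 / (2 * a))).
  rewrite /g /cst /thterm zC_row quad_pinv// dot_row dotDr dotNr dotZr -/a -/b -/D -!e2piD.
  by congr e2pi; field.
have bg : bsum (fun p => normc (g p)).
  have H := bsum_row (bsum_thterm zt (siegel_pinv (d := d) WS)).
  by apply: (bsum_le _ (bsumZ (normc_ge0 cst) H)) => p; rewrite normcM.
(* Read for fixed m, the same terms form a theta series in N for the Schur complement, to which the
   induction hypothesis applies. *)
have gE2 m N : g (m, N) = e2pi (- ((m%:~R + z1) ^+ 2 / (2 * a))) *
    thterm S (z' - ((m%:~R + z1) / a) *: b) (zC R N).
  rewrite gE /thterm quad_schur// dotDr dotNr dotZr -/a -/b -/D -!e2piD.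
  by congr e2pi; field.
have bL := bsum_thterm (row_mx z1%:M z' : 'rV_(1 + d)) WS.
pose f (p : int * 'rV[int]_d) := thterm W (row_mx z1%:M z') (zC R (row_mx p.1%:M p.2 : 'rV_(1 + d))).
have bf : bsum (fun p => normc (f p)) by exact: (bsum_row (d := d)) bL.
rewrite (@tsum_row _ d)// -/f -(hasumE (hasum_fubini_r bf)).
have -> : tsum (fun N : 'rV[int]_d => tsum (fun n : int => f (n, N))) =
    cexp (hlog a) * tsum g.
  rewrite -(hasumE (hasumZ _ (hasum_fubini_r bg))); apply: eq_tsum => N.
  set e := e2pi (quad D (zC R N) / 2 + dot (zC R N) z').
  have fE (n : int) : f (n, N) = e * e2pi (a * n%:~R ^+ 2 / 2 + n%:~R * (dot (zC R N) b + z1)).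
    rewrite /f /thterm (@zC_row _ d) (@quad_block _ d)// (@dot_row _ d) -e2piD.
    by congr e2pi; rewrite -/a -/b -/D; field.
  have := bsum_slice_r N bf; have := bsum_slice_r N bg.
  rewrite (eq_tsum fE) (eq_tsum (gE^~ N)).
  under eq_fun do rewrite gE; move=> b1; under eq_fun do rewrite fE; move=> b2.
  by rewrite !tsumZ_neq0 ?e2pi_neq0// jacobi_upper// mulrCA.
rewrite -[kappa W]/(cexp (hlog a) * kappa S) -mulrA; congr (_ * _).
pose r (p : int * 'rV[int]_d) :=
  e2pi (- quad (invmx W) (zC R (row_mx p.1%:M p.2 : 'rV_(1 + d)) + row_mx z1%:M z') / 2).
have bD := bsum_dual (row_mx z1%:M z' : 'rV_(1 + d)) WS.
have br : bsum (fun p => normc (r p)) by exact: (bsum_row (d := d)) bD.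
rewrite (@tsum_row _ d)// -/r -(hasumE (hasum_fubini_l bg)).
rewrite -(hasumE (hasumZ _ (hasum_fubini_l br))); apply: eq_tsum => m.
have rE (N : 'rV[int]_d) : r (m, N) = e2pi (- ((m%:~R + z1) ^+ 2 / (2 * a))) *
    e2pi (- quad (invmx S) (zC R N + (z' - ((m%:~R + z1) / a) *: b)) / 2).
  rewrite /r (@zC_row _ d) add_row_mx -raddfD (@quad_invmx _ d)// -/a -/b -/S addrA -e2piD.
  by congr e2pi; field.
have bt := bsum_thterm (z' - ((m%:~R + z1) / a) *: b) SS.
have bd := bsum_dual (z' - ((m%:~R + z1) / a) *: b) SS.
rewrite (eq_tsum (gE2 m)) (eq_tsum rE) !tsumZ// IH//.
by rewrite mulrCA.
Qed.

End UpperHalf.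

(** * The branch of the square root *)

Section Branch.
Variable R : realType.
Local Notation C := R[i].

Lemma contD (f g : R -> R) : continuous f -> continuous g ->
  continuous (fun s => f s + g s).
Proof. by move=> fc gc x; exact: (continuousD (fc x) (gc x)). Qed.

Lemma contN (f : R -> R) : continuous f -> continuous (fun s => - f s).
Proof. by move=> fc x; exact: (continuousN (fc x)). Qed.

Lemma contM (f g : R -> R) : continuous f -> continuous g ->
  continuous (fun s => f s * g s).
Proof. by move=> fc gc x; exact: (continuousM (fc x) (gc x)). Qed.

Lemma contV (f : R -> R) : (forall s, f s != 0) -> continuous f ->
  continuous (fun s => (f s)^-1).
Proof. by move=> f0 fc x; exact: (continuousV (f0 x) (fc x)). Qed.

(** Continuity of a complex function of a real parameter, by components, so that real continuity
    lemmas and the intermediate value theorem apply. *)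
Definition cc (f : R -> C) : Prop :=
  continuous (fun s => Re (f s)) /\ continuous (fun s => Im (f s)).

Lemma cc_ext (f g : R -> C) : (forall s, f s = g s) -> cc f -> cc g.
Proof. by move=> /funext ->. Qed.

Lemma cc_re_im (u v : R -> R) : continuous u -> continuous v ->
  cc (fun s => u s +i* v s).
Proof. by []. Qed.

Lemma cc_cst (c : C) : cc (fun=> c).
Proof. by split => x; exact: cvg_cst. Qed.

Lemma ccD f g : cc f -> cc g -> cc (fun s => f s + g s).
Proof.
move=> [f1 f2] [g1 g2].
apply: (@cc_ext (fun s => (Re (f s) + Re (g s)) +i* (Im (f s) + Im (g s)))).
  by move=> s; case: (f s) (g s) => ? ? [? ?].
by apply: cc_re_im; exact: contD.
Qed.

Lemma ccM f g : cc f -> cc g -> cc (fun s => f s * g s).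
Proof.
move=> [f1 f2] [g1 g2].
apply: (@cc_ext (fun s => (Re (f s) * Re (g s) - Im (f s) * Im (g s))
   +i* (Re (f s) * Im (g s) + Im (f s) * Re (g s)))).
  by move=> s; case: (f s) (g s) => ? ? [? ?].
apply: cc_re_im; last by apply: contD; exact: contM.
by apply: contD; [exact: contM | apply: contN; exact: contM].
Qed.

Lemma cc_prod (I : eqType) (r : seq I) (f : I -> R -> C) :
  (forall i, i \in r -> cc (f i)) -> cc (fun s => \prod_(i <- r) f i s).
Proof.
elim: r => [|i r IH] H.
  by apply: cc_ext (cc_cst 1) => s; rewrite big_nil.
have Hr : cc (fun s => \prod_(i <- r) f i s).
  by apply: IH => j jr; apply: H; rewrite inE jr orbT.
by apply: cc_ext (ccM (H i (mem_head _ _)) Hr) => s; rewrite big_cons.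
Qed.

Lemma ccX f k : cc f -> cc (fun s => f s ^+ k).
Proof.
move=> fc; elim: k => [|k IH]; first exact: cc_cst.
by apply: cc_ext (ccM fc IH) => s; rewrite exprS.
Qed.

Lemma sum_sqr_gt0 (z : C) : z != 0 -> 0 < Re z ^+ 2 + Im z ^+ 2.
Proof. by move=> /cmod_gt0; rewrite /cmod sqrtr_gt0. Qed.

Lemma cc_sum_sqr f : cc f -> continuous (fun s => Re (f s) ^+ 2 + Im (f s) ^+ 2).
Proof. by move=> [f1 f2]; apply: contD; exact: contM. Qed.

Lemma ccV f : (forall s, f s != 0) -> cc f -> cc (fun s => (f s)^-1).
Proof.
move=> f0 fc; have [f1 f2] := fc.
have nc : continuous (fun s => (Re (f s) ^+ 2 + Im (f s) ^+ 2)^-1).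
  apply: contV; last exact: (cc_sum_sqr fc).
  by move=> s; rewrite gt_eqF// sum_sqr_gt0.
apply: (@cc_ext (fun s => (Re (f s) * (Re (f s) ^+ 2 + Im (f s) ^+ 2)^-1)
   +i* (- (Im (f s) * (Re (f s) ^+ 2 + Im (f s) ^+ 2)^-1)))).
  by move=> s; case: (f s) => u v.
by apply: cc_re_im; [exact: contM | apply: contN; exact: contM].
Qed.

Lemma cc_cexp f : cc f -> cc (fun s => cexp (f s)).
Proof.
move=> [f1 f2].
have e1 : continuous (fun s => expR (Re (f s))).
  by move=> x; apply: continuous_comp; [exact: f1|exact: continuous_expR].
apply: cc_re_im; apply: contM => // x.
- by apply: continuous_comp; [exact: f2|exact: continuous_cos].
- by apply: continuous_comp; [exact: f2|exact: continuous_sin].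
Qed.

Lemma cc_hlog f : (forall s, 0 < Im (f s)) -> cc f -> cc (fun s => hlog (f s)).
Proof.
move=> I0 fc; have [f1 f2] := fc.
have f0 s : f s != 0 by exact: Im_gt0_neq0.
have mc : continuous (fun s => cmod (f s)).
  move=> x; rewrite /cmod.
  apply: (@continuous_comp _ _ _ (fun s => Re (f s) ^+ 2 + Im (f s) ^+ 2) Num.sqrt); first exact: (cc_sum_sqr fc).
  exact: sqrt_continuous.
apply: (ccM _ (cc_cst 2^-1)); apply: ccD; first exact: cc_cst.
suff H : cc (fun s => clog (f s)).
  by apply: cc_ext (ccM (cc_cst (-1)) H) => s; rewrite mulN1r.
apply: (@cc_ext (fun s => ln (cmod (f s)) +i* acos (Re (f s) / cmod (f s)))).
  by move=> s; rewrite /clog carg_upper.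
apply: cc_re_im => x.
  by apply: continuous_comp; [exact: mc | apply: continuous_ln; exact: cmod_gt0].
apply: (@continuous_comp _ _ _ (fun s => Re (f s) / cmod (f s)) acos).
  by apply: contM => //; apply: contV => // s; rewrite gt_eqF// cmod_gt0.
by apply: continuous_acos; exact: Re_cmod_lt.
Qed.

Lemma cc_kappa d (W : R -> 'M[C]_d) : (forall s, siegel (W s)) ->
  (forall i j, cc (fun s => W s i j)) -> cc (fun s => kappa (W s)).
Proof.
elim: d W => [|d IH] W WS Wc; first exact: cc_cst.
have a0 s := @siegel_diag0 _ d (W s) (WS s).
apply: ccM; first by apply: cc_cexp; apply: cc_hlog; [exact: a0 | exact: Wc].
apply: IH => [s|i j]; first exact: (@siegel_schur _ d).
have Ss s := (WS s).1.
apply: (@cc_ext (fun s => W s (rshift 1 i) (rshift 1 j) +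
    (-1) * ((W s 0 0)^-1 * (W s 0 (rshift 1 i) * W s 0 (rshift 1 j))))).
  move=> s; rewrite !mxE big_ord1 !mxE mulN1r.
  have -> : (lshift d 0 : 'I_(1 + d)) = (0 : 'I_(1 + d)) by exact: val_inj.
  by [].
apply: ccD; first exact: Wc.
apply: (ccM (cc_cst _)); apply: ccM; last by apply: ccM; exact: Wc.
by apply: ccV => [s|]; [exact: Im_gt0_neq0 (a0 s) | exact: Wc].
Qed.

Lemma kappa_sqr d (W : 'M[C]_d) : siegel W -> kappa W ^+ 2 * \det W = 'i%R ^+ d.
Proof.
elim: d W => [|d IH] W WS; first by rewrite det_mx00 expr1n mulr1.
have [Ws _] := WS; have a0 := Im_gt0_neq0 (@siegel_diag0 _ d W WS).
rewrite [kappa W]/(cexp _ * kappa _) (@det_schur _ d)// exprMn cexp_hlog_sqr//.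
rewrite mulrACA (IH _ (@siegel_schur _ d W WS)) divfK//.
by rewrite exprS.
Qed.

Lemma posdef_det_gt0 d (Y : 'M[R]_d) : Y^T = Y -> posdefmx Y -> 0 < \det Y.
Proof.
elim: d Y => [|d IH] Y Ys Yp; first by rewrite det_mx00.
have a0 := @posdef_diag0 _ d Y Ys Yp.
rewrite (@det_schur _ d)// ?gt_eqF// mulr_gt0//.
by apply: IH; [exact: (@schur_sym _ d) | exact: (@posdef_schur _ d)].
Qed.

Lemma hlog_imag (y : R) : 0 < y -> hlog ('i%C * y%:C) = (- (ln y / 2))%:C.
Proof.
move=> y0; have -> : 'i%C * y%:C = 0 +i* y.
  by apply: eqC => /=; ring.
rewrite /hlog /clog carg_upper//= /cmod /= expr0n add0r sqrtr_sqr gtr0_norm//.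
rewrite mul0r acos0.
have -> : (2^-1 : C) = (2^-1)%:C by rewrite fmorphV rmorph_nat.
by apply: eqC => /=; ring.
Qed.

(** Schur complements commute with the factor i, and each pivot is i y with y > 0, where i/(i y) has
    a positive root. This fixes the sign at the start of the path. *)
Lemma kappa_imag d (Y : 'M[R]_d) : Y^T = Y -> posdefmx Y ->
  exists2 r : R, 0 < r & kappa ('i%C *: toCmx Y) = r%:C.
Proof.
elim: d Y => [|d IH] Y Ys Yp; first by exists 1.
have a0 := @posdef_diag0 _ d Y Ys Yp.
have [r r0 rE] := IH _ (@schur_sym _ d Y Ys) (@posdef_schur _ d Y Ys Yp).
rewrite [kappa _]/(cexp _ * kappa _) !mxE hlog_imag// cexp_real.
have -> : schur ('i%C *: toCmx Y : 'M[C]_(1 + d)) = 'i%C *: toCmx (schur (Y : 'M[R]_(1 + d))).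
  have y0 : (Y 0 0)%:C != 0 :> C by rewrite fmorph_eq0 gt_eqF.
  have i0 : 'i%R != 0 :> C by exact: neq0Ci.
  have i2 : 'i%R * 'i%R = -1 :> C by rewrite -expr2 sqrCi.
  apply/matrixP => i j; rewrite !mxE !big_ord1 !mxE.
  move: i0 i2; rewrite -[Num.imaginary]/('i%C); set I := 'i%C => i0 i2.
  rewrite rmorphB !rmorphM fmorphV /=; field.
  by rewrite y0 i0.
exists (expR (- (ln (Y 0 0) / 2)) * r); first by rewrite mulr_gt0 ?expR_gt0.
by rewrite rE [RHS]rmorphM.
Qed.

(** The values are 1 or -1; by the intermediate value theorem a change of sign would force the real
    part through 0. *)
Lemma cc_sign (f : R -> C) : cc f -> (forall s, f s ^+ 2 = 1) -> f 0 = 1 -> f 1 = 1.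
Proof.
move=> [f1 _] f2 f0.
have fpm s : f s = 1 \/ f s = -1.
  by have /eqP := f2 s; rewrite sqrf_eq1 => /orP[/eqP|/eqP]; [left|right].
case: (fpm 1) => // fN.
have [|||c _ c0] := @IVT R (fun s => Re (f s)) 0 1 0; rewrite ?ler01//.
- exact: continuous_subspaceT.
- by rewrite f0 fN /= ge_min le_max oppr_le0 ler01 orbT.
by case: (fpm c) => fc; move: c0; rewrite fc /= => /eqP; rewrite ?oppr_eq0 oner_eq0.
Qed.

End Branch.

(** * Kronecker products acting on vectorised matrices *)

Section Kronecker.
Variable F : fieldType.

Lemma mul_lin1 p q (f : 'rV[F]_p -> 'rV[F]_q) (lf : linear f) v :
  v *m lin1_mx f = f v.
Proof.
pose Hf := GRing.isLinear.Build F 'rV[F]_p 'rV[F]_q _ f lf.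
pose fL : {linear 'rV[F]_p -> 'rV[F]_q} := HB.pack f Hf.
exact: (mul_rV_lin1 fL v).
Qed.

(** Sizes such as (1 + m) n and n + m n are equal but not convertible, so the two determinants are
    compared through an intertwining isomorphism. *)
Lemma det_intertwine p q (X : 'M[F]_p) (Y : 'M[F]_q) (B : 'M[F]_(p, q)) (B' : 'M[F]_(q, p)) :
  p = q -> B *m B' = 1%:M -> X *m B = B *m Y -> \det X = \det Y.
Proof.
move=> pq; case: q / pq Y B B' => Y B B' BB XB.
have b0 : \det B != 0.
  by apply/eqP => b0; have /eqP := congr1 determinant BB; rewrite det_mulmx b0 mul0r det1 eq_sym oner_eq0.
apply: (mulIf b0); have := congr1 determinant XB.
by rewrite !det_mulmx [\det B * _]mulrC.
Qed.

(** The operator U |-> A U Z on vectorised matrices. Acting on row vectors, it has the matrix A^T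
    (x) Z. *)
Definition kron m n (A : 'M[F]_m) (Z : 'M[F]_n) : 'M[F]_(m * n) :=
  lin_mx (mulmx A \o mulmxr Z).

Lemma mul_kron m n (A : 'M[F]_m) (Z : 'M[F]_n) (U : 'M[F]_(m, n)) :
  mxvec U *m kron A Z = mxvec (A *m (U *m Z)).
Proof. exact: mul_vec_lin. Qed.

Lemma eq_mulmxvec m n p (X Y : 'M[F]_(m * n, p)) :
  (forall U : 'M[F]_(m, n), mxvec U *m X = mxvec U *m Y) -> X = Y.
Proof.
move=> H; apply/row_matrixP => i; rewrite !rowE -[delta_mx 0 i]vec_mxK.
exact: H.
Qed.

Lemma kronE m n (A : 'M[F]_m) (Z : 'M[F]_n) i j k l :
  kron A Z (mxvec_index i j) (mxvec_index k l) = A k i * Z j l.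
Proof.
have -> : kron A Z (mxvec_index i j) (mxvec_index k l) =
    (delta_mx (0 : 'I_1) (mxvec_index i j) *m kron A Z) 0 (mxvec_index k l).
  by rewrite -rowE [RHS]mxE.
rewrite -mxvec_delta mul_kron mxvecE mxE (bigD1 i)//= big1 => [|x /negbTE xi]; last first.
  rewrite mxE big1 ?mulr0// => y _; by rewrite mxE xi mul0r.
rewrite addr0 mxE (bigD1 j)//= big1 => [|y /negbTE yj]; last by rewrite mxE yj andbF mul0r.
by rewrite mxE !eqxx mul1r addr0.
Qed.

Lemma kronM m n (A A' : 'M[F]_m) (Z Z' : 'M[F]_n) :
  kron A Z *m kron A' Z' = kron (A' *m A) (Z *m Z').
Proof. by apply: eq_mulmxvec => U; rewrite mulmxA !mul_kron !mulmxA. Qed.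

Lemma kron1 m n : kron (1%:M : 'M[F]_m) (1%:M : 'M[F]_n) = 1%:M.
Proof. by apply: eq_mulmxvec => U; rewrite mul_kron mul1mx !mulmx1. Qed.

Lemma dot_mxvec m n (M U : 'M[F]_(m, n)) : dot (mxvec M) (mxvec U) = \tr (U^T *m M).
Proof.
rewrite dotE (reindex _ (curry_mxvec_bij _ _)) /=.
rewrite (eq_bigr (fun p => M p.1 p.2 * U p.1 p.2)); last by move=> [i j] _; rewrite !mxvecE.
rewrite -(pair_bigA _ (fun i j => M i j * U i j)) exchange_big /=.
apply: eq_bigr => j _; rewrite mxE.
by apply: eq_bigr => i _; rewrite mxE mulrC.
Qed.

Lemma quad_kron m n (A : 'M[F]_m) (Z : 'M[F]_n) (U : 'M[F]_(m, n)) :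
  quad (kron A Z) (mxvec U) = \tr (U^T *m A *m U *m Z).
Proof. by rewrite quadE mul_kron dot_mxvec !mulmxA. Qed.

Lemma kron_tr m n (A : 'M[F]_m) (Z : 'M[F]_n) : (kron A Z)^T = kron A^T Z^T.
Proof.
apply/matrixP => x y; case/mxvec_indexP: x => i j; case/mxvec_indexP: y => k l.
by rewrite [LHS]mxE !kronE ![_^T _ _]mxE.
Qed.

Lemma kron_sym m n (A : 'M[F]_m) (Z : 'M[F]_n) : A^T = A -> Z^T = Z ->
  (kron A Z)^T = kron A Z.
Proof. by move=> As Zs; rewrite kron_tr As Zs. Qed.

Lemma kron_linear m n (A : 'M[F]_m) (Z Z' : 'M[F]_n) (a : F) :
  a *: kron A Z + kron A Z' = kron A (a *: Z + Z').
Proof.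
apply/matrixP => x y; case/mxvec_indexP: x => i j; case/mxvec_indexP: y => k l.
by rewrite [LHS]mxE [X in X + _]mxE !kronE ![in RHS]mxE; ring.
Qed.

Lemma kron_segment m n (A : 'M[F]_m) (V : 'M[F]_n) (a b : F) i j :
  kron A (a%:M + b *: V) i j = a * kron A 1%:M i j + b * kron A V i j.
Proof.
case/mxvec_indexP: i => i j'; case/mxvec_indexP: j => k l.
by rewrite !kronE !mxE -mulr_natr; ring.
Qed.

Lemma kron_unit m n (A : 'M[F]_m) (Z : 'M[F]_n) : A \in unitmx -> Z \in unitmx ->
  kron A Z \in unitmx.
Proof.
move=> Au Zu; have H : kron A Z *m kron (invmx A) (invmx Z) = 1%:M.
  by rewrite kronM mulVmx// mulmxV// kron1.
by case: (mulmx1_unit H).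
Qed.

Lemma kron_inv m n (A : 'M[F]_m) (Z : 'M[F]_n) : A \in unitmx -> Z \in unitmx ->
  invmx (kron A Z) = kron (invmx A) (invmx Z).
Proof.
move=> Au Zu; have Ku := kron_unit Au Zu.
rewrite -[RHS](mulKmx Ku) kronM mulVmx// mulmxV// kron1 mulmx1.
by [].
Qed.

(** Splitting off the first row of U turns the operator into a block diagonal one, with blocks Z and
    the same operator for m - 1 rows. *)
Lemma det_kron1Z m n (Z : 'M[F]_n) : \det (kron (1%:M : 'M[F]_m) Z) = \det Z ^+ m.
Proof.
elim: m => [|m IH]; first by rewrite det_mx00.
pose f (v : 'rV[F]_((1 + m) * n)) : 'rV[F]_(n + m * n) :=
  row_mx (usubmx (vec_mx v)) (mxvec (dsubmx (vec_mx v))).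
pose g (w : 'rV[F]_(n + m * n)) : 'rV[F]_((1 + m) * n) :=
  mxvec (col_mx (lsubmx w) (vec_mx (rsubmx w))).
have lf : linear f by move=> a u v; rewrite /f !linearP /= scale_row_mx add_row_mx.
have lg : linear g.
  by move=> a u v; rewrite /g !linearP /= -add_col_mx -scale_col_mx linearP.
rewrite exprS -IH.
have -> : \det Z * \det (kron (1%:M : 'M[F]_m) Z) = \det (block_mx Z 0 0 (kron (1%:M : 'M[F]_m) Z)).
  by rewrite det_ublock.
apply: (@det_intertwine _ _ _ _ (lin1_mx f) (lin1_mx g)).
- by rewrite mulSn.
- apply: (@eq_mulmxvec (1 + m) n) => U; rewrite mulmxA !mul_lin1// mulmx1.
  by rewrite /g /f row_mxKl row_mxKr !mxvecK vsubmxK.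
apply: (@eq_mulmxvec (1 + m) n) => U; rewrite !mulmxA mul_kron mul1mx !mul_lin1//.
rewrite /f !mxvecK mul_row_block !mulmx0 addr0 add0r mul_kron mul1mx.
by rewrite !mul_usub_mx !mul_dsub_mx.
Qed.

Lemma det_kronA1 m n (A : 'M[F]_m) : \det (kron A (1%:M : 'M[F]_n)) = \det A ^+ n.
Proof.
rewrite -(det_tr A) -det_kron1Z.
apply: (@det_intertwine _ _ _ _ (lin_mx trmx) (lin_mx trmx)); first exact: mulnC.
  by apply: eq_mulmxvec => U; rewrite mulmxA !mul_vec_lin /= trmxK mulmx1.
apply: eq_mulmxvec => U.
by rewrite !mulmxA mul_kron !mul_vec_lin /= mulmx1 mul1mx trmx_mul.
Qed.

Lemma det_kron m n (A : 'M[F]_m) (Z : 'M[F]_n) :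
  \det (kron A Z) = \det A ^+ n * \det Z ^+ m.
Proof.
have -> : kron A Z = kron 1%:M Z *m kron A 1%:M by rewrite kronM !mulmx1.
by rewrite det_mulmx det_kron1Z det_kronA1 mulrC.
Qed.

End Kronecker.

(** * Square roots of positive definite matrices *)

Section SquareRoot.
Variable R : realType.
Local Notation C := R[i].

Lemma interpolation (F : fieldType) (xs : seq F) (f : F -> F) :
  exists p : {poly F}, {in xs, forall x, p.[x] = f x}.
Proof.
elim: xs => [|x xs [p Hp]]; first by exists 0.
have [xin|xnin] := boolP (x \in xs).
  by exists p => y; rewrite inE => /orP[/eqP ->|]; exact: Hp.
pose w := \prod_(y <- xs) ('X - y%:P).
have wx : w.[x] != 0.
  by rewrite -[_ == 0]/(root w x) root_prod_XsubC.
exists (p + ((f x - p.[x]) / w.[x]) *: w) => y.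
rewrite inE hornerD hornerZ => /orP[/eqP ->|yin]; first by rewrite divfK// addrC subrK.
have /rootP -> : root w y by rewrite root_prod_XsubC.
by rewrite mulr0 addr0 Hp.
Qed.

Lemma horner_mx_sym (F : fieldType) n (Y : 'M[F]_n.+1) (p : {poly F}) :
  Y^T = Y -> (horner_mx Y p)^T = horner_mx Y p.
Proof.
move=> Ys; elim/poly_ind: p => [|p c IH]; first by rewrite rmorph0 trmx0.
rewrite [in LHS]commr_polyX !rmorphD !rmorphM /= horner_mx_X horner_mx_C linearD /=.
by rewrite tr_scalar_mx -mulmxE trmx_mul Ys IH.
Qed.

Lemma siegel_imag n (Y : 'M[R]_n) : Y^T = Y -> posdefmx Y -> siegel ('i%C *: toCmx Y).
Proof.
move=> Ys Yp; split.
  by apply/matrixP => i j; rewrite !mxE -{1}Ys mxE.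
rewrite (_ : Immx _ = Y)//; apply/matrixP => i j; rewrite !mxE /=; ring.
Qed.

Lemma toCmx_mul p q r (A : 'M[R]_(p, q)) (B : 'M[R]_(q, r)) :
  toCmx (A *m B) = toCmx A *m toCmx B.
Proof. exact: map_mxM. Qed.

Lemma toCmx_inj p q : injective (@toCmx R p q).
Proof.
move=> A B AB; apply/matrixP => i j.
by have := congr1 (fun M : 'M[C]_(p, q) => M i j) AB; rewrite !mxE => -[].
Qed.

Lemma hq_eigenvector n (Z : 'M[C]_n) (v : 'rV[C]_n) (e : C) : Z^T = Z ->
  v *m Z = e *: v -> exists2 N : R, 0 <= N & hq Z v = e * N%:C.
Proof.
move=> Zs vZ; exists (\sum_j (Re (v 0 j) ^+ 2 + Im (v 0 j) ^+ 2)).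
  by apply: sumr_ge0 => j _; rewrite addr_ge0 ?sqr_ge0.
rewrite /hq dot_mulmx// vZ dotZr; congr (_ * _).
rewrite dotE rmorph_sum; apply: eq_bigr => j _; rewrite mxE.
by case: (v 0 j) => a b; apply: eqC => /=; ring.
Qed.

Lemma Re_mulr_real (z : C) (N : R) : Re (z * N%:C) = Re z * N.
Proof. by case: z => a b /=; ring. Qed.

Lemma Im_mulr_real (z : C) (N : R) : Im (z * N%:C) = Im z * N.
Proof. by case: z => a b /=; ring. Qed.

(** A real polynomial in Y is real and symmetric. One that interpolates the fourth root on the
    spectrum gives T with T^4 = Y, and then S = T^2 = T^T T is positive definite. *)
Lemma sqrtmx_exists n (Y : 'M[R]_n) : Y^T = Y -> posdefmx Y ->
  exists S : 'M[R]_n, [/\ S^T = S, posdefmx S & S *m S = Y].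
Proof.
case: n Y => [|n] Y Ys Yp.
  by exists Y; split=> //; apply/matrixP => -[].
set Yc := toCmx Y.
have Ycs : Yc^T = Yc by apply/matrixP => i j; rewrite !mxE -{1}Ys mxE.
have Yn : Yc \is normalmx.
  have YcJ : map_mx Num.conj Yc^T = Yc.
    rewrite Ycs; apply/matrixP => i j; rewrite !mxE conj_Creal//.
    by rewrite complex_real.
  by apply/normalmxP; rewrite YcJ.
have := orthomx_spectralP Yn; have := spectral_unit Yc.
move: (spectralmx Yc) (spectral_diag Yc) => Q d Qu YE.
have rowQ i : row i Q *m Yc = d 0 i *: row i Q.
  rewrite -row_mul {1}YE !mulmxA mulmxV// mul1mx.
  by apply/rowP => j; rewrite !mxE (bigD1 i)//= big1 => [|k /negbTE ki]; rewrite !mxE ?eqxx ?mulr1n ?addr0// eq_sym ki mul0r.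
have row0 i : row i Q != 0.
  apply/eqP => H; have : (delta_mx 0 i : 'rV[C]_n.+1) = 0.
    by rewrite -[LHS]mulmx1 -(mulmxV Qu) mulmxA -rowE H mul0mx.
  move/rowP/(_ i); rewrite !mxE !eqxx; apply/eqP; exact: oner_neq0.
(* The Hermitian form of the real matrix Y is real, so the eigenvalue is real; positivity comes from
   i Y lying in the Siegel space. *)
have dpos i : exists2 e : R, 0 < e & d 0 i = e%:C.
  set v := row i Q in rowQ row0 *; have [N N0 hqE] := hq_eigenvector Ycs (rowQ i).
  have hqI : hq ('i%C *: Yc) v = 'i%C * hq Yc v.
    by rewrite /hq -scalemxAr dotZl.
  have I0 : Im (hq Yc v) = 0.
    rewrite Im_hq// (_ : Immx Yc = 0).
      by rewrite !quadE !mulmx0 !dotE !big1 ?addr0// => j _; rewrite mxE mul0r.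
    by apply/matrixP => j k; rewrite !mxE.
  have := siegel_hq (siegel_imag Ys Yp) (row0 i); rewrite hqI.
  have Ii (z : C) : Im ('i%C * z) = Re z by case: z => a b /=; ring.
  move: I0; rewrite Ii hqE Re_mulr_real Im_mulr_real; case: (d 0 i) => e f /= fN eN.
  have N1 : 0 < N by rewrite lt_neqAle N0 andbT; apply: contraTneq eN => <-; rewrite mulr0 ltxx.
  exists e; first by rewrite -(pmulr_lgt0 _ N1).
  by move/eqP : fN; rewrite mulf_eq0 (gt_eqF N1) orbF => /eqP ->.
pose xs := [seq Re (d 0 i) | i : 'I_n.+1].
have [p Hp] := interpolation xs (fun x => Num.sqrt (Num.sqrt x)).
pose T : 'M[R]_n.+1 := horner_mx Y p.
have Ts : T^T = T by exact: horner_mx_sym.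
have T4 : T *m T *m (T *m T) = Y.
  have -> : T *m T *m (T *m T) = horner_mx Y (p * p * (p * p)) by rewrite !rmorphM.
  apply: toCmx_inj; set P := p * p * (p * p).
  have -> : toCmx (horner_mx Y P) = horner_mx Yc (map_poly (real_complex R) P).
    exact: map_horner_mx.
  rewrite -/Yc {1}YE horner_mx_uconjC// horner_mx_diag [RHS]YE.
  congr (_ *m diag_mx _ *m _); apply/rowP => i; have [e e0 dE] := dpos i.
  rewrite !mxE dE horner_map; congr (_%:C).
  rewrite /P !hornerM Hp; last by apply/mapP; exists i; rewrite ?mem_enum// dE.
  by rewrite -!expr2 !sqr_sqrtr ?sqrtr_ge0 ?(ltW e0).
have Yu : Y \in unitmx by rewrite unitmxE unitfE gt_eqF// posdef_det_gt0.
have Tu : T \in unitmx.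
  by move: Yu; rewrite -T4 !unitmx_mul => /andP[/andP[]].
exists (T *m T); split=> //; first by rewrite trmx_mul Ts.
apply/posdef_quad => v v0.
rewrite /quad mulmxA -mulmxA -{2}Ts -trmx_mul -/(dot _ _); apply: dot_gt0.
by apply: contraNneq v0 => H; rewrite -(mulmxK Tu v) H mul0mx.
Qed.

Lemma sqrtmx_spec n (Y : 'M[R]_n) : Y^T = Y -> posdefmx Y ->
  [/\ (sqrtmx Y)^T = sqrtmx Y, posdefmx (sqrtmx Y) & sqrtmx Y *m sqrtmx Y = Y].
Proof.
move=> Ys Yp; have [S HS] := sqrtmx_exists Ys Yp.
apply: (@xgetPex _ 0 [set S : 'M[R]_n | [/\ S^T = S, posdefmx S & S *m S = Y]]).
by exists S.
Qed.

End SquareRoot.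

(** * Pivots against eigenvalues for Kronecker products *)

Section KappaKronecker.
Variable R : realType.
Local Notation C := R[i].

Lemma tr_quad m n (A : 'M[R]_m) (V : 'M[R]_(m, n)) :
  \tr (V^T *m A *m V) = \sum_j quad A (row j V^T).
Proof.
apply: eq_bigr => j _; rewrite /quad -row_mul !mxE.
by apply: eq_bigr => k _; rewrite !mxE.
Qed.

(** Writing Y = S^2 and moving one S across the trace leaves the sum of the values of the form A on
    the columns of U S. *)
Lemma posdef_tr_gt0 m n (A : 'M[R]_m) (Y : 'M[R]_n) (U : 'M[R]_(m, n)) :
  posdefmx A -> Y^T = Y -> posdefmx Y -> U != 0 -> 0 < \tr (U^T *m A *m U *m Y).
Proof.
move=> /posdef_quad Ap Ys Yp U0; have [Ss Sp SS] := sqrtmx_spec Ys Yp.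
set S := sqrtmx Y in Ss Sp SS.
have Su : S \in unitmx by rewrite unitmxE unitfE gt_eqF// posdef_det_gt0.
have -> : \tr (U^T *m A *m U *m Y) = \tr ((U *m S)^T *m A *m (U *m S)).
  by rewrite trmx_mul Ss -SS -!mulmxA [RHS]mxtrace_mulC -!mulmxA.
rewrite tr_quad.
have nn j : 0 <= quad A (row j (U *m S)^T).
  have [->|/Ap/ltW//] := eqVneq (row j (U *m S)^T) 0.
  by rewrite quad0.
have US0 : U *m S != 0.
  by apply: contraNneq U0 => H; rewrite -(mulmxK Su U) H mul0mx.
rewrite lt_neqAle sumr_ge0// andbT eq_sym psumr_eq0//.
apply: contraNN US0 => /allP H; apply/eqP/trmx_inj/row_matrixP => j.
have := H j (mem_index_enum j); rewrite trmx0 row0 => /= H0.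
by apply/eqP; apply: contraLR H0 => /Ap; rewrite lt_neqAle eq_sym => /andP[].
Qed.

Lemma posdef_kron m n (A : 'M[R]_m) (Y : 'M[R]_n) :
  posdefmx A -> Y^T = Y -> posdefmx Y -> posdefmx (kron A Y).
Proof.
move=> Ap Ys Yp; apply/posdef_quad => v; rewrite -[v]vec_mxK quad_kron => v0.
by apply: posdef_tr_gt0 => //; apply: contraNneq v0 => ->; rewrite linear0.
Qed.

Lemma posdef1 n : posdefmx (1%:M : 'M[R]_n).
Proof. by apply/posdef_quad => v v0; rewrite quadE mulmx1 dot_gt0. Qed.

Lemma Im_tr_real n (B : 'M[R]_n) (Z : 'M[C]_n) :
  Im (\tr (toCmx B *m Z)) = \tr (B *m Immx Z).
Proof.
rewrite Im_sum; apply: eq_bigr => i _; rewrite !mxE Im_sum.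
by apply: eq_bigr => j _; rewrite !mxE mulrC Im_mulr_real mulrC.
Qed.

Lemma toCmx_tr p q (A : 'M[R]_(p, q)) : (toCmx A)^T = toCmx A^T.
Proof. by apply/matrixP => i j; rewrite !mxE. Qed.

Lemma toCmx_sym p (A : 'M[R]_p) : A^T = A -> (toCmx A)^T = toCmx A.
Proof. by move=> As; rewrite toCmx_tr As. Qed.

Lemma siegel_kron m n (A : 'M[R]_m) (Z : 'M[C]_n) : A^T = A -> posdefmx A ->
  siegel Z -> siegel (kron (toCmx A) Z).
Proof.
move=> As Ap [Zs Yp]; apply: siegelP; first by apply: kron_sym => //; exact: toCmx_sym.
have Ys := Immx_sym Zs.
move=> v; rewrite -[v]vec_mxK; set U := vec_mx v => v0.
rewrite /toCmx map_mxvec quad_kron -/(toCmx U) toCmx_tr -!toCmx_mul Im_tr_real.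
apply: posdef_tr_gt0 => //; apply: contraNneq v0 => ->.
by rewrite linear0.
Qed.

Lemma size_eigenvalues n (Z : 'M[C]_n) : size (eigenvalues Z) = n.
Proof.
rewrite /eigenvalues; case: closed_field_poly_normal => s /= sE.
by apply: succn_inj; rewrite -(size_char_poly Z) sE (monicP (char_poly_monic Z)) scale1r size_prod_XsubC.
Qed.

Lemma det_pencil n (Z : 'M[C]_n) (x y : C) :
  \det (x%:M + y *: Z) = \prod_(e <- eigenvalues Z) (x + y * e).
Proof.
have sE : char_poly Z = \prod_(e <- eigenvalues Z) ('X - e%:P).
  rewrite /eigenvalues; case: closed_field_poly_normal => s /= {1}->.
  by rewrite (monicP (char_poly_monic Z)) scale1r.
have szE := size_eigenvalues Z.
have detE t : \det (t%:M - Z) = \prod_(e <- eigenvalues Z) (t - e).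
  transitivity (char_poly Z).[t].
    rewrite -horner_evalE -det_map_mx; congr (\det _); apply/matrixP => i j.
    by rewrite !mxE -[RHS]/(horner _ _) hornerD hornerN hornerMn hornerX hornerC.
  by rewrite sE horner_prod; apply: eq_bigr => e _; rewrite !hornerE.
have [->|y0] := eqVneq y 0.
  rewrite scale0r addr0 det_scalar (eq_bigr (fun=> x)) => [|e _]; last by rewrite mul0r addr0.
  by rewrite big_const_seq count_predT szE iter_mulr_1.
have -> : x%:M + y *: Z = (- y) *: ((- (x / y))%:M - Z).
  rewrite scalerBr scale_scalar_mx !scaleNr opprK; congr (_%:M + _).
  by rewrite mulNr mulrN opprK mulrC divfK.
rewrite detZ detE -[in X in X * _]szE.
elim: (eigenvalues Z) => [|e s IH]; first by rewrite !big_nil mulr1.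
by rewrite !big_cons /= exprS mulrACA IH; congr (_ * _); field.
Qed.

(** At an eigenvector the Hermitian form of Z equals the eigenvalue times a nonnegative real
    number. *)
Lemma eigenvalues_upper n (Z : 'M[C]_n) (e : C) : siegel Z -> e \in eigenvalues Z ->
  0 < Im e.
Proof.
move=> ZS eZ; have [Zs _] := ZS.
have : eigenvalue Z e.
  rewrite eigenvalue_root_char.
  move: eZ; rewrite /eigenvalues; case: closed_field_poly_normal => s /= sE es.
  by rewrite sE (monicP (char_poly_monic Z)) scale1r root_prod_XsubC.
move=> /eigenvalueP [v vZ v0]; have [N N0 hE] := hq_eigenvector Zs vZ.
have := siegel_hq ZS v0; rewrite hE Im_mulr_real => H.
have N1 : 0 < N by rewrite lt_neqAle N0 andbT; apply: contraTneq H => <-; rewrite mulr0 ltxx.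
by rewrite -(pmulr_lgt0 _ N1).
Qed.

Lemma ImD (z w : C) : Im (z + w) = Im z + Im w.
Proof. by case: z w => ? ? [? ?]. Qed.

Lemma Im_Ninv (z : C) : 0 < Im z -> 0 < Im (- z^-1).
Proof.
move=> I0; have s0 := sum_sqr_gt0 (Im_gt0_neq0 I0).
by case: z I0 s0 => a b /= b0 s0; rewrite opprK divr_gt0.
Qed.

Lemma hlog_i : hlog ('i%C : C) = 0.
Proof.
have := @hlog_imag R 1 ltr01; rewrite rmorph1 mulr1 => ->.
by rewrite ln1 mul0r oppr0.
Qed.

Lemma quadDm (F : fieldType) n (W W' : 'M[F]_n) v : quad (W + W') v = quad W v + quad W' v.
Proof. by rewrite /quad mulmxDr mulmxDl mxE. Qed.

Lemma quadZm (F : fieldType) n (W : 'M[F]_n) a v : quad (a *: W) v = a * quad W v.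
Proof. by rewrite /quad -scalemxAr -scalemxAl mxE. Qed.

Lemma quad_scalar (F : fieldType) n (a : F) v : quad (a%:M : 'M[F]_n) v = a * dot v v.
Proof. by rewrite quadE mul_mx_scalar dotZl. Qed.

Lemma siegel_segment n (Z : 'M[C]_n) (x y : R) : siegel Z -> 0 <= x -> 0 <= y ->
  0 < x + y -> siegel ((x%:C * 'i%C)%:M + y%:C *: Z).
Proof.
move=> ZS x0 y0 xy; have [Zs _] := ZS; apply: siegelP.
  by rewrite linearD linearZ /= tr_scalar_mx Zs.
move=> v v0; rewrite quadDm quadZm quad_scalar.
rewrite ImD [y%:C * _]mulrC Im_mulr_real.
have v1 : 0 < Im (quad Z (toCmx v)).
  by rewrite Im_quad//; case: ZS => _ /posdef_quad; apply.
have dE : dot (toCmx v) (toCmx v) = (dot v v)%:C.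
  by rewrite !dotE rmorph_sum; apply: eq_bigr => j _; rewrite !mxE rmorphM.
rewrite dE Im_mulr_real.
have -> : Im (x%:C * 'i%C) = x by rewrite /=; ring.
have v2 := dot_gt0 v0.
have [x1|] := ltP 0 x; first by rewrite ltr_wpDr ?mulr_ge0 ?mulr_gt0// ltW.
move=> x2; have y1 : 0 < y by lra.
by rewrite ltr_wpDl ?mulr_ge0 ?mulr_gt0// ltW.
Qed.

Variables (m n : nat) (A : 'M[R]_m) (Z : 'M[C]_n).
Hypotheses (As : A^T = A) (Ap : posdefmx A) (ZS : siegel Z).

(** The path from i to -Z^-1 has the weights (1 - s)^2 and s^2, which are nonnegative for every real
    s: the path stays in the Siegel space on the whole line, where [cc] is stated. *)
Let x (s : R) : C := (((1 - s) * (1 - s))%:C * 'i%C).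
Let y (s : R) : C := (s * s)%:C.
Let Z1 s : 'M[C]_n := (x s)%:M + y s *: (- invmx Z).
Let mu (e : C) s : C := x s + y s * (- e^-1).

Let Z1S s : siegel (Z1 s).
Proof.
have h1 : 0 <= (1 - s) * (1 - s) by rewrite -expr2 sqr_ge0.
have h2 : 0 <= s * s by rewrite -expr2 sqr_ge0.
apply: siegel_segment => //; first exact: siegel_Ninv.
(* The weights do not vanish together: (1 - s)^2 + s^2 = 2 (s - 1/2)^2 + 1/2. *)
by have := sqr_ge0 (s - 1 / 2); rewrite expr2; lra.
Qed.

Let mu_upper e s : 0 < Im e -> 0 < Im (mu e s).
Proof.
move=> e0; rewrite /mu /x /y ImD ![_%:C * _]mulrC !Im_mulr_real /= mul1r.
have := Im_Ninv e0; set t := Im _ => t0.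
have h1 : 0 <= (1 - s) * (1 - s) by rewrite -expr2 sqr_ge0.
have h2 : 0 <= s * s by rewrite -expr2 sqr_ge0.
have [->|s0] := eqVneq s 0; first by rewrite subr0 !mulr0 addr0 mulr1.
by rewrite ltr_wpDl// mulr_gt0// -expr2 exprn_even_gt0.
Qed.

Let prod_mu s : \det (Z1 s) = \prod_(e <- eigenvalues Z) mu e s.
Proof.
have Zu := siegel_unit ZS.
have dZ : \det Z != 0 by rewrite -unitfE -unitmxE.
apply: (mulIf dZ); rewrite -det_mulmx mulmxDl -scalemxAl mulNmx mulVmx// mul_scalar_mx.
rewrite scalerN -scaleNr scalemx1 addrC det_pencil -prod_eigenvalues -big_split /=.
apply: eq_big_seq => e /(eigenvalues_upper ZS)/Im_gt0_neq0 e0.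
by rewrite /mu; field.
Qed.

Let dA : R := \det A `^ (- (n%:R / 2)).
(** The candidate for kappa along the path, built from principal roots at the eigenvalues mu of [Z1]
    s. *)
Let phi s : C := dA%:C * \prod_(e <- eigenvalues Z) cexp (hlog (mu e s)) ^+ m.

Let detA0 : 0 < \det A. Proof. exact: posdef_det_gt0. Qed.

Let dA_gt0 : 0 < dA. Proof. exact: powR_gt0. Qed.

Let dA_sqr : dA ^+ 2 * \det A ^+ n = 1.
Proof.
rewrite /dA powRN exprVn -powR_mulrn ?powR_ge0// -powRrM divfK ?pnatr_eq0//.
by rewrite powR_mulrn ?ltW// mulVf// expf_neq0// gt_eqF.
Qed.

Let det_toCmx : \det (toCmx A) = (\det A)%:C.
Proof. by rewrite det_map_mx. Qed.

Let phi_sqr s : phi s ^+ 2 * \det (kron (toCmx A) (Z1 s)) = 'i%R ^+ (m * n).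
Proof.
rewrite det_kron det_toCmx prod_mu /phi exprMn mulrACA -rmorphXn -rmorphXn -rmorphM dA_sqr.
rewrite rmorph1 mul1r -!prodrXl -big_split /=.
rewrite (eq_big_seq (fun=> 'i%R ^+ m)) => [|e /(eigenvalues_upper ZS) e0]; last first.
  have m0 := Im_gt0_neq0 (mu_upper s e0).
  by rewrite -exprM mulnC exprM -exprMn cexp_hlog_sqr// divfK.
by rewrite big_const_seq count_predT size_eigenvalues iter_mulr_1 -exprM.
Qed.

Let KS s : siegel (kron (toCmx A) (Z1 s)). Proof. exact: siegel_kron. Qed.

Let cc_x : cc x.
Proof.
apply: ccM; last exact: cc_cst.
have h : cc (fun s : R => (1 - s)%:C).
  apply: cc_re_im; last by move=> t; exact: cvg_cst.
  by apply: contD; [move=> t; exact: cvg_cst | apply: contN => t; exact: cvg_id].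
by apply: cc_ext (ccM h h) => s; rewrite [RHS]rmorphM.
Qed.

Let cc_y : cc y.
Proof.
have h : cc (fun s : R => s%:C).
  by apply: cc_re_im; [move=> t; exact: cvg_id | move=> t; exact: cvg_cst].
by apply: cc_ext (ccM h h) => s; rewrite /y rmorphM.
Qed.

Let cc_phi : cc phi.
Proof.
apply: ccM; first exact: cc_cst.
apply: cc_prod => e /(eigenvalues_upper ZS) e0; apply: ccX; apply: cc_cexp.
apply: cc_hlog => [s|]; first exact: mu_upper.
by apply: ccD => //; apply: ccM => //; exact: cc_cst.
Qed.

Lemma toCmx_kron (B : 'M[R]_m) (Y : 'M[R]_n) : toCmx (kron B Y) = kron (toCmx B) (toCmx Y).
Proof. by apply: map_lin_mx => U /=; rewrite !map_mxM. Qed.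

(** The quotient of kappa by phi is continuous with square 1. At s = 0 both are positive reals, so
    the quotient is 1 there and hence also at s = 1. *)
Lemma kappa_kron_hlog : kappa (kron (toCmx A) (- invmx Z)) =
  dA%:C * \prod_(e <- eigenvalues Z) cexp (hlog (- e^-1)) ^+ m.
Proof.
have K0 s : kappa (kron (toCmx A) (Z1 s)) ^+ 2 = phi s ^+ 2.
  have dn : \det (kron (toCmx A) (Z1 s)) != 0.
    by rewrite -unitfE -unitmxE; exact: siegel_unit.
  by apply: (mulIf dn); rewrite phi_sqr kappa_sqr.
have i0 : 'i%R ^+ (m * n) != 0 :> C by rewrite expf_neq0 ?neq0Ci.
have phi0 s : phi s != 0.
  by apply: contraNneq i0 => H; rewrite -(phi_sqr s) H expr0n mul0r.
pose f s := kappa (kron (toCmx A) (Z1 s)) / phi s.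
have f1 : f 1 = 1.
  apply: cc_sign.
  - apply: ccM; last exact: ccV.
    apply: cc_kappa => // i j.
    have -> : (fun s => kron (toCmx A) (Z1 s) i j) =
        (fun s => x s * kron (toCmx A) 1%:M i j + y s * kron (toCmx A) (- invmx Z) i j).
      by apply/funext => s; exact: kron_segment.
    by apply: ccD; apply: ccM; [exact: cc_x|exact: cc_cst|exact: cc_y|exact: cc_cst].
  - by move=> s; rewrite /f exprMn exprVn K0 divff// expf_neq0.
  have [r r0 rE] := kappa_imag (kron_sym As (@trmx1 _ n)) (posdef_kron Ap (@trmx1 _ n) (@posdef1 n)).
  have x0 : x 0 = 'i%C by rewrite /x subr0 mulr1 mul1r.
  have y0 : y 0 = 0 by rewrite /y mulr0.
  have phi0E : phi 0 = dA%:C.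
    rewrite /phi big1_seq ?mulr1// => e _.
    by rewrite /mu x0 y0 mul0r addr0 hlog_i cexp0 expr1n.
  have kE : kron (toCmx A) (Z1 0) = 'i%C *: toCmx (kron A 1%:M).
    apply/matrixP => i j; rewrite kron_segment x0 y0 mul0r addr0 toCmx_kron.
    by rewrite /toCmx map_mx1 [RHS]mxE.
  have K00 := K0 0; rewrite /f kE rE phi0E in K00 *.
  suff -> : r = dA by rewrite divff// fmorph_eq0 gt_eqF.
  apply/eqP; rewrite -(@eqrXn2 _ 2) ?ltW//; apply/eqP/complexI.
  by rewrite !rmorphXn.
have <- : Z1 1 = - invmx Z.
  by rewrite /Z1 /x /y subrr mul0r mul0r mulr1 scale1r raddf0 add0r.
have := f1; rewrite /f => H; have := congr1 ( *%R^~ (phi 1)) H.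
rewrite /= divfK// mul1r => ->; congr (_ * _); apply: eq_bigr => e _.
by rewrite /mu /x /y subrr mul0r mul0r mulr1 mul1r add0r.
Qed.

End KappaKronecker.

(** * Translation into principal powers *)

Section PrincipalPowers.
Variable R : realType.
Local Notation C := R[i].

(** In the upper half-plane arg(-1/z) = pi - arg z again lies between 0 and pi, so no multiple of 2
    pi i appears. *)
Lemma clog_Ninv (z : C) : 0 < Im z ->
  clog (- z^-1) = 'i%C * pi%:C - clog z.
Proof.
move=> I0; have I1 := Im_Ninv I0; have z0 := Im_gt0_neq0 I0; have r0 := cmod_gt0 z0.
have cE (w : C) : cmod w = normc w by case: w.
have rE : cmod (- z^-1) = (cmod z)^-1 by rewrite !cE normcN normcV.
have s2 : cmod z ^+ 2 = Re z ^+ 2 + Im z ^+ 2.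
  by rewrite sqr_sqrtr// addr_ge0 ?sqr_ge0.
have ReE : Re (- z^-1) = - (Re z / cmod z ^+ 2).
  by rewrite s2; case: z {I0 I1 z0 r0 rE s2} => a b.
have /andP[l u] := Re_cmod_lt I0.
rewrite /clog !carg_upper// rE lnV ?posrE// invrK ReE.
have -> : - (Re z / cmod z ^+ 2) * cmod z = - (Re z / cmod z).
  by field; rewrite gt_eqF.
rewrite acosN; last by rewrite (ltW l) (ltW u).
by apply: eqC => /=; ring.
Qed.

Lemma clog_i : clog ('i%C : C) = 'i%C * (pi / 2)%:C.
Proof.
have := @hlog_i R; rewrite /hlog => /eqP; rewrite mulf_eq0 invr_eq0 pnatr_eq0 orbF.
by rewrite subr_eq0 => /eqP.
Qed.

Lemma cexp_hlog_Ninv (z : C) (m : nat) : 0 < Im z ->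
  cexp (hlog (- z^-1)) ^+ m = cpow 'i%C (- (m%:R / 2)) * cpow z (m%:R / 2).
Proof.
move=> I0; rewrite -cexpMn /hlog clog_Ninv// /cpow clog_i -cexpD; congr cexp.
rewrite -[LHS]mulr_natr; have -> : (pi / 2)%:C = pi%:C / 2 :> C.
  by rewrite rmorphM fmorphV rmorph_nat.
by field.
Qed.

Lemma eigenvalues_neq0 n (Z : 'M[C]_n) : siegel Z -> \det Z != 0.
Proof. by move=> ZS; rewrite -unitfE -unitmxE; exact: siegel_unit. Qed.

Lemma det_cpowD n (Z : 'M[C]_n) (k : C) (alpha : nat) : siegel Z ->
  det_cpow Z (k + alpha%:R) = det_cpow Z k * \det Z ^+ alpha.
Proof.
move=> ZS; rewrite -(det_cpow_nat _ (eigenvalues_neq0 ZS)) /det_cpow -big_split /=.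
by apply: eq_bigr => e _; rewrite /cpow mulrDl cexpD.
Qed.

Lemma kappa_kron m n (A : 'M[R]_m) (Z : 'M[C]_n) : A^T = A -> posdefmx A -> siegel Z ->
  kappa (kron (toCmx A) (- invmx Z)) =
  cpow 'i%C (- ((m * n)%:R / 2)) * (\det A `^ (- (n%:R / 2)))%:C * det_cpow Z (m%:R / 2).
Proof.
move=> As Ap ZS; rewrite kappa_kron_hlog// [_ * (_ `^ _)%:C]mulrC -mulrA; congr (_ * _).
rewrite (eq_big_seq (fun e => cpow 'i%C (- (m%:R / 2)) * cpow e (m%:R / 2))); last first.
  by move=> e /(eigenvalues_upper ZS) e0; rewrite cexp_hlog_Ninv.
rewrite big_split /=; congr (_ * _).
rewrite big_const_seq count_predT size_eigenvalues iter_mulr_1 /cpow -cexpMn.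
by congr cexp; rewrite -mulr_natr natrM; ring.
Qed.

End PrincipalPowers.

(** * Heat operators on polynomials *)

Section PolynomialOperators.
Variables (R : realType) (d : nat).
Local Notation C := R[i].
Local Notation MP := (mpoly.mpoly d C).
Implicit Types (P Q : MP) (T : 'M[C]_d) (v w : 'rV[C]_d).

Definition mX (j : 'I_d) : MP := mpoly.mpolyX C (mpoly.mnm1 j).
Definition ev P v : C := mpoly.meval (fun j => v 0 j) P.
Local Notation D := mpoly.mderiv.

(** The induction suited to operators on polynomials: identities linear in P only have to survive
    multiplication by a variable. *)
Lemma mpoly_linear_ind (S : MP -> Prop) :
  S 1 -> (forall c P Q, S P -> S Q -> S (c *: P + Q)) ->
  (forall j P, S P -> S (mX j * P)) -> forall P, S P.
Proof.
move=> S1 SL SX.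
have S0 : S 0 by have := SL (-1) 1 1 S1 S1; rewrite scaleN1r addNr.
have SXn j k P : S P -> S (mX j ^+ k * P).
  by move=> SP; elim: k => [|k IH]; rewrite ?mul1r// exprS -mulrA; exact: SX.
elim/mpoly.mpolyind => // c m P _ _ SP; apply: SL => //.
rewrite mpoly.mpolyXE_id.
elim: (index_enum _) => [|j r IH]; first by rewrite big_nil.
by rewrite big_cons; exact: SXn.
Qed.

Lemma D_X i j P : D i (mX j * P) = (i == j)%:R *: P + mX j * D i P.
Proof.
rewrite mpoly.mderivM; congr (_ + _).
rewrite /mX mpoly.mderivX mpoly.mnm1E eq_sym.
case: eqP => [->|_]; last by rewrite !scale0r mul0r.
rewrite !scale1r -[RHS]mul1r; congr (_ * _); rewrite -mpoly.mpolyX0; congr mpoly.mpolyX.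
by apply/mpoly.mnmP => k; rewrite mpoly.mnmBE subnn mpoly.mnm0E.
Qed.

Lemma D_sum I (r : seq I) (F : I -> MP) i : D i (\sum_(k <- r) F k) = \sum_(k <- r) D i (F k).
Proof. exact: linear_sum. Qed.

Lemma msize_D i P : (mpoly.msize (D i P) <= (mpoly.msize P).-1)%N.
Proof.
rewrite [leqLHS]mpoly.msizeE; apply/bigmax_leqP_seq => m mP _.
rewrite -ltnS; have [P0|P0] := posnP (mpoly.msize P).
  by move: mP; move/eqP: P0; rewrite mpoly.msize_poly_eq0 => /eqP ->; rewrite mpoly.mderiv0 mpoly.msupp0.
rewrite prednK//; have : mpoly.mnm_add m (mpoly.mnm1 i) \in mpoly.msupp P.
  move: mP; rewrite !mpoly.mcoeff_msupp mpoly.mcoeff_deriv.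
  by apply: contraNN => /eqP ->; rewrite mul0rn.
by move/mpoly.msize_mdeg_lt; rewrite mpoly.mdegD mpoly.mdeg1 addn1.
Qed.

Definition lap T P : MP := \sum_i \sum_j T i j *: D i (D j P).
Definition grad T j P : MP := \sum_i T j i *: D i P.

Lemma lap_is_linear T : linear (lap T).
Proof.
move=> c P Q; rewrite /lap scaler_sumr -big_split; apply: eq_bigr => i _ /=.
rewrite scaler_sumr -big_split; apply: eq_bigr => j _ /=.
by rewrite !linearP.
Qed.
HB.instance Definition _ T := GRing.isLinear.Build C MP MP _ (lap T) (lap_is_linear T).

Lemma grad_is_linear T j : linear (grad T j).
Proof.
move=> c P Q; rewrite /grad scaler_sumr -big_split; apply: eq_bigr => i _ /=.
by rewrite !linearP.
Qed.
HB.instance Definition _ T j := GRing.isLinear.Build C MP MP _ (grad T j) (grad_is_linear T j).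

Lemma D_lap T i P : D i (lap T P) = lap T (D i P).
Proof.
rewrite /lap D_sum; apply: eq_bigr => k _; rewrite D_sum; apply: eq_bigr => l _.
by rewrite linearZ /= (mpoly.mderiv_comm k i) (mpoly.mderiv_comm l i).
Qed.

Lemma iter_lap_linear T k : linear (iter k (lap T)).
Proof. by elim: k => [|k IH] c P Q //=; rewrite IH linearP. Qed.
HB.instance Definition _ T k :=
  GRing.isLinear.Build C MP MP _ (iter k (lap T)) (iter_lap_linear T k).

Lemma D_iter_lap T i k P : D i (iter k (lap T) P) = iter k (lap T) (D i P).
Proof. by elim: k => //= k IH; rewrite D_lap IH. Qed.

Lemma grad_iter_lap T S j k P : grad T j (iter k (lap S) P) = iter k (lap S) (grad T j P).
Proof.
rewrite /grad linear_sum; apply: eq_bigr => i _.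
by rewrite D_iter_lap linearZ.
Qed.

Lemma lap_X T j P : T^T = T -> lap T (mX j * P) = mX j * lap T P + 2 *: grad T j P.
Proof.
move=> Ts.
have E : lap T (mX j * P) = \sum_i \sum_k (T i k *: (mX j * D i (D k P)) +
    ((k == j)%:R * T i k) *: D i P + ((i == j)%:R * T i k) *: D k P).
  rewrite /lap; apply: eq_bigr => i _; apply: eq_bigr => k _.
  rewrite D_X linearD linearZ /= D_X !scalerDr !scalerA.
  rewrite addrA addrC addrA [(k == j)%:R * _]mulrC [(i == j)%:R * _]mulrC.
  by [].
rewrite E; under eq_bigr => i _ do rewrite !big_split /=.
rewrite !big_split /= -addrA; congr (_ + _).
  rewrite /lap mulr_sumr; apply: eq_bigr => i _; rewrite mulr_sumr.
  by apply: eq_bigr => k _; rewrite scalerAr.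
have -> : \sum_i \sum_k ((k == j)%:R * T i k) *: D i P = grad T j P.
  apply: eq_bigr => i _; rewrite (bigD1 j)//= big1 => [|k /negbTE kj]; last first.
    by rewrite kj mul0r scale0r.
  by rewrite eqxx mul1r addr0 -{1}Ts mxE.
have -> : \sum_i \sum_k ((i == j)%:R * T i k) *: D k P = grad T j P.
  rewrite (bigD1 j)//= [X in _ + X]big1 => [|i /negbTE ij]; last first.
    by rewrite big1// => k _; rewrite ij mul0r scale0r.
  by rewrite addr0; apply: eq_bigr => k _; rewrite eqxx mul1r.
by rewrite scaler_nat mulr2n.
Qed.

Lemma iter_lap_X T j k P : T^T = T ->
  iter k.+1 (lap T) (mX j * P) =
  mX j * iter k.+1 (lap T) P + (2 * k.+1%:R) *: iter k (lap T) (grad T j P).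
Proof.
move=> Ts; elim: k => [|k IH]; first by rewrite /= lap_X// mulr1.
rewrite iterS IH linearD linearZ /= lap_X// -addrA; congr (_ + _).
rewrite -[lap T (iter k _ _)]iterS grad_iter_lap -scalerDl.
by congr (_ *: _); rewrite -[in RHS]natr1; ring.
Qed.

Definition exps T K P : MP := \sum_(k < K) (k`!%:R)^-1 *: iter k (lap T) P.
Definition expL T P := exps T (mpoly.msize P) P.

Lemma msize_lap T P : (mpoly.msize (lap T P) <= (mpoly.msize P).-1)%N.
Proof.
rewrite /lap; elim/big_ind: _ => [|p q pk qk|i _].
- by rewrite mpoly.msize0.
- by apply: leq_trans (mpoly.msizeD_le _ _) _; rewrite geq_max pk.
elim/big_ind: _ => [|p q pk qk|j _].
- by rewrite mpoly.msize0.
- by apply: leq_trans (mpoly.msizeD_le _ _) _; rewrite geq_max pk.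
apply: leq_trans (mpoly.msizeZ_le _ _) _; apply: leq_trans (msize_D _ _) _.
by apply: leq_trans (leq_pred _) (msize_D _ _).
Qed.

Lemma iter_lap_eq0 T k P : (mpoly.msize P <= k)%N -> iter k (lap T) P = 0.
Proof.
move=> Pk; apply/eqP; rewrite -mpoly.msize_poly_eq0 -leqn0.
have : (mpoly.msize (iter k (lap T) P) <= mpoly.msize P - k)%N.
  elim: k {Pk} => [|k IH]; first by rewrite subn0.
  apply: leq_trans (msize_lap _ _) _; rewrite subnS.
  by rewrite -!subn1 leq_sub2r.
by move/leq_trans; apply; rewrite leqn0 subn_eq0.
Qed.

(** [expL] cuts the series at a length depending on P; any later cut gives the same value, so
    several polynomials can be compared at a common cut. *)
Lemma exps_expL T K P : (mpoly.msize P <= K)%N -> exps T K P = expL T P.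
Proof.
move=> PK; rewrite /expL /exps -(subnKC PK) big_split_ord /= [X in _ + X]big1 ?addr0//.
by move=> k _; rewrite iter_lap_eq0 ?leq_addr// scaler0.
Qed.

Lemma expL_linear T : linear (expL T).
Proof.
move=> c P Q; set K := maxn (mpoly.msize (c *: P + Q)) (maxn (mpoly.msize P) (mpoly.msize Q)).
rewrite -!(@exps_expL T K) ?leq_max ?leqnn ?orbT//.
rewrite /exps scaler_sumr -big_split; apply: eq_bigr => k _ /=.
by rewrite linearP scalerDr !scalerA mulrC.
Qed.
HB.instance Definition _ T := GRing.isLinear.Build C MP MP _ (expL T) (expL_linear T).

Lemma expL1 T : expL T 1 = 1.
Proof. by rewrite /expL mpoly.msize1 /exps big_ord1 fact0 invr1 scale1r. Qed.

Lemma D_expL T i P : D i (expL T P) = expL T (D i P).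
Proof.
rewrite -(@exps_expL T (mpoly.msize P) (D i P)).
  rewrite /expL /exps D_sum; apply: eq_bigr => k _.
  by rewrite linearZ /= D_iter_lap.
by apply: leq_trans (msize_D _ _) (leq_pred _).
Qed.

(** The commutator of the Laplacian with X_j is twice the j-th gradient, which commutes with the
    Laplacian; exponentiating gives the rule. The factor k + 1 from the commutator lowers (k + 1)!
    to k!. *)
Lemma expL_X T j P : T^T = T ->
  expL T (mX j * P) = mX j * expL T P + 2 *: grad T j (expL T P).
Proof.
move=> Ts; set K := maxn (mpoly.msize (mX j * P)) (mpoly.msize P).
have E1 : expL T (mX j * P) = exps T K.+1 (mX j * P).
  by rewrite exps_expL// leqW// leq_maxl.
have E2 : expL T P = exps T K.+1 P by rewrite exps_expL// leqW// leq_maxr.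
have E3 : expL T P = exps T K P by rewrite exps_expL// leq_maxr.
rewrite E1 {1}E2 E3 /exps big_ord_recl big_ord_recl /=.
rewrite fact0 invr1 !scale1r mulrDr -addrA; congr (_ + _).
rewrite [grad _ _ _]linear_sum mulr_sumr scaler_sumr -big_split; apply: eq_bigr => k _ /=.
rewrite add0n -iterS iter_lap_X// scalerDr -scalerAr [grad _ _ (_ *: _)]linearZ /=.
rewrite grad_iter_lap !scalerA; congr (_ + _ *: _); rewrite /bump /= add1n factS natrM.
have : k`!%:R != 0 :> C by rewrite pnatr_eq0 -lt0n fact_gt0.
have : k.+1%:R != 0 :> C by rewrite pnatr_eq0.
move: (k`!%:R : C) (k.+1%:R : C) => a b a0 b0; field.
by rewrite a0 b0.
Qed.

Lemma grad_expL T S j P : grad T j (expL S P) = expL S (grad T j P).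
Proof.
rewrite /grad linear_sum; apply: eq_bigr => i _.
by rewrite linearZ /= D_expL.
Qed.

Lemma gradD T S j P : grad (T + S) j P = grad T j P + grad S j P.
Proof. by rewrite /grad -big_split; apply: eq_bigr => i _; rewrite mxE scalerDl. Qed.

(** Both sides fix 1 and obey the same rule for multiplication by X_j, since the gradient is
    additive in its matrix. *)
Lemma expL_expL T S P : T^T = T -> S^T = S -> expL T (expL S P) = expL (T + S) P.
Proof.
move=> Ts Ss; have TSs : (T + S)^T = T + S by rewrite linearD /= Ts Ss.
elim/mpoly_linear_ind: P => [|c P Q HP HQ|j P HP]; first by rewrite !expL1.
  by rewrite !linearP /= HP HQ.
rewrite !expL_X// linearD linearZ /= expL_X// -grad_expL HP gradD scalerDr.
by rewrite addrA.
Qed.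

End PolynomialOperators.

Lemma exchange_big4 (V : nmodType) (I : finType) (F : I -> I -> I -> I -> V) :
  \sum_i \sum_j \sum_k \sum_l F i j k l = \sum_l \sum_k \sum_j \sum_i F i j k l.
Proof.
have rev3 (G : I -> I -> I -> V) : \sum_j \sum_k \sum_l G j k l = \sum_l \sum_k \sum_j G j k l.
  rewrite exchange_big [RHS]exchange_big; apply: eq_bigr => k _; exact: exchange_big.
transitivity (\sum_i \sum_l \sum_k \sum_j F i j k l).
  by apply: eq_bigr => i _; exact: rev3.
rewrite exchange_big; apply: eq_bigr => l _; rewrite exchange_big.
by apply: eq_bigr => k _; exact: exchange_big.
Qed.

(** * Evaluation and the chain rule for linear substitutions *)

Section Evaluation.
Variables (R : realType) (d : nat).
Local Notation C := R[i].
Local Notation MP := (mpoly.mpoly d C).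
Local Notation D := mpoly.mderiv.
Implicit Types (P Q : MP) (T : 'M[C]_d) (v w : 'rV[C]_d).

Lemma evD P Q v : ev (P + Q) v = ev P v + ev Q v. Proof. exact: mpoly.mevalD. Qed.
Lemma evM P Q v : ev (P * Q) v = ev P v * ev Q v. Proof. exact: mpoly.mevalM. Qed.
Lemma evZ c P v : ev (c *: P) v = c * ev P v. Proof. exact: mpoly.mevalZ. Qed.
Lemma ev1 v : ev 1 v = 1. Proof. exact: mpoly.meval1. Qed.
Lemma ev_X j v : ev (mX R j) v = v 0 j. Proof. exact: mpoly.mevalXU. Qed.
Lemma ev_sum I (r : seq I) (F : I -> MP) v :
  ev (\sum_(k <- r) F k) v = \sum_(k <- r) ev (F k) v.
Proof. exact: (big_morph _ (fun P Q => evD P Q v) (mpoly.meval0 _)). Qed.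

Lemma eq_poly_horner (p q : {poly C}) : (forall t, p.[t] = q.[t]) -> p = q.
Proof.
move=> pq; apply/eqP; rewrite -subr_eq0; apply/eqP/eqP/negPn/negP => n0.
have := @max_poly_roots _ (p - q) [seq k%:R | k <- iota 0 (size (p - q))] n0.
rewrite size_map size_iota ltnn => H; suff : false by []; apply: H.
  by apply/allP => x /mapP[k _ ->]; rewrite /root hornerD hornerN pq subrr.
by rewrite map_inj_uniq ?iota_uniq// => a b /eqP; rewrite eqr_nat => /eqP.
Qed.

(** Restriction to a line expresses a directional derivative as the formal derivative of a
    polynomial in t. As its values determine that polynomial, identities between values can be
    differentiated. *)
Lemma ev_line P v w : exists2 p : {poly C}, (forall t, p.[t] = ev P (v + t *: w)) &
  p^`().[0] = \sum_k w 0 k * ev (D k P) v.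
Proof.
elim/mpoly_linear_ind: P => [|c P Q [p pE p'] [q qE q']|j P [p pE p']].
- exists 1; first by move=> t; rewrite hornerC ev1.
  rewrite derivC horner0 big1// => k _;
  by rewrite -mpoly.mpolyC1 mpoly.mderivC /ev mpoly.meval0 mulr0.
- exists (c *: p + q); first by move=> t; rewrite hornerD hornerZ pE qE evD evZ.
  rewrite derivD derivZ hornerD hornerZ p' q' mulr_sumr -big_split.
  by apply: eq_bigr => k _; rewrite linearP evD evZ /=; ring.
exists (((v 0 j)%:P + w 0 j *: 'X) * p).
  by move=> t; rewrite hornerM pE evM ev_X hornerD hornerZ hornerX hornerC !mxE [w _ _ * _]mulrC.
have p0 : p.[0] = ev P v by rewrite pE scale0r addr0.
rewrite derivM derivD derivC derivZ derivX add0r hornerD !hornerM p' p0 !hornerE /=.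
rewrite [RHS](eq_bigr (fun k => (k == j)%:R * (w 0 k * ev P v) + v 0 j * (w 0 k * ev (D k P) v))).
  rewrite big_split -mulr_sumr /=; congr (_ + _); rewrite (bigD1 j)//= eqxx mul1r big1 ?addr0//.
  by move=> k /negbTE ->; rewrite mul0r.
by move=> k _; rewrite D_X evD evZ evM ev_X; ring.
Qed.

(** Q is P composed with v |-> v B, expressed as a relation between values. *)
Definition pullback (B : 'M[C]_d) Q P := forall v, ev Q v = ev P (v *m B).

Lemma pullback_D B Q P i : pullback B Q P ->
  pullback B (D i Q) (\sum_k B i k *: D k P).
Proof.
move=> H v; have [p pE p'] := ev_line Q v (delta_mx 0 i).
have [q qE q'] := ev_line P (v *m B) (row i B).
have pq : p = q.
  apply: eq_poly_horner => t.
  by rewrite pE qE H mulmxDl -scalemxAl -rowE.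
transitivity (p^`().[0]).
  rewrite p' (bigD1 i)//= big1 => [|k /negbTE ki]; last by rewrite mxE ki mul0r.
  by rewrite mxE !eqxx mul1r addr0.
rewrite pq q' ev_sum; apply: eq_bigr => k _.
by rewrite evZ mxE.
Qed.

Lemma pullback_sum B I (r : seq I) (c : I -> C) (F G : I -> MP) :
  (forall i, pullback B (F i) (G i)) ->
  pullback B (\sum_(i <- r) c i *: F i) (\sum_(i <- r) c i *: G i).
Proof. by move=> H v; rewrite !ev_sum; apply: eq_bigr => i _; rewrite !evZ H. Qed.

Lemma pullback_lap B S Q P : pullback B Q P ->
  pullback B (lap S Q) (lap (B^T *m S *m B) P).
Proof.
move=> H v; rewrite /lap ev_sum.
have E i j : ev (D i (D j Q)) v = \sum_k \sum_l B j k * B i l * ev (D l (D k P)) (v *m B).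
  rewrite (pullback_D i (pullback_D j H)) ev_sum exchange_big; apply: eq_bigr => l _.
  rewrite evZ D_sum ev_sum mulr_sumr; apply: eq_bigr => k _.
  by rewrite linearZ evZ /=; ring.
under eq_bigr => i _.
  rewrite ev_sum; under eq_bigr => j _ do rewrite evZ E.
  over.
rewrite ev_sum; under [RHS]eq_bigr => l _.
  rewrite ev_sum; under eq_bigr => k _.
    rewrite evZ mxE mulr_suml.
    under eq_bigr => j _ do rewrite mxE !mulr_suml.
    over.
  over.
rewrite /=.
transitivity (\sum_i \sum_j \sum_k \sum_l S i j * (B j k * B i l * ev (D l (D k P)) (v *m B))).
  apply: eq_bigr => i _; apply: eq_bigr => j _; rewrite mulr_sumr.
  by apply: eq_bigr => k _; rewrite mulr_sumr.
rewrite exchange_big4; apply: eq_bigr => l _; apply: eq_bigr => k _; apply: eq_bigr => j _; apply: eq_bigr => i _.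
by rewrite mxE; ring.
Qed.

Lemma pullback_iter_lap B S Q P k : pullback B Q P ->
  pullback B (iter k (lap S) Q) (iter k (lap (B^T *m S *m B)) P).
Proof. by move=> H; elim: k => //= k IH; exact: pullback_lap. Qed.

Lemma pullback_expL B S Q P : pullback B Q P ->
  pullback B (expL S Q) (expL (B^T *m S *m B) P).
Proof.
move=> H; set K := maxn (mpoly.msize Q) (mpoly.msize P).
rewrite -(@exps_expL _ _ S K) ?leq_maxl// -(@exps_expL _ _ _ K) ?leq_maxr//.
by apply: pullback_sum => k; exact: pullback_iter_lap.
Qed.

Lemma iter_lapZ c T k P : iter k (lap (c *: T)) P = c ^+ k *: iter k (lap T) P.
Proof.
elim: k => [|k IH]; first by rewrite scale1r.
rewrite !iterS IH linearZ /= exprSr -scalerA; congr (_ *: _).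
rewrite /lap scaler_sumr; apply: eq_bigr => i _; rewrite scaler_sumr.
by apply: eq_bigr => j _; rewrite mxE scalerA.
Qed.

End Evaluation.

Section TraceLaplacian.
Variables (R : realType) (m n : nat).
Local Notation C := R[i].

(** The transpose offsets the one contained in [kron], so that the coefficient of the pair (mu, nu),
    (rho, nu) is the entry (mu, rho) of A^-1. *)
Lemma tr_laplacian_lap (A : 'M[int]_m) (P : mpoly.mpoly (m * n) C) :
  tr_laplacian A P = lap (kron (invmx (map_mx intr A))^T 1%:M) P.
Proof.
rewrite /tr_laplacian exchange_big /lap (reindex _ (curry_mxvec_bij _ _)) /=.
rewrite pair_big; apply: eq_bigr => -[mu nu] _ /=.
rewrite [RHS](reindex _ (curry_mxvec_bij _ _)) /=.
transitivity (\sum_rho \sum_nu' kron (invmx (map_mx intr A))^T 1%:M (mxvec_index mu nu)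
    (mxvec_index rho nu') *: mpoly.mderiv (mxvec_index mu nu) (mpoly.mderiv (mxvec_index rho nu') P)); last first.
  by rewrite pair_bigA; apply: eq_bigr => -[].
apply: eq_bigr => rho _; rewrite (bigD1 nu)//= big1 => [|l /negbTE ln]; last first.
  by rewrite kronE [1%:M _ _]mxE eq_sym ln mulr0 scale0r.
by rewrite addr0 kronE [1%:M _ _]mxE eqxx mulr1 mxE /dvar linearZ.
Qed.

Lemma exp_tr_laplacian_expL c (A : 'M[int]_m) (P : mpoly.mpoly (m * n) C) :
  exp_tr_laplacian c A P = expL (c *: kron (invmx (map_mx intr A))^T 1%:M) P.
Proof.
apply: eq_bigr => k _; rewrite iter_lapZ scalerA mulrC; congr (_ *: _).
by apply: eq_iter => Q; exact: tr_laplacian_lap.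
Qed.

End TraceLaplacian.

(** * The Jacobi identity with a polynomial factor *)

Section GaussianTaylor.
Variables (R : realType) (d : nat).
Local Notation C := R[i].
Local Notation MP := (mpoly.mpoly d C).
Local Notation D := mpoly.mderiv.
Local Notation pt := (R * 'rV[int]_d)%type.

Let dom (p : pt) : Prop := 0 <= p.1 <= 1.
Let L (p : pt) : R := l1 (map_mx intr p.2).
Let X (p : pt) : R := expR (L p).
Local Notation O := (ord dom fst X (fun=> 1)).

Let h01 p : dom p -> 0 <= p.1 <= 1. Proof. by []. Qed.
Let L0 p : 0 <= L p. Proof. exact: l1_ge0. Qed.
Let X1 p : dom p -> 1 <= X p.
Proof. by move=> _; rewrite /X -expR0 ler_expR L0. Qed.
Let one_ge0 (p : pt) : dom p -> 0 <= 1 :> R. Proof. by rewrite ler01. Qed.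

(** At most linear growth in N, uniformly in t: then both E and exp(E) are bounded by a constant
    times a power of X = exp(l1 N). *)
Let aff (E : pt -> C) : Prop :=
  exists M, 0 <= M /\ forall p, dom p -> normc (E p) <= M * (1 + L p).

Let aff_ord E : aff E -> O 0 E.
Proof.
move=> [M [M0 H]]; exists M, 1%N; split=> // p Dp; apply: le_trans (H p Dp) _.
by rewrite !mulr1 expr1 ler_wpM2l// expR_ge1Dx.
Qed.

Let aff_cexp E : aff E -> O 0 (fun p => cexp (E p)).
Proof.
move=> [M [M0 H]]; exists (expR M), (Num.bound M); split=> [|p Dp]; first exact: expR_ge0.
rewrite normc_cexp !mulr1 /X -expRM_natl -expRD ler_expR.
apply: le_trans (le_trans (ler_norm _) (normc_Re_le _)) _.
apply: le_trans (H p Dp) _; rewrite mulrDr mulr1 lerD2l ler_wpM2r ?L0//.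
by rewrite ltW// archi_boundP.
Qed.

Let affD E F : aff E -> aff F -> aff (fun p => E p + F p).
Proof.
move=> [M [M0 HM]] [N [N0 HN]]; exists (M + N); split=> [|p Dp]; first exact: addr_ge0.
by apply: le_trans (le_normcD _ _) _; rewrite mulrDl lerD ?HM ?HN.
Qed.

Let affM (c : pt -> C) E : (exists M, 0 <= M /\ forall p, dom p -> normc (c p) <= M) ->
  aff E -> aff (fun p => c p * E p).
Proof.
move=> [N [N0 HN]] [M [M0 HM]]; exists (N * M); split=> [|p Dp]; first exact: mulr_ge0.
by rewrite normcM -mulrA; apply: ler_pM; rewrite ?normc_ge0 ?HN ?HM.
Qed.

Let aff_cst c : aff (fun=> c).
Proof.
exists (normc c); split=> [|p _]; first exact: normc_ge0.
by rewrite ler_peMr ?normc_ge0// lerDl L0.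
Qed.

Let aff_sum I (r : seq I) (F : I -> pt -> C) :
  (forall i, aff (F i)) -> aff (fun p => \sum_(i <- r) F i p).
Proof.
move=> H; elim: r => [|i r IH].
  by under eq_fun do rewrite big_nil; exact: aff_cst.
by under eq_fun do rewrite big_cons; exact: affD.
Qed.

Let aff_zC j : aff (fun p => zC R p.2 0 j).
Proof.
exists 1; split=> // p _; rewrite mul1r zCE [toCmx _ _ _]mxE normc_real.
rewrite ler_wpDl// /L /l1 (bigD1 j)//= lerDl.
by apply: sumr_ge0 => i _; exact: normr_ge0.
Qed.

Let bnd_cst (c : C) : exists M, 0 <= M /\ forall p : pt, dom p -> normc c <= M.
Proof. by exists (normc c); split=> //; exact: normc_ge0. Qed.

Let aff_dot u u0 : aff (fun p => dot (zC R p.2) u + u0).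
Proof.
apply: affD; last exact: aff_cst.
under eq_fun do rewrite dotE; apply: aff_sum => j.
by under eq_fun do rewrite mulrC; exact: affM.
Qed.

Let bnd_t : exists M : R, 0 <= M /\ forall p : pt, dom p -> normc (p.1%:C : C) <= M.
Proof. by exists 1; split=> // p /andP[t0 t1]; rewrite normc_real ger0_norm. Qed.

Let Ot : O 1 (fun p => (p.1)%:C). Proof. exact: ord_h. Qed.

Variables (W : 'M[C]_d) (z : 'rV[C]_d) (B : 'M[C]_d) (b w u : 'rV[C]_d) (u0 c : C).
Hypothesis WS : siegel W.
Let y (N : 'rV[int]_d) := zC R N *m B + b.
Let y1 (N : 'rV[int]_d) := dot (zC R N) u + u0.
Let th (N : 'rV[int]_d) := thterm W z (zC R N).
Let G (p : pt) := normc (th p.2).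
Let OG := ord dom fst X G.
Let G0 p : dom p -> 0 <= G p. Proof. by move=> _; exact: normc_ge0. Qed.

(** The theta term decays faster than exp(-(k + 1) l1(N)); k of these factors cancel X^k, and the
    last one leaves a summable family. *)
Lemma bsum_ord j f : OG j f -> exists2 M, 0 <= M & forall t, 0 <= t <= 1 ->
  forall A : {fset 'rV[int]_d}, \sum_(N <- A) normc (f (t, N)) <= M * t ^+ j.
Proof.
move=> [M [k [M0 H]]]; have [M' [M'0 H']] := @thterm_decay _ _ _ z (k.+1)%:R WS (ler0n _ _).
have [S HS] := bsum_l1 R d.
have S0 : 0 <= S by have := HS fset0; rewrite big_seq_fset0.
exists (M * M' * S) => [|t t01 A]; first by rewrite !mulr_ge0.
have /andP[t0 t1] := t01.
rewrite mulrAC; apply: le_trans (ler_wpM2l _ (HS A)); last by rewrite !mulr_ge0 ?exprn_ge0.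
rewrite mulr_sumr; apply: ler_sum => N _; apply: le_trans (H (t, N) t01) _.
have := H' (map_mx intr N); rewrite -zCE -/(th N) => HN.
have X0 : 0 <= X (t, N) ^+ k by rewrite exprn_ge0// expR_ge0.
apply: le_trans (ler_wpM2l _ HN) _; first by rewrite mulr_ge0// mulr_ge0// exprn_ge0.
have -> : expR (- l1 (map_mx intr N)) =
    X (t, N) ^+ k * expR (- (k.+1%:R * l1 (map_mx intr N))) :> R.
  rewrite /X -expRM_natl -expRD; congr expR; rewrite -[in RHS]natr1 /L /=; ring.
by apply: le_of_eq => /=; ring.
Qed.

Let Oy j : O 0 (fun p => y p.2 0 j).
Proof.
apply: aff_ord; have := aff_dot (row j B^T) (b 0 j).
congr aff; apply/funext => p; rewrite mxE; congr (_ + _); rewrite dotE mxE.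
by apply: eq_bigr => k _; rewrite !mxE.
Qed.

Lemma ord_ev P : O 0 (fun p => ev P (y p.2)).
Proof.
elim/mpoly_linear_ind: P => [|a P Q HP HQ|j P HP].
- by apply: (eq_ord _ (ord_cst dom fst X 1)) => p _; rewrite ev1.
- have H := ordD h01 X1 one_ge0 (ordM (ord_cst dom fst X a) HP) HQ.
  by apply: (eq_ord _ H) => p _; rewrite evD evZ.
by apply: (eq_ord _ (ordM (Oy j) HP)) => p _; rewrite evM ev_X.
Qed.

Let dirD (P : MP) N := \sum_k w 0 k * ev (D k P) (y N).

Let ord_dirD P : O 0 (fun p => dirD P p.2).
Proof.
rewrite /dirD; elim: (index_enum _) => [|k r IH].
  by apply: (eq_ord _ (ord_cst dom fst X 0)) => p _; rewrite big_nil.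
have H := ordD h01 X1 one_ge0 (ordM (ord_cst dom fst X (w 0 k)) (ord_ev (D k P))) IH.
by apply: (eq_ord _ H) => p _; rewrite big_cons.
Qed.

Let dirD_X j P N : dirD (mX R j * P) N = w 0 j * ev P (y N) + y N 0 j * dirD P N.
Proof.
rewrite /dirD mulr_sumr.
rewrite (eq_bigr (fun k => (k == j)%:R * (w 0 k * ev P (y N)) + y N 0 j * (w 0 k * ev (D k P) (y N)))).
  rewrite big_split /=; congr (_ + _); rewrite (bigD1 j)//= eqxx mul1r big1 ?addr0//.
  by move=> k /negbTE ->; rewrite mul0r.
by move=> k _; rewrite D_X evD evZ evM ev_X; ring.
Qed.

Lemma ord_ev_taylor P : O 2 (fun p =>
  ev P (y p.2 + p.1%:C *: w) - ev P (y p.2) - p.1%:C * dirD P p.2).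
Proof.
elim/mpoly_linear_ind: P => [|a P Q HP HQ|j P HP].
- apply: (@eq_ord _ _ _ _ _ _ _ (fun p => p.1%:C * (p.1%:C * 0))); last first.
    by apply: (ordM (i := 1)) => //; apply: (ordM (i := 1) (j := 0)) => //; exact: ord_cst.
  move=> p _; rewrite !ev1 /dirD big1 ?mulr0 ?subr0 ?subrr// => k _.
  by rewrite -mpoly.mpolyC1 mpoly.mderivC /ev mpoly.meval0 mulr0.
- apply: (eq_ord _ (ordD h01 X1 one_ge0 (ordM (i := 0) (ord_cst _ _ _ a) HP) HQ)) => p _.
  rewrite !evD !evZ; have -> : dirD (a *: P + Q) p.2 = a * dirD P p.2 + dirD Q p.2.
    rewrite /dirD mulr_sumr -big_split; apply: eq_bigr => k _ /=.
    by rewrite linearP evD evZ; ring.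
  ring.
have O1 := ordM (Oy j) HP.
have O2 := ordM (ordM (i := 1) Ot (ord_cst dom fst X (w 0 j))) HP.
have O3 := ordM (ordM Ot Ot) (ordM (ord_cst dom fst X (w 0 j)) (ord_dirD P)).
have O2' := ord_le h01 X1 one_ge0 (leqnSn 2) O2.
apply: (eq_ord _ (ordD h01 X1 one_ge0 (ordD h01 X1 one_ge0 O1 O2') O3)) => p _.
by rewrite !evM !ev_X dirD_X [(y p.2 + _) _ _]mxE [(_ *: w) _ _]mxE; ring.
Qed.

Let E (p : pt) : C := p.1%:C * y1 p.2 + p.1%:C ^+ 2 * c.

(** One expansion for both sides of the identity: the point of evaluation moves by t w while the
    exponent gains t y1 + t^2 c. The remainder is O(t^2) after summation over N. *)
Lemma gaussian_taylor P : exists2 M, 0 <= M & forall t, 0 <= t <= 1 ->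
  forall A : {fset 'rV[int]_d}, \sum_(N <- A) normc (
    ev P (y N + t%:C *: w) * (th N * cexp (t%:C * y1 N + t%:C ^+ 2 * c))
    - ev P (y N) * th N - t%:C * ((dirD P N + y1 N * ev P (y N)) * th N)) <= M * t ^+ 2.
Proof.
pose f (p : pt) := ev P (y p.2 + p.1%:C *: w) * (th p.2 * cexp (E p))
    - ev P (y p.2) * th p.2 - p.1%:C * ((dirD P p.2 + y1 p.2 * ev P (y p.2)) * th p.2).
suff /bsum_ord[M M0 H] : OG 2 f by exists M.
have aE : aff E.
  apply: affD; first by apply: affM; [exact: bnd_t | exact: aff_dot].
  apply: affM; last exact: aff_cst.
  exists 1; split=> // p /andP[t0 t1]; rewrite -rmorphXn normc_real ger0_norm ?exprn_ge0//.
  by rewrite exprn_ile1.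
have OE : O 1 E.
  apply: (@eq_ord _ _ _ _ _ _ _ (fun p => p.1%:C * (y1 p.2 + p.1%:C * c))).
    by move=> p _; rewrite /E; ring.
  apply: (ordM (i := 1) (j := 0)) => //; apply: ordD => //; first exact/aff_ord/aff_dot.
  apply: aff_ord; apply: affM; [exact: bnd_t | exact: aff_cst].
have Oth : OG 0 (fun p => th p.2).
  by exists 1, 0%N; split=> // p _; rewrite !mul1r.
have Othe : OG 0 (fun p => th p.2 * cexp (E p)).
  by apply: (eq_ord _ (ordM (aff_cexp aE) Oth)) => p _; rewrite mulrC.
have Orest : OG 2 (fun p => th p.2 * exp_rest (E p)) by apply: (ord_rest h01 X1 (j := 1)).
have O1 := ordM (ord_ev_taylor P) Othe.
have O2 := ordM (ord_ev P) Orest.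
have O3 := ordM (ordM (ordM Ot Ot) (ordM (ord_cst dom fst X c) (ord_ev P))) Oth.
have O4 := ord_le h01 X1 G0 (leqnSn 2) (ordM (ordM Ot (ord_dirD P)) Orest).
have O5 := ordM (ordM Ot (ord_dirD P)) (ordM OE Oth).
have OGD := ordD h01 X1 G0.
apply: (eq_ord _ (OGD _ _ _ (OGD _ _ _ (OGD _ _ _ O1 O2) O3) (OGD _ _ _ O4 O5))) => p _.
by rewrite /f /exp_rest /E; ring.
Qed.

Lemma bsum_poly_gauss P : bsum (fun N => normc (ev P (y N) * th N)).
Proof.
have Oth : OG 0 (fun p => th p.2).
  by exists 1, 0%N; split=> // p _; rewrite !mul1r.
have [M M0 H] := bsum_ord (ordM (ord_ev P) Oth).
by exists (M * 0 ^+ 0) => A; apply: (H 0); rewrite lexx ler01.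
Qed.

End GaussianTaylor.

(** * Differentiating the Jacobi identity in the character *)

Section PolynomialJacobi.
Variables (R : realType) (d : nat).
Local Notation C := R[i].
Local Notation MP := (mpoly.mpoly d C).
Local Notation D := mpoly.mderiv.

(** The remainders are O(t^2) after summation, so subtracting the identities at t and at 0 and
    dividing by t gives the identity for the first order terms. *)
Lemma tsum_deriv (T : choiceType) (f g : R -> T -> C) (f' g' : T -> C) (c : C) :
  (forall t, 0 <= t <= 1 -> bsum (fun N => normc (f t N))) ->
  (forall t, 0 <= t <= 1 -> bsum (fun N => normc (g t N))) ->
  bsum (fun N => normc (f' N)) -> bsum (fun N => normc (g' N)) ->
  (exists M, forall t, 0 <= t <= 1 -> forall A : {fset T},
     \sum_(N <- A) normc (f t N - f 0 N - t%:C * f' N) <= M * t ^+ 2) ->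
  (exists M, forall t, 0 <= t <= 1 -> forall A : {fset T},
     \sum_(N <- A) normc (g t N - g 0 N - t%:C * g' N) <= M * t ^+ 2) ->
  (forall t, 0 <= t <= 1 -> tsum (f t) = c * tsum (g t)) ->
  tsum f' = c * tsum g'.
Proof.
move=> bf bg bf' bg' [M HM] [M' HM'] fg.
have t0 : 0 <= (0 : R) <= 1 by rewrite lexx ler01.
have sumD (u : R -> T -> C) (u' : T -> C) m : (forall t, 0 <= t <= 1 -> bsum (fun N => normc (u t N))) ->
    bsum (fun N => normc (u' N)) ->
    (forall t, 0 <= t <= 1 -> forall A : {fset T},
      \sum_(N <- A) normc (u t N - u 0 N - t%:C * u' N) <= m * t ^+ 2) ->
    forall t, 0 <= t <= 1 -> normc (tsum (u t) - tsum (u 0) - t%:C * tsum u') <= m * t ^+ 2.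
  move=> bu bu' H t tt; apply: (hasum_le _ (H t tt)).
  by apply: hasumB (hasumZ _ (tsumP bu')); apply: hasumB; exact/tsumP/bu.
have c0 := normc_ge0 c.
apply/eqP; rewrite -subr_eq0; apply/eqP/eq0_normc/eqP.
rewrite eq_le normc_ge0 andbT; apply/ler_addgt0Pr => e e0; rewrite add0r.
pose m := `|M| + normc c * `|M'| + 1.
have m0 : 0 < m by rewrite ltr_wpDl ?addr_ge0 ?mulr_ge0.
(* The total error is at most m t^2; after division by t it is m t <= e. *)
pose t := Num.min 1 (e / m).
have t1 : 0 < t by rewrite lt_min ltr01 divr_gt0.
have tt : 0 <= t <= 1 by rewrite (ltW t1) ge_min lexx.
have te : t * m <= e by rewrite -ler_pdivlMr// ge_min lexx orbT.
have H1 := sumD _ _ _ bf bf' HM t tt; have H2 := sumD _ _ _ bg bg' HM' t tt.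
apply: le_trans te; rewrite -(ler_pM2l t1).
have -> : t * normc (tsum f' - c * tsum g') =
    normc (c * (tsum (g t) - tsum (g 0) - t%:C * tsum g')
      - (tsum (f t) - tsum (f 0) - t%:C * tsum f')).
  rewrite !fg// -[t in LHS]gtr0_norm// -normc_real -normcM; congr normc; ring.
apply: le_trans (le_normcD _ _) _; rewrite normcN normcM.
have t2 : 0 <= t ^+ 2 by rewrite exprn_ge0// ltW.
have H3 : normc c * normc (tsum (g t) - tsum (g 0) - t%:C * tsum g') <= normc c * (`|M'| * t ^+ 2).
  by rewrite ler_wpM2l//; apply: le_trans H2 _; rewrite ler_wpM2r// ler_norm.
have H4 : normc (tsum (f t) - tsum (f 0) - t%:C * tsum f') <= `|M| * t ^+ 2.
  by apply: le_trans H1 _; rewrite ler_wpM2r// ler_norm.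
apply: le_trans (lerD H3 H4) _; have -> : t * (t * m) = t ^+ 2 * m by ring.
rewrite /m; lra.
Qed.

Lemma dot_delta (v : 'rV[C]_d) j : dot (delta_mx 0 j) v = v 0 j.
Proof.
rewrite dotE (bigD1 j)//= mxE !eqxx mul1r big1 ?addr0// => k /negbTE kj.
by rewrite mxE kj mul0r.
Qed.

Lemma piC_neq0 : pi%:C != 0 :> C.
Proof. by rewrite -(rmorph0 (real_complex R)) (inj_eq (@complexI R)) gt_eqF ?pi_gt0. Qed.

Section Fixed.
Variables (W : 'M[C]_d) (h : 'rV[C]_d).
Hypothesis WS : siegel W.
Let V := invmx W.
Let tau : 'M[C]_d := (- (4 * pi%:C * 'i%R)^-1) *: V.
Let Wu := siegel_unit WS.

Let Ws : W^T = W. Proof. by case: WS. Qed.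
Let Vs : V^T = V. Proof. by rewrite /V trmx_inv Ws. Qed.
Let taus : tau^T = tau. Proof. by rewrite linearZ /= Vs. Qed.

Definition gauss_sum (q : MP) (k : 'rV[C]_d) (N : 'rV[int]_d) : C :=
  ev q (zC R N + h) * e2pi (quad W (zC R N + h) / 2 + dot (zC R N + h) k).

(** On the dual side k shifts the lattice and h becomes the character. The point -(N + k) W^-1 is
    the gradient in k of the exponent -W^-1[N + k]/2. *)
Definition dual_gauss_sum (q : MP) (k : 'rV[C]_d) (N : 'rV[int]_d) : C :=
  ev (expL tau q) (- ((zC R N + k) *m V)) * e2pi (- quad V (zC R N + k) / 2 - dot (zC R N) h).

Let c1 k := e2pi (quad W h / 2 + dot h k).
Let c2 k := e2pi (- quad V k / 2).

Let gauss_sumE q k N : gauss_sum q k N =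
  c1 k * (ev q (zC R N *m 1%:M + h) * thterm W (h *m W + k) (zC R N)).
Proof.
rewrite mulmx1 [RHS]mulrCA; congr (_ * _); rewrite /c1 /thterm -e2piD quadD// dotDl dotDr.
by congr e2pi; by field.
Qed.

Let dual_gauss_sumE q k N : dual_gauss_sum q k N =
  c2 k * (ev (expL tau q) (zC R N *m (- V) + - (k *m V)) * thterm (- V) (- (k *m V) - h) (zC R N)).
Proof.
rewrite mulmxN -opprD -mulmxDl [RHS]mulrCA; congr (_ * _).
rewrite /c2 /thterm -e2piD quadD// quadN dotDr !dotNr.
by congr e2pi; by field.
Qed.

Let NVS : siegel (- V). Proof. exact: siegel_Ninv. Qed.

Lemma bsum_gauss_sum q k : bsum (fun N => normc (gauss_sum q k N)).
Proof.
have := bsumZ (normc_ge0 (c1 k)) (bsum_poly_gauss (h *m W + k) 1%:M h WS q).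
by apply: bsum_le => N; rewrite gauss_sumE -normcM.
Qed.

Lemma bsum_dual_gauss_sum q k : bsum (fun N => normc (dual_gauss_sum q k N)).
Proof.
have := bsumZ (normc_ge0 (c2 k)) (bsum_poly_gauss (- (k *m V) - h) (- V) (- (k *m V)) NVS (expL tau q)).
by apply: bsum_le => N; rewrite dual_gauss_sumE -normcM.
Qed.

Let i2pi : C := 2 * pi%:C * 'i%R.

Lemma gauss_sum_taylor q k j : exists M, forall t, 0 <= t <= 1 -> forall A : {fset 'rV[int]_d},
  \sum_(N <- A) normc (gauss_sum q (k + t%:C *: delta_mx 0 j) N - gauss_sum q (k + 0%:C *: delta_mx 0 j) N
    - t%:C * (i2pi * gauss_sum (mX R j * q) k N)) <= M * t ^+ 2.
Proof.
have [M M0 H] := gaussian_taylor (h *m W + k) 1%:M h 0 (i2pi *: delta_mx 0 j) (i2pi * h 0 j) 0 WS q.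
exists (normc (c1 k) * M) => t t01 A; rewrite -mulrA.
apply: le_trans (ler_wpM2l (normc_ge0 _) (H t t01 A)); rewrite mulr_sumr; apply: ler_sum => N _.
rewrite -normcM; set u := (X in normc X <= _); set v := (X in _ <= normc X).
suff uv : u = v by rewrite uv.
rewrite /u /v scale0r addr0 (gauss_sumE q k) (gauss_sumE (mX R j * q)) evM ev_X.
rewrite /gauss_sum dotDr dotZr addrA e2piD -/(gauss_sum q k N).
rewrite [dot _ (delta_mx 0 j)]dotC dot_delta.
rewrite mulrA -/(gauss_sum q k N) gauss_sumE dotZr [dot _ (delta_mx 0 j)]dotC dot_delta.
rewrite scaler0 addr0 mulr0 addr0 big1 ?add0r => [|l _]; last by rewrite mxE mul0r.
rewrite mulmx1 [(_ + h) 0 j]mxE e2piE.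
rewrite (_ : 2 * _ * _ * _ = t%:C * (i2pi * zC R N 0 j + i2pi * h 0 j)); last by rewrite /i2pi; ring.
ring.
Qed.

(** The first order term has two sources: the exponent contributes the factor X_j and the moving
    point of evaluation the gradient; together they are the rule [expL_X]. *)
Lemma dual_gauss_sum_taylor q k j : exists M, forall t, 0 <= t <= 1 -> forall A : {fset 'rV[int]_d},
  \sum_(N <- A) normc (dual_gauss_sum q (k + t%:C *: delta_mx 0 j) N
      - dual_gauss_sum q (k + 0%:C *: delta_mx 0 j) N
    - t%:C * (i2pi * dual_gauss_sum (mX R j * q) k N)) <= M * t ^+ 2.
Proof.
pose e : 'rV[C]_d := delta_mx 0 j.
have [M M0 H] := gaussian_taylor (- (k *m V) - h) (- V) (- (k *m V)) (- (e *m V)) (- i2pi *: (e *m V))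
  (- i2pi * dot k (e *m V)) (- (pi%:C * 'i%R) * quad V e) NVS (expL tau q).
exists (normc (c2 k) * M) => t t01 A; rewrite -mulrA.
apply: le_trans (ler_wpM2l (normc_ge0 _) (H t t01 A)); rewrite mulr_sumr; apply: ler_sum => N _.
rewrite -normcM; set u := (X in normc X <= _); set v := (X in _ <= normc X).
suff uv : u = v by rewrite uv.
set x := zC R N + k; set r := expL tau q.
have yE : zC R N *m - V + - (k *m V) = - (x *m V) by rewrite mulmxN -opprD -mulmxDl.
have y1E : dot (zC R N) (- i2pi *: (e *m V)) + - i2pi * dot k (e *m V) = i2pi * (- (x *m V)) 0 j.
  rewrite dotZr -mulrDr -dotDl -/x -(dot_delta (- (x *m V))) dotNr -dot_mulmx// dotC.
  by rewrite mulrN mulNr.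
have thE : c2 k * thterm (- V) (- (k *m V) - h) (zC R N) = e2pi (- quad V x / 2 - dot (zC R N) h).
  rewrite /c2 /thterm -e2piD [quad V x]quadD// quadN dotDr !dotNr; congr e2pi; by field.
transitivity (ev r (- (x *m V) + t%:C *: - (e *m V)) *
    (e2pi (- quad V x / 2 - dot (zC R N) h) *
     cexp (t%:C * (i2pi * (- (x *m V)) 0 j) + t%:C ^+ 2 * (- (pi%:C * 'i%R) * quad V e)))
   - ev r (- (x *m V)) * e2pi (- quad V x / 2 - dot (zC R N) h)
   - t%:C * (i2pi * (((- (x *m V)) 0 j * ev r (- (x *m V)) + 2 * \sum_i tau j i * ev (D i r) (- (x *m V))) *
      e2pi (- quad V x / 2 - dot (zC R N) h)))).
  rewrite /u /dual_gauss_sum scale0r addr0 -/x expL_X// -/r evD evM ev_X evZ.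
  congr (_ - _ - t%:C * (i2pi * ((_ + 2 * _) * _))); last first.
    by rewrite [LHS]ev_sum; apply: eq_bigr => i _; rewrite evZ.
  rewrite addrA -/x mulmxDl opprD -scalemxAl -scalerN; congr (_ * _).
  rewrite -(dot_delta (- (x *m V))) dotNr -dot_mulmx// -/e.
  rewrite e2piE e2piE -cexpD; congr cexp.
  rewrite quadD// quadZ -scalemxAl dotZr [dot x _]dotC /i2pi; by field.
rewrite /v -/r y1E yE -thE.
(* Since 2 (2 pi i) tau = -W^-1; this equation is the origin of the constant 4 pi i in tau. *)
have -> : \sum_k0 (- (e *m V)) 0 k0 * ev (D k0 r) (- (x *m V)) =
    2 * i2pi * \sum_i tau j i * ev (D i r) (- (x *m V)).
  rewrite mulr_sumr; apply: eq_bigr => i _; rewrite mulrA; congr (_ * _).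
  rewrite mxE -rowE [row _ _ _ _]mxE [tau j i]mxE /i2pi.
  have := neq0Ci C; have := piC_neq0.
  by move: (pi%:C) ('i%R : C) => a b a0 b0; field; rewrite a0 b0.
ring.
Qed.

(** For q = 1 this is the Jacobi identity at z = h W + k. A factor X_j is the derivative in k along
    e_j, so the induction hypothesis is used at all characters near k. *)
Lemma poly_jacobi q k :
  tsum (gauss_sum q k) = kappa W * tsum (dual_gauss_sum q k).
Proof.
elim/mpoly_linear_ind: q => [|c P Q HP HQ|j P HP] in k *.
- transitivity (c1 k * (kappa W * tsum (fun N : 'rV[int]_d => e2pi (- quad V (zC R N + (h *m W + k)) / 2)))).
    rewrite -jacobi// -tsumZ; last exact: bsum_thterm.
    by apply: eq_tsum => N; rewrite gauss_sumE ev1 mul1r.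
  rewrite mulrCA; congr (_ * _); rewrite -tsumZ; last exact: bsum_dual.
  apply: eq_tsum => N; rewrite /dual_gauss_sum expL1 ev1 mul1r /c1 -e2piD; congr e2pi.
  rewrite [h *m W + k]addrC addrA quadD// mulmxK// [quad V (h *m W)]quadE mulmxK//.
  rewrite [dot h (h *m W)]dotC -quadE (dotDl (zC R N)) [dot k h]dotC; by field.
- have bP := bsum_gauss_sum P k; have bQ := bsum_gauss_sum Q k.
  have bP' := bsum_dual_gauss_sum P k; have bQ' := bsum_dual_gauss_sum Q k.
  have -> : tsum (gauss_sum (c *: P + Q) k) = c * tsum (gauss_sum P k) + tsum (gauss_sum Q k).
    apply: hasumE; apply: eq_hasum (hasumD (hasumZ c (tsumP bP)) (tsumP bQ)) => N.
    by rewrite /gauss_sum evD evZ; ring.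
  have -> : tsum (dual_gauss_sum (c *: P + Q) k) = c * tsum (dual_gauss_sum P k) + tsum (dual_gauss_sum Q k).
    apply: hasumE; apply: eq_hasum (hasumD (hasumZ c (tsumP bP')) (tsumP bQ')) => N.
    by rewrite /dual_gauss_sum linearP /= evD evZ; ring.
  by rewrite HP HQ mulrDr mulrCA.
have i0 : i2pi != 0 by rewrite /i2pi !mulf_neq0 ?neq0Ci ?piC_neq0 ?pnatr_eq0.
have bX := bsum_gauss_sum (mX R j * P) k; have bX' := bsum_dual_gauss_sum (mX R j * P) k.
have bi (g : 'rV[int]_d -> C) : bsum (fun N => normc (g N)) -> bsum (fun N => normc (i2pi * g N)).
  by move=> bg; apply: (bsum_le _ (bsumZ (normc_ge0 i2pi) bg)) => N; rewrite normcM.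
have := tsum_deriv (fun t _ => bsum_gauss_sum P (k + t%:C *: delta_mx 0 j))
  (fun t _ => bsum_dual_gauss_sum P (k + t%:C *: delta_mx 0 j)) (bi _ bX) (bi _ bX')
  (gauss_sum_taylor P k j) (dual_gauss_sum_taylor P k j) (fun t _ => HP (k + t%:C *: delta_mx 0 j)).
rewrite (tsumZ i2pi bX) (tsumZ i2pi bX') mulrCA => H.
exact: (mulfI i0).
Qed.

End Fixed.
End PolynomialJacobi.

(** * The theta transformation *)

Section InverseImaginaryPart.

Lemma mul_kron_inv (F : fieldType) m n (A : 'M[F]_m) (Z : 'M[F]_n) (U : 'M[F]_(m, n)) :
  A \in unitmx -> mxvec (A *m U) *m kron (invmx A) Z = mxvec (U *m Z).
Proof. by move=> Au; rewrite mul_kron !mulmxA mulVmx// mul1mx. Qed.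

Lemma mul_kron1 (F : fieldType) m n (N : 'M[F]_n) (U : 'M[F]_(m, n)) :
  mxvec U *m kron 1%:M N = mxvec (U *m N).
Proof. by rewrite mul_kron mul1mx. Qed.

Lemma scale_kron_sym (F : fieldType) m n (A : 'M[F]_m) (Z : 'M[F]_n) c :
  A^T = A -> Z^T = Z -> (c *: kron A Z)^T = c *: kron A Z.
Proof. by move=> As Zs; rewrite linearZ /= kron_sym. Qed.

Lemma kron_cancel (F : fieldType) m n (A : 'M[F]_m) (Z X : 'M[F]_n) (a b c : F) :
  b = - (c * a) -> b *: kron A (- Z) + c *: kron A (X - a *: Z) = c *: kron A X.
Proof.
move=> ->; rewrite -mulrN -scalerA -scalerDr kron_linear; congr (_ *: kron _ _).
by rewrite scaleNr scalerN opprK addrC subrK.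
Qed.

Lemma kron_inv_Ninv (F : fieldType) m n (A : 'M[F]_m) (Z : 'M[F]_n) :
  A \in unitmx -> Z \in unitmx -> invmx (kron A (- invmx Z)) = kron (invmx A) (- Z).
Proof.
move=> Au Zu; have H : - invmx Z *m - Z = 1%:M by rewrite mulNmx mulmxN opprK mulVmx.
have [NVu _] := mulmx1_unit H.
by rewrite kron_inv// -[- Z in RHS](mulKmx NVu) H mulmx1.
Qed.

Lemma quad_dual_kron (F : fieldType) m n (A : 'M[F]_m) (Z : 'M[F]_n) (U : 'M[F]_(m, n)) :
  A \in unitmx -> A^T = A ->
  quad (kron (invmx A) (- Z)) (mxvec (A *m U)) = - \tr (U^T *m A *m U *m Z).
Proof.
move=> Au As; rewrite quadE mul_kron_inv// dot_mxvec trmx_mul As.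
by rewrite mulmxN mulmxN linearN !mulmxA.
Qed.

Lemma kron_congruence (F : fieldType) m n (A : 'M[F]_m) (N Y : 'M[F]_n) (c : F) :
  (kron 1%:M N)^T *m (c *: kron A Y) *m kron 1%:M N = c *: kron A (N^T *m Y *m N).
Proof. by rewrite kron_tr trmx1 -scalemxAr -scalemxAl !kronM mulmx1 mul1mx. Qed.

Lemma sqr_sym_inv (F : fieldType) n (S : 'M[F]_n) : S^T = S -> S \in unitmx ->
  S^T *m invmx (S *m S) *m S = 1%:M.
Proof.
move=> -> Su; have SSu : S *m S \in unitmx by rewrite unitmx_mul Su.
have -> : invmx (S *m S) = invmx S *m invmx S.
  apply: (can_inj (mulKmx SSu)); rewrite mulmxV// mulmxA mulmxK//.
  by rewrite mulmxV.
by rewrite mulmxA mulmxV// mul1mx mulVmx.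
Qed.

(** Zb stands for the conjugate of Z and c for 2i. As Zb^-1 - Z^-1 = Z^-1 (Z - Zb) Zb^-1, the
    inverse of Y' is Zb Y^-1 Z, in which Zb = Z - c Y. *)
Lemma invmx_diff_inv (F : fieldType) n (Z Zb Y Y' : 'M[F]_n) (c : F) : c != 0 ->
  Z \in unitmx -> Zb \in unitmx -> Y \in unitmx ->
  c *: Y = Z - Zb -> c *: Y' = invmx Zb - invmx Z ->
  invmx Y' = Z *m invmx Y *m Z - c *: Z.
Proof.
move=> c0 Zu Zbu Yu YE Y'E; set X := RHS.
have XE : X = Zb *m invmx Y *m Z.
  have -> : Zb = Z - c *: Y by rewrite YE opprB addrC subrK.
  by rewrite !mulmxBl -!scalemxAl mulmxV// mul1mx.
have YX : Y' *m X = 1%:M.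
  apply: (scalerI c0); rewrite scalemxAl Y'E XE mulmxBl !mulmxA mulVmx// mul1mx.
  have -> : invmx Y *m Z = invmx Z *m Z *m invmx Y *m Z by rewrite mulVmx// mul1mx.
  rewrite -!mulmxBl -mulmxBr -YE -scalemxAr -!scalemxAl; congr (_ *: _).
  by rewrite -(mulmxA (invmx Z)) mulmxV// mulmx1 mulVmx.
have Y'u : Y' \in unitmx by case: (mulmx1_unit YX).
by rewrite -[RHS]mul1mx -(mulVmx Y'u) -mulmxA YX mulmx1.
Qed.

Variable R : realType.
Local Notation C := R[i].

Lemma toCmx_Immx n (M : 'M[C]_n) : (2 * 'i%R) *: toCmx (Immx M) = M - map_mx conjc M.
Proof.
apply/matrixP => i j; rewrite !mxE; case: (M i j) => a b.
by apply: eqC => /=; ring.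
Qed.

Lemma siegel_Im_unit n (Z : 'M[C]_n) : siegel Z -> toCmx (Immx Z) \in unitmx.
Proof.
move=> [Zs Yp]; have Ys := Immx_sym Zs.
by rewrite map_unitmx unitmxE unitfE gt_eqF// posdef_det_gt0.
Qed.

Lemma invmx_Im_Ninv n (Z : 'M[C]_n) : siegel Z ->
  invmx (toCmx (Immx (- invmx Z))) = Z *m invmx (toCmx (Immx Z)) *m Z - (2 * 'i%R) *: Z.
Proof.
move=> ZS; have Zu := siegel_unit ZS.
apply: (@invmx_diff_inv _ _ Z (map_mx conjc Z)).
- by rewrite mulf_neq0 ?neq0Ci ?pnatr_eq0.
- by [].
- by rewrite map_unitmx.
- exact: siegel_Im_unit.
- exact: toCmx_Immx.
by rewrite toCmx_Immx map_mxN map_invmx opprK addrC.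
Qed.

End InverseImaginaryPart.

Section HomogeneousPolynomials.
Variables (R : realType) (m n alpha : nat).
Local Notation C := R[i].
Variable P : mpoly.mpoly (m * n) C.
Hypothesis P_homog : det_homog alpha P.

(** Substituting U N multiplies P by (det N)^alpha, while the chain rule replaces Y in the heat
    operator by the congruent matrix N^T Y N. *)
Lemma homog_expL (c : C) (A : 'M[C]_m) (Y N : 'M[C]_n) (U : 'M[C]_(m, n)) :
  ev (expL (c *: kron A (N^T *m Y *m N)) P) (mxvec (U *m N)) =
  \det N ^+ alpha * ev (expL (c *: kron A Y) P) (mxvec U).
Proof.
have PN : pullback (kron 1%:M N) (\det N ^+ alpha *: P) P.
  move=> v; rewrite -[v]vec_mxK mul_kron mul1mx evZ.
  exact/esym/P_homog.
rewrite -(kron_congruence A N Y c) -(mul_kron1 N U) -(pullback_expL (c *: kron A Y) PN).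
have -> : expL (c *: kron A Y) (\det N ^+ alpha *: P) = \det N ^+ alpha *: expL (c *: kron A Y) P.
  exact: linearZ.
exact: evZ.
Qed.

End HomogeneousPolynomials.

(** * Splitting the dual lattice into cosets *)

Section CosetReindexing.
Variables (R : realType) (m n : nat) (A : 'M[int]_m).
Local Notation C := R[i].
Let AR : 'M[R]_m := map_mx intr A.
Hypothesis Au : AR \in unitmx.

Lemma map_intr_inj p q : injective (fun N : 'M[int]_(p, q) => map_mx intr N : 'M[R]_(p, q)).
Proof.
move=> N N' H; apply/matrixP => i j; apply: (@intr_inj R).
by have := congr1 (fun M : 'M[R]_(p, q) => M i j) H; rewrite !mxE.
Qed.

(** If N_i is A times the i-th representative, then N_i + A N runs through every integral matrix
    exactly once. *)
Lemma tsum_coset (reps : seq 'M[R]_(m, n)) (f : 'M[R]_(m, n) -> C) : coset_reps A reps ->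
  bsum (fun M : 'M[int]_(m, n) => normc (f (invmx AR *m map_mx intr M))) ->
  tsum (fun M : 'M[int]_(m, n) => f (invmx AR *m map_mx intr M)) =
  \sum_(J <- reps) tsum (fun N : 'M[int]_(m, n) => f (J + map_mx intr N)).
Proof.
move=> [us dual inj surj] bf; pose r := size reps.
have /choice[N0 HN0] (i : 'I_r) : exists N : 'M[int]_(m, n), reps`_i = invmx AR *m map_mx intr N.
  exact/dual/mem_nth.
pose h (p : 'I_r * 'M[int]_(m, n)) : 'M[int]_(m, n) := N0 p.1 + A *m p.2.
have hE p : invmx AR *m map_mx intr (h p) = reps`_p.1 + map_mx intr p.2.
  by rewrite map_mxD mulmxDr -HN0 map_mxM mulmxA mulVmx// mul1mx.
have hI : injective h.
  move=> [i N] [j N'] /(congr1 (fun M => invmx AR *m map_mx intr M : 'M[R]_(m, n))).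
  rewrite !hE /= => E.
  have ij : reps`_i = reps`_j.
    apply: inj; rewrite ?mem_nth//; exists (N' - N); rewrite map_mxB.
    have -> : map_mx intr N' = reps`_i + map_mx intr N - reps`_j by rewrite E addrC addKr.
    by rewrite addrAC addrK.
  have {}ij : i = j.
    by have := nth_uniq 0 (ltn_ord i) (ltn_ord j) us; rewrite ij eqxx => /esym/eqP/val_inj.
  by subst j; move/addrI: E => /map_intr_inj ->.
have /choice[h' h'K] M : exists p, h p = M.
  have [|J Jr [N HN]] := surj (invmx AR *m map_mx intr M); first by exists M.
  have Jlt : (index J reps < r)%N by rewrite index_mem.
  exists (Ordinal Jlt, N); apply: map_intr_inj; apply: (can_inj (mulKVmx Au)).
  by rewrite hE /= nth_index// -HN addrC subrK.
have hK : cancel h h' by move=> p; apply: hI; rewrite h'K.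
rewrite (tsum_bij hK h'K bf).
pose g (p : 'I_r * 'M[int]_(m, n)) := f (reps`_p.1 + map_mx intr p.2).
have bg : bsum (fun p => normc (g p)).
  by apply: bsum_le (bsum_inj hI bf) => p; rewrite hE.
have -> : tsum (fun p => f (invmx AR *m map_mx intr (h p))) = tsum g.
  by apply: eq_tsum => p; rewrite hE.
by rewrite (hasum_unique (hasum_fubini_l bg) (hasum_fin _)) (big_nth 0) big_mkord.
Qed.

End CosetReindexing.

Section ThetaAsGaussSum.
Variables (R : realType) (m n : nat) (A : 'M[int]_m) (alpha : nat).
Local Notation C := R[i].
Let AR : 'M[R]_m := map_mx intr A.
Let AC : 'M[C]_m := toCmx AR.
Hypotheses (A_sym : A^T = A) (A_posdef : posdefmx AR).
Variable P : mpoly.mpoly (m * n) C.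
Hypothesis P_homog : det_homog alpha P.
Let c8 : C := - (1 / (8 * pi%:C)).
Let p := exp_tr_laplacian c8 A P.

Let AR_sym : AR^T = AR. Proof. by apply/matrixP => i j; rewrite !mxE -{1}A_sym mxE. Qed.
Let ARu : AR \in unitmx.
Proof. by rewrite unitmxE unitfE gt_eqF// posdef_det_gt0. Qed.
Let ACE : map_mx intr A = AC.
Proof. by apply/matrixP => i j; rewrite !mxE rmorph_int. Qed.
Let AC_sym : AC^T = AC. Proof. exact: toCmx_sym. Qed.

Let pE : p = expL (c8 *: kron (invmx AC) 1%:M) P.
Proof.
have E : (invmx (map_mx intr A : 'M[C]_m))^T = invmx AC by rewrite trmx_inv ACE AC_sym.
by rewrite /p exp_tr_laplacian_expL E.
Qed.

(** The polynomial factor of theta including the power of det Y, in a form that involves Y^-1 in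
    place of the square root of Y. *)
Definition heat_poly (Z : 'M[C]_n) : mpoly.mpoly (m * n) C :=
  expL (c8 *: kron (invmx AC) (invmx (toCmx (Immx Z)))) P.

(** Homogeneity at N = S = Y^(1/2), where S^T Y^-1 S = 1; the factor (det S)^alpha cancels the power
    of det Y. *)
Lemma sqrt_heat_poly (Z : 'M[C]_n) (U : 'M[R]_(m, n)) : siegel Z ->
  (\det (Immx Z) `^ (- (alpha%:R / 2)))%:C * mxeval p (toCmx (U *m sqrtmx (Immx Z))) =
  ev (heat_poly Z) (mxvec (toCmx U)).
Proof.
move=> ZS; have [Zs Yp] := ZS.
have Ys := Immx_sym Zs.
have [Ss Sp SS] := sqrtmx_spec Ys Yp; set Y := Immx Z in Ys Yp Ss Sp SS *; set S := sqrtmx Y in Ss Sp SS *.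
have Yu := siegel_Im_unit ZS; rewrite -/Y in Yu.
have dS := posdef_det_gt0 Ss Sp; have dY := posdef_det_gt0 Ys Yp.
have Su : toCmx S \in unitmx by rewrite map_unitmx unitmxE unitfE gt_eqF.
have SE := sqr_sym_inv (toCmx_sym Ss) Su; rewrite -toCmx_mul SS in SE.
rewrite pE -SE.
rewrite toCmx_mul [mxeval _ _](homog_expL P_homog) mulrA.
have -> : \det (toCmx S) = (\det S)%:C by rewrite det_map_mx.
rewrite -rmorphXn -rmorphM /=.
suff -> : \det Y `^ (- (alpha%:R / 2)) * \det S ^+ alpha = 1 by rewrite mul1r.
have -> : \det Y = \det S `^ 2%:R by rewrite powR_mulrn ?ltW// -SS det_mulmx.
rewrite -powRrM -powR_mulrn ?ltW// -powRD; last by rewrite (gt_eqF dS) implybT.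
by rewrite (_ : _ + _ = 0) ?powRr0//; field.
Qed.

Let W (Z : 'M[C]_n) := kron AC Z.
Let vec (U : 'M[R]_(m, n)) : 'rV[C]_(m * n) := mxvec (toCmx U).

Definition theta_term (K : 'M[R]_(m, n)) (Z : 'M[C]_n) (U : 'M[R]_(m, n)) : C :=
  ev (heat_poly Z) (vec U) * e2pi (\tr (toCmx (U^T *m AR *m U) *m Z) / 2 + (\tr (K^T *m AR *m U))%:C).

Let zC_vec (H : 'M[R]_(m, n)) (N : 'M[int]_(m, n)) :
  zC R (mxvec N) + vec H = vec (H + map_mx intr N).
Proof. by apply/rowP => x; case/mxvec_indexP: x => i j; rewrite mxE zCE !(mxE, mxvecE) rmorphD addrC. Qed.

Let traceC d (M : 'M[R]_d) : (\tr M)%:C = \tr (toCmx M).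
Proof. by rewrite -trace_map_mx. Qed.

Lemma gauss_sum_theta (H K : 'M[R]_(m, n)) (Z : 'M[C]_n) (N : 'M[int]_(m, n)) :
  gauss_sum (W Z) (vec H) (heat_poly Z) (vec (AR *m K)) (mxvec N) =
  theta_term K Z (H + map_mx intr N).
Proof.
rewrite /gauss_sum (zC_vec H N) /theta_term; move: (H + _) => U.
congr (_ * _); congr (e2pi _); congr (_ / 2 + _).
  by rewrite [LHS]quad_kron toCmx_tr !toCmx_mul.
by rewrite [LHS]dot_mxvec toCmx_tr -toCmx_mul -traceC trmx_mul AR_sym.
Qed.

Lemma tsum_mxvec (f : 'rV[int]_(m * n) -> C) : bsum (fun N => normc (f N)) ->
  tsum f = tsum (fun N : 'M[int]_(m, n) => f (mxvec N)).
Proof. by apply: tsum_bij; [exact: mxvecK | exact: vec_mxK]. Qed.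

Let WS Z : siegel Z -> siegel (W Z). Proof. exact: siegel_kron. Qed.

Lemma bsum_theta_term (H K : 'M[R]_(m, n)) (Z : 'M[C]_n) : siegel Z ->
  bsum (fun N : 'M[int]_(m, n) => normc (theta_term K Z (H + map_mx intr N))).
Proof.
move=> ZS; have := bsum_gauss_sum (vec H) (WS ZS) (heat_poly Z) (vec (AR *m K)).
move/(bsum_inj (can_inj (@mxvecK int m n))); apply: bsum_le => N.
by rewrite gauss_sum_theta.
Qed.

Lemma thetaE (H K : 'M[R]_(m, n)) (Z : 'M[C]_n) : siegel Z ->
  theta A alpha p H K Z = tsum (fun N : 'M[int]_(m, n) => theta_term K Z (H + map_mx intr N)).
Proof.
move=> ZS; have [Zs Yp] := ZS.
have Ys := Immx_sym Zs.
have H0 (N : 'M[int]_(m, n)) := sqrt_heat_poly (H + map_mx intr N) ZS.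
have := bsum_theta_term H K ZS.
rewrite /theta_term /vec; under eq_fun do rewrite -H0 -mulrA; move=> b.
under [RHS]eq_tsum do rewrite -H0 -mulrA.
rewrite tsumZ_neq0//.
by rewrite -(rmorph0 (real_complex R)) (inj_eq (@complexI R)) gt_eqF// powR_gt0// posdef_det_gt0.
Qed.

Let vec_mul (U : 'M[R]_(m, n)) (Z : 'M[C]_n) :
  vec (AR *m U) *m kron (invmx AC) Z = mxvec (toCmx U *m Z).
Proof.
have ACu : AC \in unitmx by rewrite map_unitmx.
rewrite -(mul_kron_inv Z (toCmx U) ACu).
by rewrite /vec toCmx_mul.
Qed.

Lemma expL_heat_poly (Z : 'M[C]_n) : siegel Z ->
  expL (- (4 * pi%:C * 'i%R)^-1 *: kron (invmx AC) (- Z)) (heat_poly (- invmx Z)) =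
  expL (c8 *: kron (invmx AC) (Z^T *m invmx (toCmx (Immx Z)) *m Z)) P.
Proof.
move=> ZS; have [Zs Yp] := ZS; have [NZs _] := siegel_Ninv ZS.
have A's : (invmx AC)^T = invmx AC by rewrite trmx_inv AC_sym.
have ImS (M : 'M[C]_n) : M^T = M -> (toCmx (Immx M))^T = toCmx (Immx M).
  by move=> Ms; exact/toCmx_sym/Immx_sym.
have Ss : (c8 *: kron (invmx AC) (invmx (toCmx (Immx (- invmx Z)))))^T =
    c8 *: kron (invmx AC) (invmx (toCmx (Immx (- invmx Z)))).
  by apply: scale_kron_sym => //; rewrite trmx_inv ImS.
have Ts : (- (4 * pi%:C * 'i%R)^-1 *: kron (invmx AC) (- Z))^T =
    - (4 * pi%:C * 'i%R)^-1 *: kron (invmx AC) (- Z).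
  by apply: scale_kron_sym => //; rewrite linearN /= Zs.
apply: etrans (expL_expL P Ts Ss) _.
apply: (congr1 (fun M => expL M P)).
(* The terms linear in Z cancel because -1/(4 pi i) = 2i/(8 pi). *)
rewrite (invmx_Im_Ninv ZS) [Z^T]Zs; apply: kron_cancel.
have i2 : ('i%R : C) ^+ 2 = -1 by exact: sqrCi.
have := neq0Ci C; have := piC_neq0 R; rewrite /c8.
move: (pi%:C) ('i%R : C) i2 => a b b2 a0 b0.
by apply: (mulfI b0); field : b2; rewrite a0 b0.
Qed.

(** The dual point is N + A K = A U with U = A^-1 N + K. Writing N = A (U - K) in the character
    splits it into the character of -H at U and the constant with H^T A K. *)
Lemma dual_theta (H K : 'M[R]_(m, n)) (Z : 'M[C]_n) (N : 'M[int]_(m, n)) : siegel Z ->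
  dual_gauss_sum (W (- invmx Z)) (vec H) (heat_poly (- invmx Z)) (vec (AR *m K)) (mxvec N) =
  \det Z ^+ alpha * e2pi (\tr (H^T *m AR *m K))%:C *
  theta_term (- H) Z (invmx AR *m map_mx intr N + K).
Proof.
move=> ZS; set U := invmx AR *m map_mx intr N + K.
have AU : AR *m U = AR *m K + map_mx intr N by rewrite mulmxDr mulKVmx// addrC.
have Zu := siegel_unit ZS; have ACu : AC \in unitmx by rewrite map_unitmx.
rewrite /dual_gauss_sum (kron_inv_Ninv ACu Zu) (zC_vec (AR *m K) N) -AU (expL_heat_poly ZS).
have -> : - (vec (AR *m U) *m kron (invmx AC) (- Z)) = mxvec (toCmx U *m Z).
  by rewrite vec_mul mulmxN linearN opprK.
rewrite (homog_expL P_homog) /theta_term -!mulrA; congr (_ * _); rewrite [RHS]mulrCA; congr (_ * _).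
have -> : quad (kron (invmx AC) (- Z)) (vec (AR *m U)) = - \tr (toCmx (U^T *m AR *m U) *m Z).
  rewrite /vec toCmx_mul (quad_dual_kron Z (toCmx U) ACu AC_sym).
  by rewrite toCmx_tr !toCmx_mul.
have -> : dot (zC R (mxvec N)) (vec H) = (\tr (H^T *m AR *m U))%:C - (\tr (H^T *m AR *m K))%:C.
  have -> : zC R (mxvec N) = vec (map_mx intr N) by rewrite zCE /vec /toCmx !map_mxvec.
  rewrite [LHS]dot_mxvec toCmx_tr -toCmx_mul -traceC -rmorphB -linearB; congr (\tr _)%:C.
  by rewrite -mulmxBr /U addrK -mulmxA mulKVmx.
rewrite -e2piD; congr e2pi.
have -> : \tr ((- H)^T *m AR *m U) = - \tr (H^T *m AR *m U).
  by rewrite linearN !mulNmx linearN.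
rewrite rmorphN; by field.
Qed.

Lemma theta_Ninv (H K : 'M[R]_(m, n)) (Z : 'M[C]_n) (reps : seq 'M[R]_(m, n)) :
  siegel Z -> coset_reps A reps ->
  theta A alpha p H K (- invmx Z) =
  kappa (W (- invmx Z)) * (\det Z ^+ alpha * e2pi (\tr (H^T *m AR *m K))%:C *
    \sum_(J <- reps) theta A alpha p (J + K) (- H) Z).
Proof.
move=> ZS repsP; have NZS := siegel_Ninv ZS; have WNS := WS NZS.
have bG := bsum_gauss_sum (vec H) WNS (heat_poly (- invmx Z)) (vec (AR *m K)).
have bD := bsum_dual_gauss_sum (vec H) WNS (heat_poly (- invmx Z)) (vec (AR *m K)).
rewrite (thetaE H K NZS).
transitivity (tsum (gauss_sum (W (- invmx Z)) (vec H) (heat_poly (- invmx Z)) (vec (AR *m K)))).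
  rewrite (tsum_mxvec bG); apply: eq_tsum => N; exact/esym/gauss_sum_theta.
rewrite (poly_jacobi (vec H) WNS); congr (_ * _).
have bD' := bsum_inj (can_inj (@mxvecK int m n)) bD.
rewrite (tsum_mxvec bD) (eq_tsum (fun N => dual_theta H K N ZS)).
set c := _ * e2pi _; pose f (U : 'M[R]_(m, n)) := theta_term (- H) Z (U + K).
have bf : bsum (fun N : 'M[int]_(m, n) => normc (c * f (invmx AR *m map_mx intr N))).
  by apply: bsum_le bD' => N; rewrite (dual_theta H K N ZS).
have c0 : c != 0 by rewrite mulf_neq0 ?e2pi_neq0// expf_neq0// eigenvalues_neq0.
rewrite (tsumZ_neq0 c0 bf); congr (_ * _).
rewrite (tsum_coset ARu repsP); last first.
  apply: bsum_le (bsumZ (normc_ge0 c^-1) bf) => N.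
  by rewrite -normcM mulKf.
apply: eq_bigr => J _; rewrite (thetaE _ _ ZS); apply: eq_tsum => N.
by rewrite /f addrAC.
Qed.

End ThetaAsGaussSum.

Theorem proposition4p7 (R : realType) (m n : nat) (m_gt0 : (0 < m)%N)
    (n_gt0 : (0 < n)%N) (A : 'M[int]_m) (A_sym : A^T = A)
    (A_posdef : posdefmx (map_mx intr A : 'M[R]_m)) (alpha : nat)
    (P : mpoly.mpoly (m * n) R[i]) (P_homog : det_homog alpha P)
    (H K : 'M[R]_(m, n)) (Z : 'M[R[i]]_n) (Z_siegel : siegel Z)
    (reps : seq 'M[R]_(m, n)) (repsP : coset_reps A reps) :
  let p := exp_tr_laplacian (- (1 / (8 * pi%:C))) A P in
  theta A alpha p H K (- invmx Z) =
    cpow 'i (- ((m * n)%:R / 2))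
    * (((\det A)%:~R : R) `^ (- (n%:R / 2)))%:C
    * det_cpow Z (m%:R / 2 + alpha%:R)
    * e2pi (\tr (H^T *m map_mx intr A *m K))%:C
    * \sum_(J <- reps) theta A alpha p (J + K) (- H) Z.
Proof.
move=> p; rewrite /p (theta_Ninv A_sym A_posdef P_homog H K Z_siegel repsP).
have A_symR : (map_mx intr A : 'M[R]_m)^T = map_mx intr A.
  by apply/matrixP => i j; rewrite !mxE -{1}A_sym mxE.
rewrite (kappa_kron A_symR A_posdef Z_siegel) (det_cpowD _ _ Z_siegel) det_map_mx.
by rewrite !mulrA.
Qed.
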